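(* Let $(X_t)_{t\ge0}$ be an ergodic, time-homogeneous Markov process on $\mathbb{R}^d$ with invariant probability measure $\mu$, and let $\mathcal L$ with domain $\mathscr D(\mathcal L)$ be the infinitesimal generator of its transition semigroup on $L^2(\mu)$. Assume $L^2(\mu)$-coercivity: there exists $\lambda_{\mathrm C}>0$ such that $\langle-\mathcal Lf,f\rangle_{L^2(\mu)}\ge\lambda_{\mathrm C}\|f\|_{L^2(\mu)}^2$ for all $f\in\mathscr D(\mathcal L)$ with $\mu(f)=0$. Let $p>0$ and assume $\mu(|\cdot|^q)<\infty$ for some $q>p$. Define $\gamma_2:=\max\{\frac12,1-\frac pd\}\in(0,1)$. Then there exists $C>0$ such that for all $T\ge2$, $$\mathbb{E}^\mu\big[\mathcal{T}_p(\mu_T,\mu)\big]\le C\,T^{-\left(1-\max\{\gamma_2,\frac pq\}\right)}\Big(\mathbf 1_{\{\gamma_2q=p\}}\log T+\mathbf 1_{\{\gamma_2q\ne p\}}\Big)\Big(\mathbf 1_{\{p=\frac12d\}}\log T+\mathbf 1_{\{p\ne\frac12 d\}}\Big).$$ In particular, if $q>2p$, then $\mathbb{E}^\mu[\mathcal{T}_p(\mu_T,\mu)]\le CT^{-1/2}$ if $p>\frac d2$, $\le CT^{-1/2}\log T$ if $p=\frac d2$, and $\le CT^{-p/d}$ if $p<\frac d2$.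
   Context: For probability measures $\nu_0,\nu_1$ on $\mathbb{R}^d$ and $p\in(0,\infty)$, $\mathcal{T}_p(\nu_0,\nu_1):=\inf_{\pi}\int|x-y|^p\,\pi(\mathrm dx,\mathrm dy)$, the infimum over all couplings $\pi$ of $\nu_0,\nu_1$. The empirical measure is $\mu_T:=\frac1T\int_0^T\delta_{X_t}\,\mathrm dt$. $\mathbb{E}^\mu$ denotes expectation when $X_0\sim\mu$. $\mu(f)=\int f\,\mathrm d\mu$, $\mu(|\cdot|^q)=\int|x|^q\,\mu(\mathrm dx)$, and $\langle\cdot,\cdot\rangle_{L^2(\mu)}$ is the inner product of $L^2(\mu)$. $\mathbf 1_{\{\cdot\}}$ equals $1$ if the stated condition holds and $0$ otherwise. *)

(* Defs.v *)
From HB Require Import structures.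
From mathcomp Require Import all_boot all_order all_algebra.
From mathcomp Require Import all_classical all_reals all_analysis measurable_realfun.
Set Implicit Arguments. Unset Strict Implicit. Unset Printing Implicit Defensive.
Import Order.TTheory GRing.Theory Num.Theory.
Import numFieldNormedType.Exports.
Local Open Scope classical_set_scope.
Local Open Scope ring_scope.

(* R^d is represented by d.-tuple R, with the product (= Borel) sigma-algebra
   of the library (measurable_structure.v, section measurable_tuple). *)
Notation Rd R d := (d.-tuple R).

Definition edist (R : realType) (d : nat) (x y : Rd R d) : R :=
  Num.sqrt (\sum_(i < d) (tnth x i - tnth y i) ^+ 2).

Definition enorm (R : realType) (d : nat) (x : Rd R d) : R :=
  Num.sqrt (\sum_(i < d) (tnth x i) ^+ 2).

Definition coupling (R : realType) (d : nat) (nu0 nu1 : set (Rd R d) -> \bar R)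
  (pi : probability (Rd R d * Rd R d)%type R) : Prop :=
  forall A : set (Rd R d), measurable A ->
    pi (A `*` setT) = nu0 A /\ pi (setT `*` A) = nu1 A.

Definition Tcost (R : realType) (d : nat) (p : R) (nu0 nu1 : set (Rd R d) -> \bar R)
  : \bar R :=
  ereal_inf [set (\int[pi]_z ((edist z.1 z.2) `^ p)%:E)%E
            | pi in [set pi | coupling nu0 nu1 pi]].

Definition empirical (R : realType) (d : nat) (Omega : Type)
  (X : R -> Omega -> Rd R d) (T : R) (w : Omega) : set (Rd R d) -> \bar R :=
  fun A => ((T^-1)%:E * \int[@lebesgue_measure R]_(t in (`[0%R, T]%classic : set R)) (\1_A (X t w))%:E)%E.

Definition semigroup (R : realType) (d : nat)
  (Pk : R -> Rd R d -> probability (Rd R d) R) (t : R) (f : Rd R d -> R)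
  : Rd R d -> R :=
  fun x => fine (\int[Pk t x]_y (f y)%:E)%E.

Definition L2 (R : realType) (d : nat) (mu : probability (Rd R d) R)
  (f : Rd R d -> R) : Prop :=
  measurable_fun setT f /\ (\int[mu]_x ((f x) ^+ 2)%:E < +oo)%E.

Definition L2sq (R : realType) (d : nat) (mu : probability (Rd R d) R)
  (f : Rd R d -> R) : \bar R := (\int[mu]_x ((f x) ^+ 2)%:E)%E.

(* f is in the domain of the L^2(mu)-generator and L f = g *)
Definition generator (R : realType) (d : nat) (mu : probability (Rd R d) R)
  (Pk : R -> Rd R d -> probability (Rd R d) R) (f g : Rd R d -> R) : Prop :=
  [/\ L2 mu f, L2 mu g &
      (fun t => L2sq mu (fun x => (semigroup Pk t f x - f x) / t - g x))
        @ 0^'+ --> 0%E].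

Definition markov_process (R : realType) (d : nat) (dO : measure_display)
  (Omega : measurableType dO) (P : probability Omega R)
  (X : R -> Omega -> Rd R d) (Pk : R -> Rd R d -> probability (Rd R d) R)
  (mu : probability (Rd R d) R) : Prop :=
  [/\
      measurable_fun setT (fun tw : R * Omega => X tw.1 tw.2),
      (forall t A, 0 <= t -> measurable A -> @measurable_fun _ _ (Rd R d) (\bar R) setT (fun x => Pk t x A)),
      (forall x A, measurable A -> Pk 0 x A = \d_x A) /\
      (forall s t x A, 0 <= s -> 0 <= t -> measurable A ->
         Pk (s + t) x A = (\int[Pk s x]_y Pk t y A)%E),
      (forall A, measurable A -> P (X 0 @^-1` A) = mu A) &
      (* Markov property w.r.t. the natural filtration *)
      (forall (n : nat) (r : 'I_n -> R) (B : 'I_n -> set (Rd R d)) s t A,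
         0 <= s -> 0 <= t -> measurable A ->
         (forall i, 0 <= r i <= s) -> (forall i, measurable (B i)) ->
         P ([set w | forall i, B i (X (r i) w)] `&` (X (s + t) @^-1` A)) =
         (\int[P]_(w in [set w | forall i, B i (X (r i) w)]) Pk t (X s w) A)%E)].

Definition mu_invariant (R : realType) (d : nat)
  (Pk : R -> Rd R d -> probability (Rd R d) R) (mu : probability (Rd R d) R) : Prop :=
  forall t A, 0 <= t -> measurable A -> (\int[mu]_x Pk t x A)%E = mu A.

Definition mu_ergodic (R : realType) (d : nat)
  (Pk : R -> Rd R d -> probability (Rd R d) R) (mu : probability (Rd R d) R) : Prop :=
  forall A, measurable A ->
    (forall t, 0 <= t -> {ae mu, forall x, Pk t x A = (\1_A x)%:E}) ->
    mu A = 0%E \/ mu A = 1%E.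

Definition strongly_continuous (R : realType) (d : nat)
  (Pk : R -> Rd R d -> probability (Rd R d) R) (mu : probability (Rd R d) R) : Prop :=
  forall f, L2 mu f ->
    (fun t => L2sq mu (fun x => semigroup Pk t f x - f x)) @ 0^'+ --> 0%E.

Definition coercive (R : realType) (d : nat)
  (Pk : R -> Rd R d -> probability (Rd R d) R) (mu : probability (Rd R d) R)
  (lam : R) : Prop :=
  forall f g, generator mu Pk f g -> (\int[mu]_x (f x)%:E)%E = 0%E ->
    (lam%:E * L2sq mu f <= - \int[mu]_x (g x * f x)%:E)%E.

(* Main.v *)
(* Variance: for F = 1_B - mu(B), the function u = int_0^S P_t F dt lies in the domain
   of the generator, with Lu = P_S F - F. Coercivity at u gives
   lam |u|^2 <= <F - P_S F, u>, so |u| <= 2 |F| / lam uniformly in S, and by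
   stationarity E[(mu_T(B) - mu(B))^2] <= 4 mu(B) / (lam T).

   Transport: cut [-r, r)^d triadically. Matching as much mass as possible inside
   the cells of each level in turn bounds the cost by
   sum_l diam_(l+1)^p sum_(cells c of level l) |mu_T(c) - mu(c)|, plus the p-th
   moments outside the cube. A triadic subdivision keeps the cubes rho_n [-1, 1)^d,
   rho_n = 3^(n-L) r, unions of cells: the at most 3^(d(n-l)) cells of level l in
   the n-th annulus have total mass at most eps_n ~ min(1, rho_n^-q), hence by
   Cauchy-Schwarz a total expected deviation of order
   min(eps_n, sqrt(eps_n 3^(d(n-l)) / T)).
   With r = T^(1/q), what remains are two geometric sums, over n - l and over n; each
   becomes a mere count of scales in its critical case (p = d/2, resp.
   gamma_2 q = p), whence the logarithms. *)
Require Import Defs.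
From HB Require Import structures.
From mathcomp Require Import all_boot all_order all_algebra.
From mathcomp Require Import all_classical all_reals all_analysis measurable_realfun.
From mathcomp Require Import ring lra.
Import Order.TTheory GRing.Theory Num.Theory.
Import numFieldNormedType.Exports.
Import HBNNSimple.
Local Open Scope classical_set_scope.
Local Open Scope ring_scope.
Set Implicit Arguments.
Unset Strict Implicit.
Unset Printing Implicit Defensive.

(** Time integrals are taken of correlations of the process, which is jointly measurable, and the
    potential u is recovered as a Radon-Nikodym density. It is known only through pairings with
    bounded functions, so norm estimates for u are obtained by testing against bounded functions
    built from u itself.

    Origin of the exponents, logarithms aside: for p < d/2 the sum over n - l is governed by the
    scale where its two bounds agree, 3^(n-l) = (eps_n T)^(1/d), and for p > d/2 by n = l; either
    way it is of order eps_n^gamma_2 T^(gamma_2 - 1). The sum over n of rho_n^p eps_n^gamma_2 is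
    then governed by rho_n near 1 or by rho_n = r, according to the sign of gamma_2 q - p. The
    radius r = T^(1/q) is chosen so that the moment outside the cube, of order r^(p-q) =
    T^(-(1-p/q)), just fits the rate. *)

(** * Monotone class induction and basic facts on integrals *)

Section measure_toolbox.
Context d (T : measurableType d) (R : realType).
Local Open Scope ereal_scope.

(** The standard machine by simple functions: kernel measurability and Markov identities then need a
    check on indicators only. Measurability and sign are carried along because linearity of the
    integral asks for them. *)
Lemma ge0_measurable_ind (Q : (T -> \bar R) -> Prop) :
  (forall A, measurable A -> Q (fun x => (\1_A x)%:E)) ->
  (forall (a : R) f, (0 <= a)%R -> measurable_fun setT f ->
     (forall x, 0 <= f x) -> Q f -> Q (fun x => a%:E * f x)) ->
  (forall f g, measurable_fun setT f -> (forall x, 0 <= f x) ->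
     measurable_fun setT g -> (forall x, 0 <= g x) ->
     Q f -> Q g -> Q (fun x => f x + g x)) ->
  (forall (f_ : (T -> \bar R)^nat) f, (forall n, measurable_fun setT (f_ n)) ->
     (forall n x, 0 <= f_ n x) ->
     (forall x, {homo (f_ ^~ x) : m n / (m <= n)%N >-> m <= n}) ->
     (forall x, f_ ^~ x @ \oo --> f x) -> (forall n, Q (f_ n)) -> Q f) ->
  forall f, measurable_fun setT f -> (forall x, 0 <= f x) -> Q f.
Proof.
move=> Q1 QZ QD Ql f mf f0.
pose g := nnsfun_approx measurableT mf.
apply: (Ql (fun n x => (g n x)%:E)).
- by move=> n; exact/measurable_EFinP.
- by move=> n x; rewrite lee_fin.
- by move=> x m n mn; rewrite lee_fin; exact/lefP/nd_nnsfun_approx.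
- by move=> x; apply: cvg_nnsfun_approx.
move=> n.
have -> : (fun x => (g n x)%:E) =
   (fun x => \sum_(y <- finmap.enum_fset (fset_set (range (g n)))) (y * \1_(g n @^-1` [set y]) x)%:E).
  apply/funext => x; rewrite fimfunE fsbig_finite//= sumEFin//.
have : all (fun y => 0 <= y)%R (finmap.enum_fset (fset_set (range (g n)))).
  by apply/allP => y; rewrite in_fset_set// inE => -[x _ <-].
elim: (finmap.enum_fset (fset_set (range (g n)))) => [_|y s ih /= /andP[y0 s0]].
  have -> : (fun x : T => \sum_(y <- [::]) (y * \1_(g n @^-1` [set y]) x)%:E) =
      (fun x => (\1_(@set0 T) x)%:E :> \bar R).
    by apply/funext => x; rewrite big_nil indicE in_set0.
  exact: Q1.
have mI z : measurable_fun setT (fun x => (\1_(g n @^-1` [set z]) x)%:E : \bar R).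
  by apply/measurable_EFinP; exact: measurable_indic.
under eq_fun do rewrite big_cons.
apply: QD.
- by under eq_fun do rewrite EFinM; exact: measurable_funeM.
- by move=> x; rewrite lee_fin mulr_ge0.
- apply: emeasurable_sum => z.
  by under eq_fun do rewrite EFinM; exact: measurable_funeM.
- move=> x; rewrite big_seq sume_ge0// => z zs; rewrite lee_fin mulr_ge0//.
  exact: (allP s0).
- by under eq_fun do rewrite EFinM; apply: QZ => //; exact: Q1.
- exact: ih.
Qed.

Lemma ge0_cvg_integral (mu : {measure set T -> \bar R})
    (f_ : (T -> \bar R)^nat) f :
  (forall n, measurable_fun setT (f_ n)) ->
  (forall n x, 0 <= f_ n x) ->
  (forall x, {homo (f_ ^~ x) : m n / (m <= n)%N >-> m <= n}) ->
  (forall x, f_ ^~ x @ \oo --> f x) ->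
  \int[mu]_x f_ n x @[n --> \oo] --> \int[mu]_x f x.
Proof.
move=> mf f0 nd fl.
have -> : \int[mu]_x f x = \int[mu]_x limn (f_ ^~ x).
  by apply: eq_integral => x _; apply/esym/cvg_lim.
exact: cvg_monotone_convergence.
Qed.

Lemma integral_mrestr (mu : {measure set T -> \bar R}) (E : set T)
    (mE : measurable E) (f : T -> \bar R) :
  measurable_fun setT f -> (forall x, 0 <= f x) ->
  \int[mrestr mu mE]_x f x = \int[mu]_x (f x * (\1_E x)%:E).
Proof.
move=> mf f0; rewrite -[in LHS](setvU E) [LHS]ge0_integral_setU//=; last 3 first.
- exact: measurableC.
- exact: measurable_funTS.
- by rewrite disj_set2E setICl.
rewrite (@eq_measure_integral _ _ _ (~` E) mzero) => [|A mA AE]; last first.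
  by transitivity (mu set0); [congr (mu _); apply/seteqP; split => // x [/AE]|exact: measure0].
rewrite integral_measure_zero add0e.
rewrite (@eq_measure_integral _ _ _ E mu) => [|A mA AE]; last first.
  by congr (mu _); apply/seteqP; split => [x []|x Ax] //; split => //; exact: AE.
rewrite integral_mkcond; apply: eq_integral => x _.
by rewrite epatch_indic.
Qed.

(** The integral of a nonnegative function is a supremum over the simple functions below it, so
    monotonicity survives without measurability. This serves transport costs, as functions of the
    sample point or of a pair of points. *)
Lemma le_integral_nonmeasurable (mu : {measure set T -> \bar R})
    (f g : T -> \bar R) : (forall x, 0 <= f x) -> (forall x, f x <= g x) ->
  \int[mu]_x f x <= \int[mu]_x g x.
Proof.
move=> f0 fg; rewrite !ge0_integralTE//; last by move=> x; exact: le_trans (fg x).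
apply: ge_ereal_sup => /= _ [h hf <-]; apply: ereal_sup_ubound; exists h => //= x.
exact: le_trans (hf x) (fg x).
Qed.

End measure_toolbox.

Definition mpush d1 d2 (T1 : measurableType d1) (T2 : measurableType d2)
    (R : realType) (m : {measure set T1 -> \bar R}) (f : T1 -> T2)
    (mf : measurable_fun setT f) : {measure set T2 -> \bar R} :=
  measure_function_pushforward__canonical__measure_function_Measure m mf.

Section mfin.
Context d (T : measurableType d) (R : realType).
Variables (m : {measure set T -> \bar R}) (mf : fin_num_fun m).

(** An alias that carries a finiteness proof, to which the finite-measure structure is attached. *)
Definition mfin of fin_num_fun m : set T -> \bar R := m.

HB.instance Definition _ := isMeasure.Build _ _ _ (mfin mf)
  (measure0 m) (measure_ge0 m) (@measure_semi_sigma_additive _ _ _ m).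
HB.instance Definition _ := Measure_isFinite.Build _ _ _ (mfin mf) mf.

End mfin.

(** * Conditional densities by the Radon-Nikodym theorem *)

Section cond_density.
Context d (T : measurableType d) d' (S : measurableType d') (R : realType).
Variables (m : {finite_measure set S -> \bar R}) (E : set S) (mE : measurable E).
Variables (Z : S -> T) (mZ : measurable_fun setT Z).
Variables (mu : {finite_measure set T -> \bar R}) (K : R).
Local Open Scope ereal_scope.

Let nu : {measure set T -> \bar R} := mpush (mrestr m mE) mZ.

Let nu_fin : fin_num_fun nu.
Proof.
move=> A mA; rewrite ge0_fin_numE ?measure_ge0//.
rewrite [ltLHS]/(m (Z @^-1` A `&` E)).
apply: (@le_lt_trans _ _ (m setT)); last by rewrite -ge0_fin_numE ?measure_ge0 ?fin_num_measure.
apply: le_measure; rewrite ?inE//; apply: measurableI => //.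
by rewrite -[X in measurable X]setTI; exact: mZ.
Qed.

(* [E]-restricted conditional expectation given [Z], as a density *)
Lemma cond_density :
  (forall A, measurable A -> m (Z @^-1` A `&` E) <= K%:E * mu A) ->
  exists u : T -> R, [/\ measurable_fun setT u,
    forall x, (0 <= u x <= `|K|)%R &
    forall g : T -> \bar R, measurable_fun setT g -> (forall x, 0 <= g x) ->
      \int[m]_s (g (Z s) * (\1_E s)%:E) = \int[mu]_x (g x * (u x)%:E)].
Proof.
move=> mK.
pose nuf : {finite_measure set T -> \bar R} := mfin nu_fin.
have dom : nuf `<< mu.
  apply/null_content_dominatesP => A mA muA.
  apply/eqP; rewrite eq_le measure_ge0 andbT.
  by have := mK _ mA; rewrite muA mule0.
have f0 := @Radon_Nikodym_SigmaFinite.f_ge0 _ _ _ nuf mu dom.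
have fi := @Radon_Nikodym_SigmaFinite.f_integrable _ _ _ nuf mu dom.
have fE := @Radon_Nikodym_SigmaFinite.f_integral _ _ _ nuf mu dom.
have fch := @Radon_Nikodym_SigmaFinite.change_of_variables _ _ _ nuf mu dom.
set f := Radon_Nikodym_SigmaFinite.f _ _ in f0 fi fE fch.
have ff := @Radon_Nikodym_SigmaFinite.f_fin_num _ _ _ nuf mu dom.
have mf : measurable_fun setT f by exact: measurable_int fi.
(* The Radon-Nikodym derivative is bounded by [K] only almost everywhere; truncation gives a version
   that is bounded at every point and has the same integrals. *)
pose u x := Num.min (fine (f x)) `|K|%R.
have mu_ : measurable_fun setT u.
  apply: measurable_minr => //; exact: measurableT_comp.
have aefu : ae_eq mu setT f (EFin \o u).
  pose N := [set x | (`|K|%:E < f x)].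
  have mN : measurable N.
    by rewrite -[N]setTI; apply: emeasurable_fun_o_infty.
  have muN : mu N = 0.
    have intK : \int[mu]_(x in N) (`|K|%:E) = `|K|%:E * mu N by rewrite integral_cst.
    have le1 : \int[mu]_(x in N) f x <= `|K|%:E * mu N.
      rewrite -fE//; apply: (le_trans (mK _ mN)).
      by rewrite lee_wpmul2r// lee_fin ler_norm.
    (* The integrand is positive on [N], while domination makes its integral at most 0; hence [N] is
       null. *)
    have intg : \int[mu]_(x in N) (f x - `|K|%:E) = 0.
      apply/eqP; rewrite eq_le; apply/andP; split; last first.
        by apply: integral_ge0 => x Nx; rewrite suber_ge0//; exact: ltW Nx.
      rewrite integralB//; last 2 first.
      - exact: integrableS fi.
      - exact: finite_measure_integrable_cst.
      rewrite intK leeBlDr ?add0e// fin_numM// fin_num_measure//.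
    have := (@ae_eq_integral_abs _ _ _ mu N mN (fun x => f x - `|K|%:E)).
    have mg : measurable_fun N (fun x => f x - `|K|%:E).
      by apply: emeasurable_funB => //; exact: measurable_funTS.
    move=> /(_ mg)[+ _].
    have -> : \int[mu]_(x in N) `|f x - `|K|%:E| = \int[mu]_(x in N) (f x - `|K|%:E).
      apply: eq_integral => x; rewrite inE => xN.
      by rewrite gee0_abs// suber_ge0//; exact: ltW xN.
    move=> /(_ intg) [M [mM M0 NM]].
    apply: subset_measure0 M0 => //.
    move=> x Nx; apply: NM => /(_ Nx) /eqP.
    by rewrite -[_ == _]negbK; apply/negP/negPn; rewrite gt_eqF// sube_gt0.
  exists N; split => //= x; apply: contra_notP => /= /negP.
  rewrite -leNgt => fK _.
  by rewrite /u -[LHS](fineK (ff x)) min_l// -lee_fin fineK.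
exists u; split => //.
- move=> x; rewrite /u le_min fine_ge0//= normr_ge0/=.
  by rewrite ge_min lexx orbT.
- move=> g mg g0.
  have mgZ : measurable_fun setT (g \o Z) by exact: measurableT_comp.
  rewrite -(integral_mrestr m mE mgZ)//; last by move=> s; exact: g0.
  have := @ge0_integral_pushforward _ _ _ _ R Z mZ (mrestr m mE) setT g measurableT mg.
  rewrite preimage_setT => <-//; rewrite -fch//.
  apply: ge0_ae_eq_integral => //.
  - exact: emeasurable_funM.
  - by apply: emeasurable_funM => //; exact/measurable_EFinP.
  - by move=> x _; rewrite mule_ge0.
  - by move=> x _; rewrite mule_ge0// lee_fin /u le_min fine_ge0//=.
  - by apply: filterS aefu => x /= + _ => ->.
Qed.
End cond_density.

(** * Bounded measurable functions and their real-valued integrals *)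

Section bounded_measurable.
Context d (T : measurableType d) (R : realType).
Implicit Types f g : T -> R.

(** Indicators, their images under the semigroup and the densities used below all lie in this class,
    which is stable under the operations needed; against finite measures its integrals are real
    numbers. *)
Definition bmf f := measurable_fun setT f /\ exists M : R, forall x, `|f x| <= M.

Lemma bmf_cst r : bmf (fun=> r).
Proof. by split; [exact: measurable_cst|exists `|r|]. Qed.

Lemma bmf_indic A : measurable A -> bmf (\1_A).
Proof.
move=> mA; split; first exact: measurable_indic.
by exists 1 => x; rewrite indicE; case: (_ \in _); rewrite ?normr1 ?normr0.
Qed.

Lemma bmfD f g : bmf f -> bmf g -> bmf (fun x => f x + g x).
Proof.
move=> [mf [M fM]] [mg [N gN]]; split; first exact: measurable_funD.
by exists (M + N) => x; rewrite (le_trans (ler_normD _ _))// lerD.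
Qed.

Lemma bmfM f g : bmf f -> bmf g -> bmf (fun x => f x * g x).
Proof.
move=> [mf [M fM]] [mg [N gN]]; split; first exact: measurable_funM.
by exists (M * N) => x; rewrite normrM ler_pM.
Qed.

Lemma bmfZ r f : bmf f -> bmf (fun x => r * f x).
Proof. exact/bmfM/bmf_cst. Qed.

Lemma bmfN f : bmf f -> bmf (fun x => - f x).
Proof.
move=> [mf [M fM]]; split; first exact: measurableT_comp.
by exists M => x; rewrite normrN.
Qed.

Lemma bmfB f g : bmf f -> bmf g -> bmf (fun x => f x - g x).
Proof. by move=> bf bg; apply: bmfD => //; exact: bmfN. Qed.

Lemma bmfX2 f : bmf f -> bmf (fun x => f x ^+ 2).
Proof. by move=> bf; under eq_fun do rewrite expr2; exact: bmfM. Qed.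

Lemma bmf_norm f : bmf f -> bmf (fun x => `|f x|).
Proof.
move=> [mf [M fM]]; split; first exact: measurableT_comp.
by exists M => x; rewrite normr_id.
Qed.

Variable m : {finite_measure set T -> \bar R}.

Lemma bmf_integrable f : bmf f -> m.-integrable setT (EFin \o f).
Proof.
move=> [mf [M fM]]; apply: measurable_bounded_integrable => //.
- by rewrite -ge0_fin_numE ?measure_ge0// fin_num_measure.
- by exists M; split; [exact: num_real|move=> N MN x _ /=; rewrite (le_trans (fM x))// ltW].
Qed.

Lemma EFin_Rint f : bmf f -> (\int[m]_x f x)%:E = (\int[m]_x (f x)%:E)%E.
Proof. by move=> bf; rewrite fineK//; apply/integrable_fin_num => //; exact: bmf_integrable. Qed.

Lemma RintD f g : bmf f -> bmf g ->
  \int[m]_x (f x + g x) = \int[m]_x f x + \int[m]_x g x.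
Proof. by move=> bf bg; rewrite RintegralD//; exact: bmf_integrable. Qed.

Lemma RintB f g : bmf f -> bmf g ->
  \int[m]_x (f x - g x) = \int[m]_x f x - \int[m]_x g x.
Proof. by move=> bf bg; rewrite RintegralB//; exact: bmf_integrable. Qed.

Lemma RintZ r f : bmf f -> \int[m]_x (r * f x) = r * \int[m]_x f x.
Proof. by move=> bf; rewrite RintegralZl//; exact: bmf_integrable. Qed.

Lemma le_Rint f g : bmf f -> bmf g -> (forall x, f x <= g x) ->
  \int[m]_x f x <= \int[m]_x g x.
Proof. by move=> bf bg fg; apply: le_Rintegral => //; exact: bmf_integrable. Qed.

Lemma Rint_cst r : \int[m]_x r = r * fine (m setT).
Proof. by rewrite Rintegral_cst. Qed.

Lemma Rint_indic A : measurable A -> \int[m]_x \1_A x = fine (m A).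
Proof. by move=> mA; rewrite /Rintegral integral_indic// setIT. Qed.

End bounded_measurable.

Lemma Rint_cstP d (T : measurableType d) (R : realType) (P : probability T R) (r : R) :
  \int[P]_x r = r.
Proof.
rewrite Rintegral_cst//; transitivity (r * fine (P setT)) => //.
by rewrite probability_setT mulr1.
Qed.

(** Adding constants makes bounded functions nonnegative; this expansion carries identities back
    from the shifted functions. *)
Lemma Rint_shiftM d (T : measurableType d) (R : realType) (P : probability T R)
    (h k : T -> R) (M N : R) : bmf h -> bmf k ->
  \int[P]_x ((h x + M) * (k x + N)) =
  \int[P]_x (h x * k x) + N * \int[P]_x h x + M * \int[P]_x k x + M * N.
Proof.
move=> bh bk.
have -> : (fun x => (h x + M) * (k x + N)) =
    (fun x => h x * k x + N * h x + M * k x + M * N).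
  by apply/funext => x; ring.
rewrite !RintD ?RintZ ?Rint_cstP//;
  by repeat first [exact: bmf_cst | exact: bh | exact: bk| apply: bmfD | apply: bmfM].
Qed.

Lemma bmf_comp d1 d2 (T1 : measurableType d1) (T2 : measurableType d2)
    (R : realType) (f : T2 -> R) (h : T1 -> T2) :
  measurable_fun setT h -> bmf f -> bmf (fun x => f (h x)).
Proof.
move=> mh [mf [M fM]]; split; first exact: measurableT_comp mf mh.
by exists M.
Qed.

Lemma bmf_fst d1 d2 (T1 : measurableType d1) (T2 : measurableType d2)
    (R : realType) (f : T1 * T2 -> R) (m2 : {finite_measure set T2 -> \bar R}) :
  bmf f -> bmf (fun x => \int[m2]_y f (x, y)).
Proof.
move=> bf; have [mf [M fM]] := bf.
have bx x : bmf (fun y => f (x, y)) by apply: bmf_comp bf; exact: pair1_measurable.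
have M0 : 0 <= M by exact: le_trans (fM point).
split.
  (* After the shift by [M] the integrand is nonnegative, and measurability of the partial integral
     is Tonelli's theorem. *)
  have E x : \int[m2]_y f (x, y) =
      fine (\int[m2]_y (f (x, y) + M)%:E) - M * fine (m2 setT).
    rewrite -[fine _]/(\int[m2]_y (f (x, y) + M)) RintD//; last exact: bmf_cst.
    by rewrite Rint_cst addrK.
  under eq_fun do rewrite E.
  apply: measurable_funB => //; apply: measurableT_comp => //.
  apply: (@measurable_fun_fubini_tonelli_F _ _ _ _ _ m2 (fun z => (f z + M)%:E)).
    by apply/measurable_EFinP; exact: measurable_funD.
  by move=> z; rewrite lee_fin -lerBlDr sub0r; have := fM z; rewrite ler_norml => /andP[].
exists (M * fine (m2 setT)) => x.
rewrite (le_trans (le_normr_Rintegral _ (bmf_integrable _ _)))// -Rint_cst.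
by apply: le_Rint => //; [exact: bmf_norm|exact: bmf_cst].
Qed.

Lemma bmf_fubini d1 d2 (T1 : measurableType d1) (T2 : measurableType d2)
    (R : realType) (f : T1 * T2 -> R) (m1 : {finite_measure set T1 -> \bar R})
    (m2 : {finite_measure set T2 -> \bar R}) :
  bmf f -> \int[m1]_x \int[m2]_y f (x, y) = \int[m2]_y \int[m1]_x f (x, y).
Proof.
move=> bf; have [mf [M fM]] := bf.
have b1 x : bmf (fun y => f (x, y)) by apply: bmf_comp bf; exact: pair1_measurable.
have b2 y : bmf (fun x => f (x, y)) by apply: bmf_comp bf; exact: pair2_measurable.
congr fine.
under eq_integral do rewrite EFin_Rint//.
under [RHS]eq_integral do rewrite EFin_Rint//.
apply: (Fubini (f := EFin \o f)); apply/integrable12ltyP; first exact/measurable_EFinP.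
apply: (@le_lt_trans _ _ (\int[m1]_x \int[m2]_y M%:E)%E).
  apply: ge0_le_integral => //.
  - by move=> x _; apply: integral_ge0 => y _; rewrite abse_ge0.
  - apply: (@measurable_fun_fubini_tonelli_F _ _ _ _ _ m2 (fun z => (`|f z|)%:E)) => //.
    by apply/measurable_EFinP; exact: measurableT_comp.
  - move=> x _; apply: ge0_le_integral => //.
      by apply/measurable_EFinP; apply: measurableT_comp => //; exact: (b1 x).1.
    by move=> y _; rewrite lee_fin.
under eq_integral do rewrite integral_cst//.
by rewrite integral_cst// ltey_eq !fin_numM ?fin_num_measure.
Qed.

(** * Consequences of the Markov property and of stationarity *)

Section markov.
Context (R : realType) (d : nat) (dO : measure_display).
Context (Omega : measurableType dO) (P : probability Omega R).
Variables (X : R -> Omega -> d.-tuple R).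
Variables (Pk : R -> d.-tuple R -> probability (d.-tuple R) R).
Variable mu : probability (d.-tuple R) R.
Hypothesis markov : markov_process P X Pk mu.
Hypothesis inv : mu_invariant Pk mu.
Local Open Scope ereal_scope.

Lemma measurable_process : measurable_fun setT (fun tw : R * Omega => X tw.1 tw.2).
Proof. by case: markov. Qed.

Lemma measurable_marginal t : measurable_fun setT (X t).
Proof. exact: measurableT_comp measurable_process (pair1_measurable t). Qed.

Lemma measurable_preimage_marginal t A : measurable A -> measurable (X t @^-1` A).
Proof. by move=> mA; rewrite -[X in measurable X]setTI; exact: measurable_marginal. Qed.

Lemma measurable_transition t A : (0 <= t)%R -> measurable A ->
  measurable_fun setT (fun x => Pk t x A).
Proof. by case: markov => _ + _ _ _; apply. Qed.

Let mPk := measurable_transition.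

Lemma law_marginal t A : (0 <= t)%R -> measurable A -> P (X t @^-1` A) = mu A.
Proof.
(* With an empty family of past events and s = 0, the Markov property gives the law of [X t] as the
   law of [X 0] transported by P_t. *)
move=> t0 mA; have [_ _ _ X0 /(_ 0%N (fun=> 0%R) (fun=> setT) 0%R t A)] := markov.
rewrite (_ : [set w | _] = setT); last by apply/seteqP; split => // w _ [].
rewrite setTI add0r => ->//; last by case.
rewrite -(inv t0 mA).
rewrite (@eq_measure_integral _ _ _ _ (mpush P (measurable_marginal 0))); last first.
  by move=> B mB _; exact/esym/X0.
by rewrite ge0_integral_pushforward//=; [exact: measurable_marginal|exact: mPk].
Qed.

Lemma ge0_integral_marginal t f : (0 <= t)%R -> measurable_fun setT f ->
  (forall x, 0 <= f x) -> \int[P]_w f (X t w) = \int[mu]_x f x.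
Proof.
move=> t0 mf f0.
rewrite [RHS](@eq_measure_integral _ _ _ _ (mpush P (measurable_marginal t))); last first.
  by move=> B mB _; exact/esym/law_marginal.
by rewrite ge0_integral_pushforward//=; exact: measurable_marginal.
Qed.

Lemma markov2 s t A B : (0 <= s)%R -> (0 <= t)%R -> measurable A -> measurable B ->
  P (X s @^-1` A `&` X (s + t) @^-1` B) = \int[P]_(w in X s @^-1` A) Pk t (X s w) B.
Proof.
move=> s0 t0 mA mB; have [_ _ _ _ /(_ 1%N (fun=> s) (fun=> A) s t B)] := markov.
rewrite (_ : [set w | _] = X s @^-1` A); last first.
  by apply/seteqP; split => w /=; [apply; exact: ord0|].
by apply => // _; rewrite s0 lexx.
Qed.

Lemma measurable_integral_transition t f : (0 <= t)%R -> measurable_fun setT f ->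
  (forall x, 0 <= f x) -> measurable_fun setT (fun x => \int[Pk t x]_y f y).
Proof.
move=> t0; move: f; apply: ge0_measurable_ind.
- move=> A mA; under eq_fun do rewrite integral_indic// setIT; exact: mPk.
- move=> a f a0 mf f0 ih; under eq_fun do rewrite ge0_integralZl//.
  exact: measurable_funeM.
- move=> f g mf f0 mg g0 ihf ihg; under eq_fun do rewrite ge0_integralD//.
  exact: emeasurable_funD.
- move=> f_ f mf_ f_0 nd fl ih.
  apply: (emeasurable_fun_cvg (fun n x => \int[Pk t x]_y f_ n y)) => //.
  by move=> x _; exact: ge0_cvg_integral.
Qed.

(** First of two monotone class arguments: the event at time s + t is fixed and the weight at time s
    varies. The next lemma varies the function at time s + t. *)
Let markov2_indic s t B g : (0 <= s)%R -> (0 <= t)%R -> measurable B ->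
  measurable_fun setT g -> (forall x, 0 <= g x) ->
  \int[P]_w (g (X s w) * (\1_B (X (s + t) w))%:E) = \int[mu]_x (g x * Pk t x B).
Proof.
move=> s0 t0 mB.
have mX r : measurable_fun setT (fun w => (\1_B (X r w))%:E : \bar R).
  apply/measurable_EFinP; apply: measurableT_comp (measurable_marginal r).
  exact: measurable_indic.
have mP := mPk t0 mB.
move: g; apply: ge0_measurable_ind.
- move=> A mA; transitivity (P (X s @^-1` A `&` X (s + t) @^-1` B)).
    rewrite -[X in P X]setIT -integral_indic//; last first.
      by apply: measurableI; exact: measurable_preimage_marginal.
    by apply: eq_integral => w _; rewrite indicI !indicE.
  rewrite markov2// integral_mkcond -(ge0_integral_marginal s0)//.
  + by apply: eq_integral => w _; rewrite epatch_indic muleC.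
  + by apply: emeasurable_funM => //; exact/measurable_EFinP/measurable_indic.
  + by move=> x; rewrite mule_ge0.
- move=> a f a0 mf f0 ih; under eq_integral do rewrite -muleA.
  rewrite ge0_integralZl//; last 2 first.
    by apply: emeasurable_funM => //; exact: measurableT_comp mf (measurable_marginal s).
    by move=> w _; rewrite mule_ge0.
  under [RHS]eq_integral do rewrite -muleA.
  rewrite [RHS]ge0_integralZl//; last 2 first.
    by apply: emeasurable_funM.
    by move=> w _; rewrite mule_ge0.
  by rewrite ih.
- move=> f g mf f0 mg g0 ihf ihg.
  under eq_integral do rewrite ge0_muleDl//.
  rewrite ge0_integralD//=; last 4 first.
    by move=> w _; rewrite mule_ge0.
    by apply: emeasurable_funM => //; exact: measurableT_comp mf (measurable_marginal s).
    by move=> w _; rewrite mule_ge0.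
    by apply: emeasurable_funM => //; exact: measurableT_comp mg (measurable_marginal s).
  under [RHS]eq_integral do rewrite ge0_muleDl//.
  rewrite [RHS]ge0_integralD//=; last 4 first.
    by move=> w _; rewrite mule_ge0.
    by apply: emeasurable_funM.
    by move=> w _; rewrite mule_ge0.
    by apply: emeasurable_funM.
  by rewrite ihf ihg.
- move=> f_ f mf_ f_0 nd fl ih.
  apply: (@cvg_unique _ _ (\int[mu]_x (f_ n x * Pk t x B) @[n --> \oo])) => //.
    rewrite /= -(funext ih); apply: ge0_cvg_integral.
    + by move=> n; apply: emeasurable_funM => //; exact: measurableT_comp (mf_ n) (measurable_marginal s).
    + by move=> n w; rewrite mule_ge0.
    + by move=> w m n mn; rewrite lee_wpmul2r//; exact: nd.
    + by move=> w; apply: cvgeZr => //; exact: fl.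
  apply: ge0_cvg_integral.
  + by move=> n; exact: emeasurable_funM.
  + by move=> n w; rewrite mule_ge0.
  + by move=> w m n mn; rewrite lee_wpmul2r//; exact: nd.
  + by move=> w; apply: cvgeZr => //; exact: fin_num_measure.
Qed.

Lemma ge0_integral_markov2 s t (g : d.-tuple R -> R) (f : d.-tuple R -> \bar R) : (0 <= s)%R -> (0 <= t)%R ->
  measurable_fun setT g -> (forall x, 0 <= g x)%R ->
  measurable_fun setT f -> (forall x, 0 <= f x) ->
  \int[P]_w ((g (X s w))%:E * f (X (s + t) w)) =
  \int[mu]_x ((g x)%:E * \int[Pk t x]_y f y).
Proof.
move=> s0 t0 mg g0.
move: f; have mgX : measurable_fun setT (fun w => (g (X s w))%:E).
  by apply/measurable_EFinP; exact: measurableT_comp mg (measurable_marginal s).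
have mgE : measurable_fun setT (fun x => (g x)%:E) by exact/measurable_EFinP.
have g0E x : 0 <= (g x)%:E by rewrite lee_fin.
have mX h r : measurable_fun setT h -> measurable_fun setT (fun w => h (X r w) : \bar R).
  by move=> mh; exact: measurableT_comp mh (measurable_marginal r).
have mI h := @measurable_integral_transition t h t0.
apply: ge0_measurable_ind.
- move=> A mA; rewrite (@markov2_indic s t A (fun x => (g x)%:E))//.
  by apply: eq_integral => x _; rewrite integral_indic// setIT.
- move=> a f a0 mf f0 ih; under eq_integral do rewrite muleCA.
  rewrite ge0_integralZl//; last 2 first.
    by apply: emeasurable_funM => //; exact: mX.
    by move=> w _; rewrite mule_ge0.
  under [RHS]eq_integral do rewrite ge0_integralZl// muleCA.
  rewrite [RHS]ge0_integralZl//; last 2 first.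
    by apply: emeasurable_funM => //; exact: mI.
    by move=> w _; rewrite mule_ge0// integral_ge0.
  by rewrite ih.
- move=> f h mf f0 mh h0 ihf ihh.
  under eq_integral do rewrite ge0_muleDr//.
  rewrite ge0_integralD//=; last 4 first.
    by move=> w _; rewrite mule_ge0.
    by apply: emeasurable_funM => //; exact: mX.
    by move=> w _; rewrite mule_ge0.
    by apply: emeasurable_funM => //; exact: mX.
  under [RHS]eq_integral do rewrite ge0_integralD// ge0_muleDr ?integral_ge0//.
  rewrite [RHS]ge0_integralD//=; last 4 first.
    by move=> w _; rewrite mule_ge0 ?integral_ge0.
    by apply: emeasurable_funM => //; exact: mI.
    by move=> w _; rewrite mule_ge0 ?integral_ge0.
    by apply: emeasurable_funM => //; exact: mI.
  by rewrite ihf ihh.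
- move=> f_ f mf_ f_0 nd fl ih.
  apply: (@cvg_unique _ _ (\int[mu]_x ((g x)%:E * \int[Pk t x]_y f_ n y) @[n --> \oo])) => //.
    rewrite /= -(funext ih); apply: ge0_cvg_integral.
    + by move=> n; apply: emeasurable_funM => //; exact: mX.
    + by move=> n w; rewrite mule_ge0.
    + by move=> w m n mn; rewrite lee_wpmul2l//; exact: nd.
    + by move=> w; apply: cvgeZl => //; exact: fl.
  apply: ge0_cvg_integral.
  + by move=> n; apply: emeasurable_funM => //; exact: mI.
  + by move=> n w; rewrite mule_ge0// integral_ge0.
  + move=> w m n mn; rewrite lee_wpmul2l//; apply: ge0_le_integral => // x _; exact: nd.
  + by move=> w; apply: cvgeZl => //; exact: ge0_cvg_integral.
Qed.

Local Close Scope ereal_scope.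

Lemma bmf_semigroup t f : 0 <= t -> bmf f -> bmf (semigroup Pk t f).
Proof.
move=> t0 bf; have [mf [M fM]] := bf.
split.
  have E x : semigroup Pk t f x = fine (\int[Pk t x]_y (f y + M)%:E) - M.
    rewrite -[fine _]/(\int[Pk t x]_y (f y + M)) RintD//; last exact: bmf_cst.
    rewrite Rint_cstP addrK//.
  rewrite (funext E).
  apply: measurable_funB => //; apply: measurableT_comp => //.
  apply: measurable_integral_transition => //.
    by apply/measurable_EFinP; exact: measurable_funD.
  by move=> z; rewrite lee_fin -lerBlDr sub0r; have := fM z; rewrite ler_norml => /andP[].
exists M => x.
rewrite (le_trans (le_normr_Rintegral _ (bmf_integrable _ _)))//.
rewrite (le_trans (le_Rint _ (bmf_norm bf) (bmf_cst _ M) fM))//.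
by rewrite Rint_cstP.
Qed.

Lemma Rint_marginal t f : 0 <= t -> bmf f -> \int[P]_w f (X t w) = \int[mu]_x f x.
Proof.
move=> t0 bf; have [mf [M fM]] := bf.
have bX : bmf (fun w => f (X t w)) by exact: bmf_comp (measurable_marginal t) bf.
have : \int[P]_w (f (X t w) + M) = \int[mu]_x (f x + M).
  congr fine; apply: (ge0_integral_marginal (f := fun x => (f x + M)%:E)) => //.
    by apply/measurable_EFinP; exact: measurable_funD.
  by move=> z; rewrite lee_fin -lerBlDr sub0r; have := fM z; rewrite ler_norml => /andP[].
by rewrite !RintD//; try exact: bmf_cst; rewrite !Rint_cstP => /addIr.
Qed.

Lemma Rint_markov2 s t g f : 0 <= s -> 0 <= t -> bmf g -> bmf f ->
  \int[P]_w (g (X s w) * f (X (s + t) w)) = \int[mu]_x (g x * semigroup Pk t f x).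
Proof.
move=> s0 t0 bg bf.
have bX r h : bmf h -> bmf (fun w => h (X r w)) by exact: bmf_comp (measurable_marginal r).
(* The nonnegative case, to be applied to g + M and f + N. *)
have key g' f' : bmf g' -> bmf f' -> (forall x, 0 <= g' x) -> (forall x, 0 <= f' x) ->
  \int[P]_w (g' (X s w) * f' (X (s + t) w)) = \int[mu]_x (g' x * semigroup Pk t f' x).
  move=> bg' bf' g0 f0; congr fine.
  under eq_integral do rewrite EFinM.
  rewrite (@ge0_integral_markov2 s t g' (EFin \o f'))//; last first.
  - by apply/measurable_EFinP; exact: bf'.1.
  - exact: bg'.1.
  by apply: eq_integral => x _; rewrite EFinM -[(semigroup _ _ _ _)%:E]/((\int[Pk t x]_y f' y)%:E) EFin_Rint.
have [_ [M gM]] := bg; have [_ [N fN]] := bf.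
have gM0 x : 0 <= g x + M.
  by rewrite -lerBlDr sub0r; have := gM x; rewrite ler_norml => /andP[].
have fN0 x : 0 <= f x + N.
  by rewrite -lerBlDr sub0r; have := fN x; rewrite ler_norml => /andP[].
have bgM : bmf (fun x => g x + M) by apply: bmfD => //; exact: bmf_cst.
have bfN : bmf (fun x => f x + N) by apply: bmfD => //; exact: bmf_cst.
have bs := bmf_semigroup t0 bf.
have bXst : bmf (fun w => f (X (s + t) w)) by exact: bX.
have st0 : 0 <= s + t by exact: addr_ge0.
have sD : semigroup Pk t (fun x => f x + N) = (fun x => semigroup Pk t f x + N).
  apply/funext => x; rewrite -[LHS]/(\int[Pk t x]_y (f y + N)) RintD//; last exact: bmf_cst.
  by rewrite Rint_cstP.
(* The weight g = 1 shows that P_t preserves the mean, which makes the cross terms of the two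
   shifted products agree. *)
have invf : \int[mu]_x semigroup Pk t f x = \int[P]_w f (X (s + t) w).
  have := key (fun=> 1) _ (bmf_cst _ 1) bfN (fun=> ler01) fN0; rewrite sD.
  under eq_Rintegral do rewrite mul1r.
  under [X in _ = X -> _]eq_Rintegral do rewrite mul1r.
  by rewrite !RintD//; try exact: bmf_cst; rewrite !Rint_cstP => /addIr.
have := key _ _ bgM bfN gM0 fN0; rewrite sD.
rewrite (Rint_shiftM P M N (bX _ _ _ bg) bXst) (Rint_shiftM mu M N bg bs).
by rewrite (Rint_marginal s0)// invf => /addIr /addIr /addIr.
Qed.

Lemma Rint_semigroup t f : 0 <= t -> bmf f ->
  \int[mu]_x semigroup Pk t f x = \int[mu]_x f x.
Proof.
move=> t0 bf; have := Rint_markov2 (lexx 0) t0 (bmf_cst _ 1) bf.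
under eq_Rintegral do rewrite mul1r.
under [X in _ = X -> _]eq_Rintegral do rewrite mul1r.
by rewrite add0r Rint_marginal.
Qed.

End markov.

(** * Time integrals: Lebesgue measure on [0, S), translated and reflected *)

Section lebesgue_interval.
Context (R : realType).
Local Notation leb := (@lebesgue_measure R).

Let mshift0 (c : R) : measurable_fun setT (fun t : measurableTypeR R => c + t : measurableTypeR R).
Proof. by apply: measurable_funD. Qed.

Lemma lebesgue_measure_shift (c : R) (A : set (measurableTypeR R)) : measurable A ->
  leb ((fun t => c + t) @^-1` A) = leb A.
Proof.
move=> mA; apply/esym.
apply: (@lebesgue_measure_unique R (mpush leb (mshift0 c))) => // _ [[a b]] _ <-.
rewrite /mpush/= /pushforward.
have -> : (fun t => c + t) @^-1` `]a, b]%classic = `]a - c, b - c]%classic.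
  by apply/seteqP; split => t /=; rewrite !in_itv/= ltrBlDl lerBrDl.
rewrite !lebesgue_measure_itv/= !lte_fin ltrD2r; case: ifP => // _.
by congr (_%:E); ring.
Qed.

Lemma lebesgue_measure_reflect (c : R) (A : set (measurableTypeR R)) : measurable A ->
  leb ((fun t => c - t) @^-1` A) = leb A.
Proof.
move=> mA; rewrite -[RHS](lebesgue_measure_shift c mA) -[RHS]lebesgue_measureN//.
by rewrite -[X in measurable X]setTI; exact: mshift0.
Qed.

Lemma le_lebesgue_measureU1 (E F : set (measurableTypeR R)) (c : R) :
  measurable E -> measurable F -> E `<=` F `|` [set c] -> (leb E <= leb F)%E.
Proof.
move=> mE mF EF; have m1 : measurable ([set c] : set (measurableTypeR R)) by [].
apply: (@le_trans _ _ (leb (F `|` [set c]))).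
  by apply: le_measure; rewrite ?inE//; exact: measurableU.
have := measureU2 leb mF m1.
by rewrite -[(leb F + _)%E]/(leb F + leb [set c])%E lebesgue_measure_set1 adde0.
Qed.

Let mI (A : set (measurableTypeR R)) (i : interval R) : measurable A -> measurable (A `&` [set` i]).
Proof. by move=> mA; apply: measurableI => //; exact: measurable_itv. Qed.

Lemma lebesgue_measure_setIoc_co (a b : R) (A : set (measurableTypeR R)) : measurable A ->
  leb (A `&` `]a, b]%classic) = leb (A `&` `[a, b[%classic).
Proof.
move=> mA; apply/eqP; rewrite eq_le; apply/andP; split.
  apply: (@le_lebesgue_measureU1 _ _ b); try exact: mI.
  move=> x [Ax] /=; rewrite !in_itv/= le_eqVlt => /andP[ax /orP[/eqP->|xb]]; first by right.
  by left; split => //=; rewrite (ltW ax).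
apply: (@le_lebesgue_measureU1 _ _ a); try exact: mI.
move=> x [Ax] /=; rewrite !in_itv/= le_eqVlt => /andP[/orP[/eqP<-|ax] xb]; first by right.
by left; split => //=; rewrite ax ltW.
Qed.

Lemma lebesgue_measure_setIcc_co (a b : R) (A : set (measurableTypeR R)) : measurable A ->
  leb (A `&` `[a, b]%classic) = leb (A `&` `[a, b[%classic).
Proof.
move=> mA; apply/eqP; rewrite eq_le; apply/andP; split.
  apply: (@le_lebesgue_measureU1 _ _ b); try exact: mI.
  move=> x [Ax] /=; rewrite !in_itv/= => /andP[ax]; rewrite le_eqVlt => /orP[/eqP->|xb]; first by right.
  by left; split => //=; rewrite ax.
apply: (@le_lebesgue_measureU1 _ _ a); try exact: mI.
move=> x [Ax] /=; rewrite !in_itv/= => /andP[ax xb]; left; split => //=.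
by rewrite ax ltW.
Qed.

(** Lebesgue measure retyped as a measure on [R], so that it can form products with the sample space
    of the process. *)
Definition lebR : set R -> \bar R := leb.

HB.instance Definition _ := isMeasure.Build _ R R lebR
  (measure0 leb) (measure_ge0 leb) (@measure_semi_sigma_additive _ _ _ leb).

Let measurable_co (S : R) : measurable (`[0, S[%classic : set R).
Proof. exact: measurable_itv. Qed.

Let lebI_fin S : fin_num_fun (mrestr lebR (measurable_co S)).
Proof.
move=> A mA; rewrite ge0_fin_numE ?measure_ge0//.
apply: (@le_lt_trans _ _ (lebR `[0, S[%classic)).
  by apply: le_measure; rewrite ?inE//; exact: measurableI.
by rewrite /lebR lebesgue_measure_itv/=; case: ifP => // _; rewrite ltry.
Qed.

(** A finite measure on the whole line, so that bounded functions are integrable. The half-open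
    interval makes concatenation of time intervals exact. *)
Definition lebI (S : R) : {finite_measure set R -> \bar R} := mfin (lebI_fin S).

Lemma lebIE (S : R) (A : set R) : lebI S A = leb (A `&` `[0, S[%classic).
Proof. by []. Qed.

Lemma lebI_setT (S : R) : 0 <= S -> fine (lebI S setT) = S.
Proof.
move=> S0; rewrite lebIE setTI lebesgue_measure_itv/= lte_fin.
by case: ltP => /= [_|S1]; rewrite ?subr0//; apply/eqP; rewrite eq_le S0 S1.
Qed.

Lemma lebI_setTE (S : R) : 0 <= S -> lebI S setT = S%:E.
Proof. by move=> S0; rewrite -[LHS]fineK ?lebI_setT// fin_num_measure. Qed.

Let mshift (c : R) : measurable_fun setT (fun t : R => c + t : R).
Proof. by apply: measurable_funD. Qed.

Lemma lebI_split (a b : R) (A : set (R)) : 0 <= a -> 0 <= b -> measurable A ->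
  (lebI b ((fun t : R => a + t)%R @^-1` A) + lebI a A = lebI (a + b)%R A)%E.
Proof.
move=> a0 b0 mA; rewrite !lebIE.
have mI' (i : interval R) : measurable (A `&` [set` i]) by exact: mI.
have -> : (fun t : R => a + t) @^-1` A `&` `[0, b[%classic =
    (fun t : R => a + t) @^-1` (A `&` `[a, a + b[%classic).
  apply/seteqP; split => t [/= At]; rewrite !in_itv/= => /andP[t0 tb]; split => //=.
    by rewrite lerDl t0 ltrD2l.
  by move: t0 tb; rewrite lerDl ltrD2l => -> ->.
rewrite (lebesgue_measure_shift a (mI' _)) addeC -measureU//; last first.
  by apply/seteqP; split => t //= [[_]]; rewrite in_itv/= => /andP[_ ta] [_]; rewrite in_itv/= leNgt ta.
- exact: mI'.
- exact: mI'.
rewrite -setIUr; congr (leb (_ `&` _)).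
apply/seteqP; split => t /=; rewrite !in_itv/=.
  by move=> [/andP[t0 ta]|/andP[ta tb]]; rewrite ?t0 ?tb/= ?andbT ?(lt_le_trans ta) ?lerDl// (le_trans a0).
by move=> /andP[t0 ->]; rewrite t0 /=; case: (ltP t a) => _; [left|right].
Qed.

(** Times before [s] are reflected and times after [s] translated. This evaluates the inner time
    integral of a stationary correlation, which depends on |t - s| only. *)
Lemma lebI_dist (s S : R) (A : set (R)) : 0 <= s -> s <= S -> measurable A ->
  (lebI S ((fun t : R => `|t - s|)%R @^-1` A) = lebI s A + lebI (S - s)%R A)%E.
Proof.
move=> s0 sS mA.
have mabs : measurable ((fun t : R => `|t - s|) @^-1` A : set (R)).
  rewrite -[X in measurable X]setTI; apply: (_ : measurable_fun setT (fun t : R => `|t - s|)) => //.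
  by apply: measurableT_comp => //; exact: measurable_funB.
have Ss0 : 0 <= S - s by rewrite subr_ge0.
have mI' (i : interval R) : measurable (A `&` [set` i]) by exact: mI.
have mB (i : interval R) : measurable (((fun t : R => `|t - s|) @^-1` A) `&` [set` i] : set (R)).
  by apply: measurableI => //; exact: measurable_itv.
rewrite -{1}(subrKC s S) -(lebI_split s0 Ss0 mabs) addeC; congr (_ + _)%E; rewrite !lebIE.
- rewrite -[RHS]lebesgue_measure_setIoc_co//.
  have -> : (fun t : R => `|t - s|) @^-1` A `&` `[0, s[%classic =
      (fun t : R => s - t) @^-1` (A `&` `]0, s]%classic).
    apply/seteqP; split => t [/= At]; rewrite !in_itv/= => /andP[t0 ts]; split => //=.
    + by rewrite -[s - t]ger0_norm ?subr_ge0 ?(ltW ts)// distrC.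
    + by rewrite subr_gt0 ts lerBlDr lerDl.
    + by rewrite distrC ger0_norm// ltW.
    + by move: t0 ts; rewrite subr_gt0 lerBlDr lerDl => -> ->.
  exact: lebesgue_measure_reflect _ (mI' _).
- congr (leb _); apply/seteqP; split => t [/= At ti]; split => //; move: At ti => /=;
    by rewrite in_itv/= addrAC subrr add0r => + /andP[t0 _]; rewrite ger0_norm.
Qed.

Lemma RintI_split (a b : R) (f : R -> R) : 0 <= a -> 0 <= b -> bmf f ->
  \int[lebI b]_t f (a + t) + \int[lebI a]_t f t = \int[lebI (a + b)]_t f t.
Proof.
move=> a0 b0 bf.
have bfa : bmf (fun t : R => f (a + t)) by exact: bmf_comp (mshift a) bf.
apply: EFin_inj; rewrite EFinD !EFin_Rint//.
have -> : (\int[lebI b]_x (f (a + x)%R)%:E = \int[mpush (lebI b) (mshift a)]_x (f x)%:E)%E.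
  have := @integral_pushforward _ _ _ _ _ _ (mshift a) (lebI b) setT (EFin \o f).
  rewrite preimage_setT => /(_ _ (bmf_integrable _ bfa)) <- //.
  by apply/measurable_EFinP; exact: bf.1.
have bp : (mpush (lebI b) (mshift a)).-integrable setT (EFin \o f).
  have := @integrable_pushforward _ _ _ _ _ _ (mshift a) (lebI b) setT (EFin \o f).
  rewrite preimage_setT => /(_ _ (bmf_integrable _ bfa)); apply => //.
  by apply/measurable_EFinP; exact: bf.1.
rewrite -(@integral_measure_add _ _ _ (mpush (lebI b) (mshift a)) (lebI a))//; last first.
  exact: bmf_integrable bf.
apply: eq_measure_integral => A mA _.
by rewrite -[RHS](lebI_split a0 b0 mA); exact: measure_addE.
Qed.

Lemma RintI_dist (s S : R) (f : R -> R) : 0 <= s -> s <= S -> bmf f ->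
  \int[lebI S]_t f `|t - s| = \int[lebI s]_t f t + \int[lebI (S - s)]_t f t.
Proof.
move=> s0 sS bf.
have md : measurable_fun setT (fun t : R => `|t - s| : R).
  by apply: measurableT_comp => //; exact: measurable_funB.
have bfa : bmf (fun t : R => f `|t - s|) by exact: bmf_comp md bf.
apply: EFin_inj; rewrite EFinD !EFin_Rint//.
have -> : (\int[lebI S]_x (f `|x - s|%R)%:E = \int[mpush (lebI S) md]_x (f x)%:E)%E.
  have := @integral_pushforward _ _ _ _ _ _ md (lebI S) setT (EFin \o f).
  rewrite preimage_setT => /(_ _ (bmf_integrable _ bfa)) <- //.
  by apply/measurable_EFinP; exact: bf.1.
rewrite -(@integral_measure_add _ _ _ (lebI s) (lebI (S - s)))//; try exact: bmf_integrable bf.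
apply: eq_measure_integral => A mA _.
rewrite [LHS](lebI_dist s0 sS mA); exact/esym/measure_addE.
Qed.

(** Only values on [0, S) count, so comparisons of integrands can be restricted to the times at
    which the Markov property speaks. *)
Lemma RintI_mkcond (S : R) (f : R -> R) : bmf f ->
  \int[lebI S]_t f t = \int[lebI S]_t (f t * \1_(`[0, S[%classic : set R) t).
Proof.
move=> bf; have mIS := measurable_co S.
have b2 : bmf (fun t : R => f t * \1_(`[0, S[%classic : set R) t).
  by apply: bmfM => //; exact: bmf_indic.
have E0 : \int[lebI S]_t (f t - f t * \1_(`[0, S[%classic : set R) t) = 0.
  rewrite /Rintegral (_ : \int[lebI S]_t _ = 0)%E//.
  pose D := (`[0, S[%classic : set R).
  have mD : measurable D by exact: mIS.
  rewrite -(setvU D) integral_setU//; last 3 first.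
  - exact: measurableC.
  - by rewrite setvU; apply/measurable_EFinP; exact: (bmfB bf b2).1.
  - by rewrite disj_set2E setICl.
  rewrite (@integral0_eq _ _ _ _ D) ?adde0; last first.
    move=> t It; rewrite indicE; case: (boolP (t \in _)) => [_|/negP]; first by rewrite mulr1 subrr.
    by rewrite inE.
  rewrite (@eq_measure_integral _ _ _ _ mzero) => [|A mA AE]; last first.
    transitivity (leb set0); [congr (leb _); apply/seteqP; split => // x [/AE]|exact: measure0].
    by [].
  by rewrite integral_measure_zero.
by move: E0; rewrite RintB// => /eqP; rewrite subr_eq0 => /eqP.
Qed.

Lemma eq_RintI (S : R) (f g : R -> R) : bmf f -> bmf g -> (forall t, 0 <= t < S -> f t = g t) ->
  \int[lebI S]_t f t = \int[lebI S]_t g t.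
Proof.
move=> bf bg fg; rewrite (RintI_mkcond S bf) (RintI_mkcond S bg).
apply: eq_Rintegral => t _; rewrite indicE; case: (boolP (t \in _)); last by rewrite !mulr0.
by rewrite inE /= in_itv/= => /fg ->.
Qed.

Lemma le_RintI (S : R) (f : R -> R) (c : R) : 0 <= S -> bmf f -> (forall t, 0 <= t < S -> f t <= c) ->
  \int[lebI S]_t f t <= c * S.
Proof.
move=> S0 bf fc; rewrite -{2}(lebI_setT S0) -Rint_cst.
rewrite (RintI_mkcond S bf) (RintI_mkcond S (bmf_cst _ c)).
apply: le_Rint => [||t].
- by apply: bmfM => //; exact: bmf_indic.
- by apply: bmfM => //; [exact: bmf_cst|exact: bmf_indic].
rewrite indicE; case: (boolP (t \in _)); last by rewrite !mulr0.
by rewrite inE /= in_itv/= !mulr1 => /fc.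
Qed.

End lebesgue_interval.

(** * The time-integrated semigroup as a density *)

Section cond_density_bmf.
Context d (T : measurableType d) d' (S : measurableType d') (R : realType).

Lemma Rint_shiftr (m : {finite_measure set T -> \bar R}) (g u : T -> R) (M : R) :
  bmf g -> bmf u ->
  \int[m]_x ((g x + M) * u x) = \int[m]_x (g x * u x) + M * \int[m]_x u x.
Proof.
move=> bg bu; rewrite -RintZ// -RintD//; [|exact: bmfM|exact: bmfZ].
by congr Rintegral; apply/funext => x; rewrite mulrDl.
Qed.

End cond_density_bmf.

Lemma cond_density_bmf d (T : measurableType d) d' (S : measurableType d') (R : realType)
    (m : {finite_measure set S -> \bar R}) (E : set S) (mE : measurable E)
    (Z : S -> T) (mZ : measurable_fun setT Z)
    (mu : {finite_measure set T -> \bar R}) (K : R) :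
  (forall A, measurable A -> (m (Z @^-1` A `&` E) <= K%:E * mu A)%E) ->
  exists u : T -> R, bmf u /\
    forall g, bmf g -> \int[m]_s (g (Z s) * \1_E s) = \int[mu]_x (g x * u x).
Proof.
move=> mK; have [u [mu_ u01 uE]] := cond_density mE mZ mK.
have bu : bmf u.
  by split=> //; exists `|K| => x; have /andP[u0 uK] := u01 x; rewrite ger0_norm.
have b1 : bmf (\1_E : S -> R) by exact: bmf_indic.
exists u; split => // g bg; have [mg [M gM]] := bg.
have gM0 x : 0 <= g x + M.
  by rewrite -lerBlDr sub0r; have := gM x; rewrite ler_norml => /andP[].
have M0 : 0 <= M by apply: le_trans (gM point); exact: normr_ge0.
have key (h : T -> R) : bmf h -> (forall x, 0 <= h x) ->
    \int[m]_s (h (Z s) * \1_E s) = \int[mu]_x (h x * u x).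
  move=> bh h0; congr fine; under eq_integral do rewrite EFinM.
  rewrite (uE (EFin \o h))//; last by apply/measurable_EFinP; exact: bh.1.
have bgZ : bmf (fun s => g (Z s)) by exact: bmf_comp bg.
have bgM : bmf (fun x => g x + M) by apply: bmfD => //; exact: bmf_cst.
have := key _ bgM gM0.
rewrite (Rint_shiftr m M bgZ b1) (Rint_shiftr mu M bg bu).
have := key _ (bmf_cst _ M) (fun=> M0); rewrite RintZ// RintZ// => ->.
exact: addIr.
Qed.

Lemma bmf_prod d1 d2 (T1 : measurableType d1) (T2 : measurableType d2)
    (R : realType) (f : T1 * T2 -> R) (m1 : {finite_measure set T1 -> \bar R})
    (m2 : {finite_measure set T2 -> \bar R}) (m : {finite_measure set (T1 * T2)%type -> \bar R}) :
  (forall A, m A = (m1 \x m2)%E A) ->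
  bmf f -> \int[m]_z f z = \int[m1]_x \int[m2]_y f (x, y).
Proof.
move=> mE bf; have [mf [M fM]] := bf.
have b1 x : bmf (fun y => f (x, y)) by apply: bmf_comp bf; exact: pair1_measurable.
congr fine.
rewrite (@eq_measure_integral _ _ _ _ (m1 \x m2)%E); last by move=> A _ _; exact: mE.
under [RHS]eq_integral do rewrite EFin_Rint//.
rewrite -(@integral12_prod_meas1 _ _ _ _ _ m1 m2 (EFin \o f))//.
apply: (@eq_integrable _ _ _ _ _ _ (EFin \o f)) => //.
have := bmf_integrable m bf.
move=> /integrableP[? fin]; apply/integrableP; split => //; move: fin.
by rewrite [X in (X < _)%E -> _](@eq_measure_integral _ _ _ _ (m1 \x m2)%E)// => A _ _; exact: mE.
Qed.

Section density.
Context (R : realType) (d : nat) (dO : measure_display).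
Context (Omega : measurableType dO) (P : probability Omega R).
Variables (X : R -> Omega -> d.-tuple R).
Variables (Pk : R -> d.-tuple R -> probability (d.-tuple R) R).
Variable mu : probability (d.-tuple R) R.
Hypothesis markov : markov_process P X Pk mu.
Hypothesis inv : mu_invariant Pk mu.
Variables (B : set (d.-tuple R)) (mB : measurable B).

Let mX t : measurable_fun setT (X t) := measurable_marginal markov t.
Let mXX := measurable_process markov.

Lemma bmf_marginal t (g : d.-tuple R -> R) : bmf g -> bmf (fun w => g (X t w)).
Proof. exact: bmf_comp (mX t). Qed.

Lemma bmf_process_shift h (g : d.-tuple R -> R) : bmf g -> bmf (fun tw : R * Omega => g (X (h + tw.1) tw.2)).
Proof.
move=> bg; apply: (@bmf_comp _ _ _ _ _ _ (fun tw : R * Omega => (X (h + tw.1) tw.2)) _ bg).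
have mh : measurable_fun setT (fun tw : R * Omega => (h + tw.1, tw.2)).
  apply/measurable_fun_pair => //; apply: measurable_funD => //.
exact: measurableT_comp mXX mh.
Qed.

Let prodm S : {measure set (R * Omega)%type -> \bar R} := (lebI S \x P)%E.

Let prodm_fin S : fin_num_fun (prodm S).
Proof.
move=> A mA; rewrite ge0_fin_numE ?measure_ge0//.
apply: (@le_lt_trans _ _ (prodm S (setT `*` setT))).
  by apply: le_measure; rewrite ?inE ?setXTT//.
have -> : (prodm S (setT `*` setT) = lebI S setT * P setT)%E by exact: product_measure1E.
rewrite probability_setT mule1.
by rewrite -ge0_fin_numE ?measure_ge0// fin_num_measure.
Qed.

(** For nonnegative times this is the pairing of g with P_(h+t) 1_B. Written through the process, it
    is measurable in t. *)
Definition corr (g : d.-tuple R -> R) h (t : R) : R :=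
  \int[P]_w (g (X 0 w) * \1_B (X (h + t) w)).

Lemma bmf_corr (g : d.-tuple R -> R) (h : R) : bmf g -> bmf (corr g h).
Proof.
move=> bg; apply: (@bmf_fst _ _ _ _ _ (fun tw : R * Omega => g (X 0 tw.2) * \1_B (X (h + tw.1) tw.2)) P).
apply: bmfM; last exact: bmf_process_shift (bmf_indic _ mB).
by apply: (@bmf_comp _ _ _ _ _ (fun w => g (X 0 w)) _ measurable_snd); exact: bmf_marginal.
Qed.

Lemma corr_markov (g : d.-tuple R -> R) (t : R) : bmf g -> 0 <= t ->
  corr g 0 t = \int[mu]_x (g x * semigroup Pk t (\1_B) x).
Proof. by move=> bg t0; rewrite /corr (Rint_markov2 markov inv (lexx 0) t0 bg)//; exact: bmf_indic. Qed.

(** [u] stands for the integral of P_(h+t) 1_B over t in [0, S). Under time x [P], restricting to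
    the event that X_(h+t) lies in [B] and projecting to X_0 gives a measure dominated by S mu,
    since X_0 has law mu; [u] is its density. *)
Lemma density (S h : R) : 0 <= S -> exists u : d.-tuple R -> R, bmf u /\
  forall g : d.-tuple R -> R, bmf g -> \int[lebI S]_t corr g h t = \int[mu]_x (g x * u x).
Proof.
move=> S0.
pose m : {finite_measure set (R * Omega)%type -> \bar R} := mfin (prodm_fin S).
pose E := [set tw : R * Omega | B (X (h + tw.1) tw.2)].
have b1 := bmf_process_shift h (bmf_indic R mB).
have mE : measurable E.
  have := b1.1 measurableT [set 1] (measurable_set1 _).
  rewrite setTI; congr (measurable _); apply/seteqP; split => tw /=; rewrite /E/= indicE.
    by case: (boolP (_ \in _)) => [|_ /eqP]; rewrite ?inE// eq_sym oner_eq0.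
  by move=> Bx; rewrite mem_set.
have mZ : measurable_fun setT (fun tw : R * Omega => X 0 tw.2).
  exact: measurableT_comp (mX 0) measurable_snd.
have [|u [bu uE]] := @cond_density_bmf _ _ _ _ _ m E mE _ mZ mu S.
  move=> A mA; apply: (@le_trans _ _ (m (setT `*` (X 0 @^-1` A)))).
    apply: le_measure; rewrite ?inE.
    + by apply: measurableI => //; rewrite -[X in measurable X]setTI; exact: mZ.
    + by apply: measurableX => //; exact (measurable_preimage_marginal markov _ mA).
    + by move=> tw [/= ? _]; split.
  have -> : (m (setT `*` (X 0 @^-1` A)) = lebI S setT * P (X 0 @^-1` A))%E.
    by apply: product_measure1E => //; exact (measurable_preimage_marginal markov _ mA).
  rewrite [X in (X * _)%E]lebI_setTE//.
  rewrite le_eqVlt; apply/orP; left; apply/eqP; congr (_ * _)%E.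
  exact (law_marginal markov inv (lexx 0) mA).
exists u; split => // g bg; rewrite -uE//.
rewrite (@bmf_prod _ _ _ _ _ _ (lebI S) P m)//.
apply: bmfM; last exact: bmf_indic.
by apply: (@bmf_comp _ _ _ _ _ (fun w => g (X 0 w)) _ measurable_snd); exact: bmf_marginal.
Qed.

Lemma semigroup_comp s t f : 0 <= s -> 0 <= t -> measurable f ->
  semigroup Pk s (semigroup Pk t (\1_f)) = semigroup Pk (s + t) (\1_f).
Proof.
move=> s0 t0 mf; apply/funext => x.
have E r y : 0 <= r -> semigroup Pk r (\1_f) y = fine (Pk r y f).
  by move=> r0; rewrite /semigroup integral_indic// setIT.
have [_ _ [_ CK] _ _] := markov.
rewrite E ?addr_ge0// CK// /semigroup; congr fine.
by apply: eq_integral => y _; rewrite -[fine _]/(semigroup Pk t (\1_f) y) E// fineK// fin_num_measure.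
Qed.

(** P_h commutes with the time integral. As [u] is known only by its pairings, P_h is first moved to
    the test function by its adjoint, and back after the pairing has become a time integral of
    correlations. *)
Lemma semigroup_density (S h : R) (u uh : d.-tuple R -> R) : 0 <= S -> 0 <= h -> bmf u -> bmf uh ->
  (forall g : d.-tuple R -> R, bmf g -> \int[lebI S]_t corr g 0 t = \int[mu]_x (g x * u x)) ->
  (forall g : d.-tuple R -> R, bmf g -> \int[lebI S]_t corr g h t = \int[mu]_x (g x * uh x)) ->
  forall g : d.-tuple R -> R, bmf g -> \int[mu]_x (g x * semigroup Pk h u x) = \int[mu]_x (g x * uh x).
Proof.
move=> S0 h0 bu buh uE uhE.
have bsu : bmf (semigroup Pk h u) := (bmf_semigroup markov h0 bu).
have key A : measurable A -> \int[mu]_x (\1_A x * semigroup Pk h u x) = \int[mu]_x (\1_A x * uh x).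
  move=> mA; have bA := bmf_indic R mA.
  have mXA : measurable (X 0 @^-1` A) by exact (measurable_preimage_marginal markov _ mA).
  (* [k] is the adjoint of P_h in L^2(mu) applied to 1_A: the conditional probability that X_0 lies
     in [A] given X_h. *)
  have [|k [bk kE]] := @cond_density_bmf _ _ _ _ _ P _ mXA _ (mX h) mu 1.
    move=> A' mA'; rewrite mul1e; apply: (@le_trans _ _ (P (X h @^-1` A'))).
      apply: le_measure; rewrite ?inE.
      + by apply: measurableI => //; exact (measurable_preimage_marginal markov _ mA').
      + exact (measurable_preimage_marginal markov _ mA').
      + exact: subIsetl.
    by rewrite le_eqVlt; apply/orP; left; apply/eqP; exact (law_marginal markov inv h0 mA').
  have kE' g : bmf g -> \int[P]_w (\1_A (X 0 w) * g (X h w)) = \int[mu]_x (k x * g x).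
    move=> bg; under [RHS]eq_Rintegral do rewrite mulrC.
    rewrite -kE//; apply: eq_Rintegral => w _; rewrite mulrC; congr (_ * _).
  rewrite -(Rint_markov2 markov inv (lexx 0) h0)// add0r kE'// -uE// -uhE//.
  apply: eq_RintI; [exact: bmf_corr|exact: bmf_corr|] => t /andP[t0 _].
  have bt : bmf (semigroup Pk t (\1_B)) by apply: (bmf_semigroup markov) => //; exact: bmf_indic.
  rewrite corr_markov// -kE'//.
  have := Rint_markov2 markov inv (lexx 0) h0 bA bt; rewrite add0r => ->.
  rewrite semigroup_comp// -(Rint_markov2 markov inv (lexx 0))//; first by rewrite add0r.
    exact: addr_ge0.
  exact: bmf_indic.
have ae : ae_eq mu setT (EFin \o semigroup Pk h u) (EFin \o uh).
  apply: integral_ae_eq => //.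
  - exact: bmf_integrable bsu.
  - by apply/measurable_EFinP; exact: buh.1.
  - move=> A _ mA; have bA := bmf_indic R mA.
    have E f : bmf f -> (\int[mu]_(x in A) (EFin \o f) x)%E = (\int[mu]_x (\1_A x * f x))%:E.
      move=> bf; rewrite EFin_Rint; last exact: bmfM.
      rewrite integral_mkcond; apply: eq_integral => x _.
      by rewrite epatch_indic muleC -EFinM.
    by rewrite !E// key.
move=> g bg; congr fine; apply: ae_eq_integral => //.
- by apply/measurable_EFinP; exact: (bmfM bg bsu).1.
- by apply/measurable_EFinP; exact: (bmfM bg buh).1.
- by apply: filterS ae => x /= + _ => /(_ I) [->].
Qed.

(** Cutting [0, S + h) at h or at S turns P_h u - u, a difference of integrals of length S, into
    integrals of length h near S and near 0. Divided by h, they converge to the pairing with P_S 1_B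
    - 1_B. *)
Lemma Rint_corr_split (S h : R) (g : d.-tuple R -> R) : 0 <= S -> 0 <= h -> bmf g ->
  \int[lebI S]_t corr g h t - \int[lebI S]_t corr g 0 t =
  \int[lebI h]_t corr g S t - \int[lebI h]_t corr g 0 t.
Proof.
move=> S0 h0 bg.
have bc := bmf_corr 0 bg.
have E a t : corr g a t = corr g 0 (a + t) by rewrite /corr add0r.
rewrite (_ : corr g h = (fun t => corr g 0 (h + t))); last by apply/funext => t; exact: E.
rewrite (_ : corr g S = (fun t => corr g 0 (S + t))); last by apply/funext => t; exact: E.
have := RintI_split h0 S0 bc; have := RintI_split S0 h0 bc.
by rewrite [h + S]addrC => <- /eqP; rewrite addrC -subr_eq => /eqP <-; ring.
Qed.

End density.

Ltac bmf_tac := repeat first [ assumption | exact: bmf_cst | apply: bmfX2 | apply: bmfB |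
  apply: bmfD | apply: bmfM | apply: bmfN ].

Lemma Rint_sqr_ge0 d (T : measurableType d) (R : realType)
    (m : {measure set T -> \bar R}) (f : T -> R) : 0 <= \int[m]_x (f x ^+ 2).
Proof. by apply: Rintegral_ge0 => x _; exact: sqr_ge0. Qed.

(** * From coercivity to the variance of the empirical measure *)

Section variance.
Context (R : realType) (d : nat) (dO : measure_display).
Context (Omega : measurableType dO) (P : probability Omega R).
Variables (X : R -> Omega -> d.-tuple R).
Variables (Pk : R -> d.-tuple R -> probability (d.-tuple R) R).
Variable mu : probability (d.-tuple R) R.
Hypothesis markov : markov_process P X Pk mu.
Hypothesis inv : mu_invariant Pk mu.
Hypothesis sc : strongly_continuous Pk mu.
Variable lam : R.
Hypothesis lam0 : 0 < lam.
Hypothesis coer : coercive Pk mu lam.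
Variables (B : set (d.-tuple R)) (mB : measurable B).

Let b1 : bmf (\1_B : d.-tuple R -> R) := bmf_indic R mB.
Let bsg (t : R) (f : d.-tuple R -> R) : 0 <= t -> bmf f -> bmf (semigroup Pk t f).
Proof. exact: (bmf_semigroup markov). Qed.

Lemma L2_bmf (f : d.-tuple R -> R) : bmf f -> L2 mu f.
Proof.
move=> bf; split; first exact: bf.1.
by rewrite -(EFin_Rint mu (bmfX2 bf)) ltry.
Qed.

Lemma L2sq_bmf (f : d.-tuple R -> R) : bmf f -> L2sq mu f = (\int[mu]_x (f x ^+ 2))%:E.
Proof. by move=> bf; rewrite -[LHS](EFin_Rint mu (bmfX2 bf)). Qed.

Lemma semigroupB (t : R) (f g : d.-tuple R -> R) x : bmf f -> bmf g ->
  semigroup Pk t (fun y => f y - g y) x = semigroup Pk t f x - semigroup Pk t g x.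
Proof. by move=> bf bg; exact: (RintB (Pk t x) bf bg). Qed.

Lemma semigroup_cst (t r : R) x : semigroup Pk t (fun=> r) x = r.
Proof. exact: (Rint_cstP (Pk t x) r). Qed.

Lemma sqr_Rint_le d' (T : measurableType d') (nu : probability T R) (f : T -> R) :
  bmf f -> (\int[nu]_x f x) ^+ 2 <= \int[nu]_x (f x ^+ 2).
Proof.
move=> bf; set m := \int[nu]_x f x.
have : 0 <= \int[nu]_x (f x ^+ 2 - (2 * m) * f x + m ^+ 2).
  apply: Rintegral_ge0 => x _.
  by rewrite (_ : _ + _ = (f x - m) ^+ 2) ?sqr_ge0//; ring.
rewrite RintD; [|bmf_tac|bmf_tac]; rewrite RintB; [|bmf_tac|bmf_tac].
rewrite RintZ// Rint_cstP -/m => H.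
by rewrite -subr_ge0 (_ : _ - _ = \int[nu]_x (f x ^+ 2) - 2 * m * m + m ^+ 2)//; ring.
Qed.

Lemma semigroup_contraction (t : R) (f : d.-tuple R -> R) : 0 <= t -> bmf f ->
  \int[mu]_x (semigroup Pk t f x ^+ 2) <= \int[mu]_x (f x ^+ 2).
Proof.
move=> t0 bf; rewrite -(Rint_semigroup markov inv t0 (bmfX2 bf)).
apply: le_Rint; [exact: bmfX2 (bsg t0 bf)|exact: bsg t0 (bmfX2 bf)|] => x.
exact: (sqr_Rint_le (Pk t x) bf).
Qed.

Lemma semigroup0 (f : d.-tuple R -> R) : bmf f -> semigroup Pk 0 f = f.
Proof.
move=> bf; apply/funext => x; have [_ _ [P0 _] _ _] := markov.
rewrite /semigroup (@eq_measure_integral _ _ _ _ \d_x); last by move=> A mA _; exact: P0.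
have mE : measurable_fun setT (fun y => (f y)%:E) by apply/measurable_EFinP; exact: bf.1.
by rewrite (integral_dirac x measurableT mE) diracT mul1e.
Qed.

(* [u] plays the role of [\int_0^S P_t 1_B dt], which cannot be written down directly:
   [P_t 1_B (x)] is not assumed jointly measurable in [(t, x)]. *)
Let potential (S : R) (u : d.-tuple R -> R) :=
  forall g : d.-tuple R -> R, bmf g -> \int[lebI S]_t corr P X B g 0 t = \int[mu]_x (g x * u x).

(** The error [D] of the difference quotient is bounded, hence an admissible test function, and is
    paired with itself. Only the continuity at time 0 of t |-> P_t 1_B enters. *)
Lemma difference_quotient_bound (S h eps : R) (u : d.-tuple R -> R) :
  0 <= S -> 0 < h -> bmf u -> potential S u -> 0 <= eps ->
  (forall t, 0 < t < h -> \int[mu]_x ((semigroup Pk t (\1_B) x - \1_B x) ^+ 2) <= eps) ->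
  \int[mu]_x (((semigroup Pk h u x - u x) / h - (semigroup Pk S (\1_B) x - \1_B x)) ^+ 2)
    <= 4 * eps.
Proof.
move=> S0 h0 bu uE eps0 small.
have [uh [buh uhE]] := density markov inv mB h S0.
have bhu := bsg (ltW h0) bu; have bS := bsg S0 b1.
pose G x := semigroup Pk S (\1_B) x - \1_B x.
have bG : bmf G by rewrite /G; bmf_tac.
pose D := fun x => (semigroup Pk h u x - u x) / h - (semigroup Pk S (\1_B) x - \1_B x).
have bD : bmf D by rewrite /D; bmf_tac.
have DE x : D x = (semigroup Pk h u x - u x) / h - G x by [].
have GE x : G x = semigroup Pk S (\1_B) x - \1_B x by [].
suff : \int[mu]_x (D x ^+ 2) <= 4 * eps by [].
clearbody D G.
have E1 : \int[mu]_x (D x * (semigroup Pk h u x - u x)) =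
    \int[lebI h]_t (corr P X B D S t - corr P X B D 0 t).
  rewrite RintB; [|exact (bmf_corr markov mB S bD)|exact (bmf_corr markov mB 0 bD)].
  rewrite -(Rint_corr_split markov mB S0 (ltW h0) bD) uE// uhE//.
  rewrite -(semigroup_density markov inv mB S0 (ltW h0) bu buh uE uhE bD).
  rewrite -(RintB mu (bmfM bD bhu) (bmfM bD bu)).
  by congr Rintegral; apply/funext => x; rewrite mulrBr.
have E2 : \int[mu]_x (D x * (semigroup Pk h u x - u x)) =
    h * (\int[mu]_x (D x ^+ 2) + \int[mu]_x (D x * G x)).
  rewrite -(RintD mu (bmfX2 bD) (bmfM bD bG)) -(RintZ mu h (bmfD (bmfX2 bD) (bmfM bD bG))).
  congr Rintegral; apply/funext => x; rewrite DE.
  by field; rewrite gt_eqF.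
(* With w = P_t 1_B - 1_B one has P_(S+t) 1_B - P_t 1_B = G + P_S w - w, and |P_S w|^2 <= |w|^2 <=
   eps. Young's inequality costs |D|^2 / 2, which is absorbed on the left. *)
have E3 : \int[lebI h]_t (corr P X B D S t - corr P X B D 0 t) <=
    (\int[mu]_x (D x * G x) + 2^-1 * \int[mu]_x (D x ^+ 2) + 2 * eps) * h.
  apply: le_RintI; first exact: ltW.
    exact (bmfB (bmf_corr markov mB S bD) (bmf_corr markov mB 0 bD)).
  move=> t /andP[t0 th].
  have -> : corr P X B D S t = corr P X B D 0 (S + t) by rewrite /corr add0r.
  rewrite (corr_markov markov inv mB bD t0) (corr_markov markov inv mB bD (addr_ge0 S0 t0)).
  have bt := bsg t0 b1; have bSt := bsg (addr_ge0 S0 t0) b1.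
  pose w x := semigroup Pk t (\1_B) x - \1_B x.
  have bw : bmf w by rewrite /w; bmf_tac.
  have w2 : \int[mu]_x (w x ^+ 2) <= eps.
    move: t0; rewrite le_eqVlt => /orP[/eqP t0|t0]; last by apply: small; rewrite t0.
    rewrite /w -t0 semigroup0//; under eq_Rintegral do rewrite subrr expr0n/=.
    by rewrite Rint_cstP.
  have bSw := bsg S0 bw.
  have Sw2 := le_trans (semigroup_contraction S0 bw) w2.
  have SwE x : semigroup Pk S w x = semigroup Pk (S + t) (\1_B) x - semigroup Pk S (\1_B) x.
    by rewrite semigroupB// (semigroup_comp markov).
  have wE x : w x = semigroup Pk t (\1_B) x - \1_B x by [].
  clearbody w.
  have bDt := bmfM bD bt; have bDG := bmfM bD bG; have bD2 := bmfZ 2^-1 (bmfX2 bD).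
  have bSw2 := bmfX2 bSw; have bw2 := bmfX2 bw.
  have : \int[mu]_x (D x * semigroup Pk (S + t) (\1_B) x) <=
      \int[mu]_x (D x * semigroup Pk t (\1_B) x +
        (D x * G x + (2^-1 * D x ^+ 2 + (semigroup Pk S w x ^+ 2 + w x ^+ 2)))).
    apply: (le_Rint mu (bmfM bD bSt) (bmfD bDt (bmfD bDG (bmfD bD2 (bmfD bSw2 bw2))))) => x.
    rewrite SwE wE GE -subr_ge0.
    rewrite (_ : _ - _ = (D x / 2 - (semigroup Pk (S + t) (\1_B) x - semigroup Pk S (\1_B) x)) ^+ 2
      + (D x / 2 + (semigroup Pk t (\1_B) x - \1_B x)) ^+ 2).
      by rewrite addr_ge0 ?sqr_ge0.
    by field.
  rewrite (RintD mu bDt (bmfD bDG (bmfD bD2 (bmfD bSw2 bw2)))).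
  rewrite (RintD mu bDG (bmfD bD2 (bmfD bSw2 bw2))) (RintD mu bD2 (bmfD bSw2 bw2)).
  rewrite (RintD mu bSw2 bw2) (RintZ mu _ (bmfX2 bD)); lra.
move: E3; rewrite -E1 E2 [_ * h]mulrC ler_pM2l// => E3; lra.
Qed.

(** P_t preserves constants, so [c] is free; it will be the mean of [u], as coercivity concerns
    functions of mean zero. *)
Lemma generator_potential (S c : R) (u : d.-tuple R -> R) :
  0 <= S -> bmf u -> potential S u ->
  generator mu Pk (fun x => u x - c) (fun x => semigroup Pk S (\1_B) x - \1_B x).
Proof.
move=> S0 bu uE; have bS := bsg S0 b1.
split; [by apply: L2_bmf; bmf_tac|by apply: L2_bmf; bmf_tac|].
have bt t : 0 < t -> bmf (semigroup Pk t (\1_B)) by move=> t0; exact: bsg (ltW t0) b1.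
have /fine_cvgP[_ /cvgrPdist_le sB] := sc (L2_bmf b1).
have DE h : 0 < h -> L2sq mu (fun x => (semigroup Pk h (fun x => u x - c) x - (u x - c)) / h -
     (semigroup Pk S \1_B x - \1_B x)) =
   (\int[mu]_x (((semigroup Pk h u x - u x) / h - (semigroup Pk S (\1_B) x - \1_B x)) ^+ 2))%:E.
  move=> h0; have bh := bsg (ltW h0) bu.
  rewrite -L2sq_bmf; last by bmf_tac.
  congr L2sq; apply/funext => x; rewrite semigroupB//; last exact: bmf_cst.
  by rewrite semigroup_cst; congr (_ / _ - _); ring.
apply/fine_cvgP; split.
  by near=> h; rewrite DE//; near: h; exact: nbhs_right_gt.
apply/cvgrPdist_le => e e0.
have e40 : 0 < e / 4 by rewrite divr_gt0.
have [delta /= delta0 sdelta] := sB _ e40.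
exists delta => //= h; rewrite /ball_/= sub0r normrN => hd h0.
rewrite sub0r normrN DE//= ger0_norm; last by apply: Rintegral_ge0 => x _; exact: sqr_ge0.
rewrite -(@divfK _ 4 _ e)// mulrC.
apply: difference_quotient_bound => //; first exact: ltW.
move=> t /andP[t0 th].
have := sdelta t; rewrite /ball_/= sub0r normrN => /(_ _ t0).
rewrite sub0r normrN L2sq_bmf/=; last by have btt := bt _ t0; bmf_tac.
rewrite (ger0_norm (Rint_sqr_ge0 _ _)).
apply; rewrite gtr0_norm//; apply: lt_trans th _.
by rewrite -(gtr0_norm h0).
Unshelve. all: by end_near. Qed.

Let c := fine (mu B).
Let F (x : d.-tuple R) : R := \1_B x - c.
Let bF : bmf F. Proof. by rewrite /F; bmf_tac. Qed.

Let F_mean0 : \int[mu]_x F x = 0.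
Proof. by rewrite RintB// ?Rint_cstP ?Rint_indic ?subrr//; exact: bmf_cst. Qed.

(** Replacing 1_B by [F] subtracts a constant, which pairs to zero with the centred weight. *)
Let corr_center (t : R) : corr P X B F 0 t = \int[P]_w (F (X 0 w) * F (X t w)).
Proof.
have b0 := bmf_marginal markov 0 bF; have b1t := bmf_marginal markov t b1.
have := F_mean0; rewrite -(Rint_marginal markov inv (lexx 0) bF) => E.
have -> : \int[P]_w (F (X 0 w) * F (X t w)) =
    \int[P]_w (F (X 0 w) * \1_B (X t w)) - c * \int[P]_w F (X 0 w).
  rewrite -RintZ// -RintB; [|bmf_tac|bmf_tac].
  by congr Rintegral; apply/funext => w; rewrite /F; ring.
by rewrite E mulr0 subr0 /corr add0r.
Qed.

Lemma Rint_corr_le (S : R) : 0 <= S ->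
  \int[lebI S]_t corr P X B F 0 t <= 2 * (\int[mu]_x (F x ^+ 2)) / lam.
Proof.
move=> S0; have [u [bu uE]] := density markov inv mB 0 S0.
pose cu := \int[mu]_x u x.
have bS := bsg S0 b1.
have gen := generator_potential cu S0 bu uE.
have buc : bmf (fun x => u x - cu) by bmf_tac.
have muc0 : (\int[mu]_x (u x - cu)%:E)%E = 0%E.
  rewrite -(EFin_Rint mu buc) RintB; [|bmf_tac|bmf_tac].
  by rewrite Rint_cstP subrr.
pose G x := semigroup Pk S (\1_B) x - \1_B x.
have bG : bmf G by rewrite /G; bmf_tac.
have := coer gen muc0; rewrite L2sq_bmf// -(EFin_Rint mu (bmfM bG buc)) -EFinM -EFinN lee_fin => cI.
have bSF := bsg S0 bF.
have GE x : G x = semigroup Pk S F x - F x.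
  rewrite /F semigroupB//; last exact: bmf_cst.
  by rewrite semigroup_cst /G; ring.
set F2 := \int[mu]_x (F x ^+ 2).
(* |P_S F - F|^2 <= 2 |P_S F|^2 + 2 |F|^2 and P_S contracts; the bound is uniform in S. *)
have G2 : \int[mu]_x (G x ^+ 2) <= 4 * F2.
  apply: (@le_trans _ _ (\int[mu]_x (2 * semigroup Pk S F x ^+ 2 + 2 * F x ^+ 2))).
    apply: le_Rint; [bmf_tac|bmf_tac|] => x; rewrite GE.
    rewrite -subr_ge0 (_ : _ - _ = (semigroup Pk S F x + F x) ^+ 2) ?sqr_ge0//; ring.
  rewrite RintD; [|bmf_tac|bmf_tac]; rewrite RintZ; last by bmf_tac.
  rewrite RintZ; last by bmf_tac.
  have := semigroup_contraction S0 bF; rewrite -/F2; lra.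
set V := \int[mu]_x ((u x - cu) ^+ 2) in cI.
have V0 : 0 <= V by apply: Rintegral_ge0 => x _; exact: sqr_ge0.
have lamn0 : lam != 0 by rewrite gt_eqF.
(* Young's inequality weighted so that half of the coercive term absorbs the right-hand side. *)
have cI2 : lam * V <= (2 * lam)^-1 * \int[mu]_x (G x ^+ 2) + lam / 2 * V.
  apply: (le_trans cI); rewrite -RintZ; last by bmf_tac.
  rewrite -RintZ; last by bmf_tac.
  rewrite -RintD; [|bmf_tac|bmf_tac]; rewrite -mulN1r -RintZ; last by bmf_tac.
  apply: le_Rint; [bmf_tac|bmf_tac|] => x.
  rewrite -subr_ge0.
  rewrite (_ : _ - _ = (2 * lam)^-1 * (G x + lam * (u x - cu)) ^+ 2); last by field.
  by rewrite mulr_ge0 ?sqr_ge0// invr_ge0 mulr_ge0// ltW.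
have V2 : lam ^+ 2 * V <= 4 * F2.
  have : lam * (lam * V) <= lam * ((2 * lam)^-1 * \int[mu]_x (G x ^+ 2) + lam / 2 * V).
    by rewrite ler_pM2l.
  rewrite mulrDr [lam * ((2 * lam)^-1 * _)](_ : _ = 2^-1 * \int[mu]_x (G x ^+ 2)); last by field.
  rewrite [lam * (lam / 2 * V)](_ : _ = lam ^+ 2 * V / 2); last by field.
  rewrite [lam * (lam * V)](_ : _ = lam ^+ 2 * V); last by ring.
  lra.
have -> : \int[lebI S]_t corr P X B F 0 t = \int[mu]_x (F x * (u x - cu)).
  rewrite uE// -[LHS]subr0 -(mulr0 cu) -F_mean0 -RintZ// -RintB; [|bmf_tac|bmf_tac].
  by congr Rintegral; apply/funext => x; ring.
(* Since lam^2 V <= 4 F2, the weight lam / 4 makes each term at most F2 / lam, whence the factor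
   2. *)
apply: (@le_trans _ _ (\int[mu]_x (lam / 4 * (u x - cu) ^+ 2 + lam^-1 * F x ^+ 2))).
  apply: le_Rint; [bmf_tac|bmf_tac|] => x.
  rewrite -subr_ge0 (_ : _ - _ = lam / 4 * ((u x - cu) - 2 / lam * F x) ^+ 2); last by field.
  by rewrite mulr_ge0 ?sqr_ge0// divr_ge0// ltW.
rewrite RintD; [|bmf_tac|bmf_tac]; rewrite RintZ; last by bmf_tac.
rewrite RintZ; last by bmf_tac.
rewrite -/V -/F2 ler_pdivlMr// mulrDl.
rewrite (_ : lam^-1 * F2 * lam = F2); last by field.
rewrite (_ : lam / 4 * V * lam = lam ^+ 2 * V / 4); last by field.
lra.
Qed.

Lemma variance_time_integral (T : R) : 0 <= T ->
  \int[P]_w ((\int[lebI T]_t F (X t w)) ^+ 2) <= 4 * (\int[mu]_x (F x ^+ 2)) / lam * T.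
Proof.
move=> T0.
have bXF : bmf (fun tw : R * Omega => F (X tw.1 tw.2)).
  have := bmf_process_shift markov 0 bF; congr bmf; apply/funext => tw.
  by rewrite add0r.
have bXF' : bmf (fun wt : Omega * R => F (X wt.2 wt.1)).
  have ms : measurable_fun setT (fun wt : Omega * R => (wt.2, wt.1)) by exact: measurable_fun_pair.
  exact: (bmf_comp ms bXF).
pose Y w := \int[lebI T]_t F (X t w).
have bY : bmf Y by exact: (bmf_fst (lebI T) bXF').
have bXt t : bmf (fun w => F (X t w)) by exact: (bmf_marginal markov t bF).
have bXw w : bmf (fun t => F (X t w)).
  exact: (bmf_comp (pair1_measurable w) bXF').
have kE s t : 0 <= s -> s <= t -> \int[P]_w (F (X s w) * F (X t w)) = corr P X B F 0 (t - s).
  move=> s0 st; have ts0 : 0 <= t - s by rewrite subr_ge0.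
  rewrite corr_center.
  have := Rint_markov2 markov inv s0 ts0 bF bF; rewrite subrKC => ->.
  by have := Rint_markov2 markov inv (lexx 0) ts0 bF bF; rewrite add0r => ->.
have kE' s t : 0 <= s -> 0 <= t ->
    \int[P]_w (F (X s w) * F (X t w)) = corr P X B F 0 `|t - s|.
  move=> s0 t0; have [st|ts] := leP s t; first by rewrite kE// ger0_norm ?subr_ge0.
  under eq_Rintegral do rewrite mulrC.
  by rewrite kE ?(ltW ts)// distrC ger0_norm// subr_ge0 ltW.
have -> : \int[P]_w (Y w ^+ 2) = \int[P]_w \int[lebI T]_t (F (X t w) * Y w).
  apply: eq_Rintegral => w _; rewrite expr2 -RintZ//.
  by congr Rintegral; apply/funext => t; rewrite mulrC.
have bFY : bmf (fun wt : Omega * R => F (X wt.2 wt.1) * Y wt.1).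
  by apply: bmfM => //; exact: (bmf_comp measurable_fst bY).
rewrite (bmf_fubini P (lebI T) bFY)/=.
have bFYs : bmf (fun tw : R * Omega => F (X tw.1 tw.2) * Y tw.2).
  by apply: bmfM => //; exact: (bmf_comp measurable_snd bY).
apply: le_RintI => //; first exact: (bmf_fst P bFYs).
move=> t /andP[t0 tT].
have -> : \int[P]_w (F (X t w) * Y w) = \int[P]_w \int[lebI T]_s (F (X t w) * F (X s w)).
  by apply: eq_Rintegral => w _; rewrite RintZ.
have bFF : bmf (fun ws : Omega * R => F (X t ws.1) * F (X ws.2 ws.1)).
  by apply: bmfM => //; exact: (bmf_comp measurable_fst (bXt t)).
rewrite (bmf_fubini P (lebI T) bFF)/=.
have bc := bmf_corr markov mB 0 bF.
have bFFs : bmf (fun sw : R * Omega => F (X t sw.2) * F (X sw.1 sw.2)).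
  by apply: bmfM => //; exact: (bmf_comp measurable_snd (bXt t)).
have md : measurable_fun setT (fun s : R => `|s - t|).
  by apply: measurableT_comp => //; exact: measurable_funB.
rewrite (@eq_RintI _ T _ (fun s => corr P X B F 0 `|s - t|)); last 3 first.
- exact: (bmf_fst P bFFs).
- exact: (bmf_comp md bc).
- by move=> s /andP[s0 _]; exact: kE'.
(* The past and the future of t each contribute one integrated correlation, bounded independently of
   its length. *)
rewrite RintI_dist ?(ltW tT)//.
have Tt0 : 0 <= T - t by rewrite subr_ge0 ltW.
have := Rint_corr_le t0; have := Rint_corr_le Tt0.
set A := 2 * _ / _; rewrite (_ : 4 * _ / _ = A + A) => [? ?|]; last by rewrite /A; ring.
exact: lerD.
Qed.

(** The variance of 1_B is c - c^2 <= c. A bound linear in mu(B) can be summed over disjoint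
    cells. *)
Lemma variance_empirical (T : R) : 0 < T ->
  \int[P]_w ((T^-1 * \int[lebI T]_t \1_B (X t w) - c) ^+ 2) <= 4 * c / (lam * T).
Proof.
move=> T0; have := variance_time_integral (ltW T0).
have F2 : \int[mu]_x (F x ^+ 2) <= c.
  have -> : \int[mu]_x (F x ^+ 2) = c - c ^+ 2.
    have -> : (fun x => F x ^+ 2) = (fun x => (1 - 2 * c) * \1_B x + c ^+ 2).
      apply/funext => x; rewrite /F indicE; case: (_ \in _) => /=; ring.
    rewrite RintD; [|bmf_tac|bmf_tac]; rewrite RintZ// Rint_indic// Rint_cstP -/c; ring.
  by rewrite lerBlDr lerDl sqr_ge0.
have bXB : bmf (fun wt : Omega * R => (\1_B (X wt.2 wt.1) : R)).
  have : bmf (fun tw : R * Omega => (\1_B (X tw.1 tw.2) : R)).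
    have := bmf_process_shift markov 0 b1; congr bmf; apply/funext => tw.
    by rewrite add0r.
  have ms : measurable_fun setT (fun wt : Omega * R => (wt.2, wt.1)) by exact: measurable_fun_pair.
  exact: (bmf_comp ms).
have bXw w : bmf (fun t => \1_B (X t w) : R).
  exact: (bmf_comp (pair1_measurable w) bXB).
have bY : bmf (fun w => \int[lebI T]_t (\1_B (X t w) : R)) by exact: (bmf_fst (lebI T) bXB).
have E w : T^-1 * \int[lebI T]_t \1_B (X t w) - c = T^-1 * \int[lebI T]_t F (X t w).
  rewrite RintB//; last exact: bmf_cst.
  by rewrite Rint_cst lebI_setT ?(ltW T0)//; field; rewrite gt_eqF.
under [X in _ -> X <= _]eq_Rintegral do rewrite E exprMn.
have bYF : bmf (fun w => \int[lebI T]_t F (X t w)).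
  have -> : (fun w => \int[lebI T]_t F (X t w)) =
     (fun w => \int[lebI T]_t \1_B (X t w) - c * T).
    apply/funext => w; rewrite RintB//; last exact: bmf_cst.
    by rewrite Rint_cst lebI_setT ?(ltW T0).
  by bmf_tac.
rewrite RintZ; last by bmf_tac.
move=> H.
apply: (@le_trans _ _ (T^-1 ^+ 2 * (4 * (\int[mu]_x (F x ^+ 2)) / lam * T))).
  by rewrite ler_wpM2l// sqr_ge0.
have lamn0 : lam != 0 by rewrite gt_eqF.
have Tn0 : T != 0 by rewrite gt_eqF.
rewrite (_ : T^-1 ^+ 2 * _ = 4 * (\int[mu]_x (F x ^+ 2)) / (lam * T)); last first.
  by field; apply/andP.
by rewrite ler_wpM2r ?invr_ge0 ?mulr_ge0 ?(ltW lam0) ?(ltW T0)// ler_wpM2l.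
Qed.

End variance.

(** * Greedy coupling along a finite tree *)

Section tree_coupling.
Context (R : realFieldType) (I K : finType).
Implicit Types (e : I -> K) (a b p q : I -> R) (pi : I -> I -> R).

Definition class_sum e a k := \sum_(i | e i == k) a i.

Lemma class_sum_ge0 e a k : (forall i, 0 <= a i) -> 0 <= class_sum e a k.
Proof. by move=> a0; apply: sumr_ge0. Qed.

Lemma sum_class_sum e a : \sum_k class_sum e a k = \sum_i a i.
Proof. by rewrite (partition_big e xpredT). Qed.

Lemma class_sumB e a b k :
  class_sum e (fun i => a i - b i) k = class_sum e a k - class_sum e b k.
Proof. by rewrite /class_sum sumrB. Qed.

(** Inside each class, the product normalised by the larger of the two masses: exactly the smaller
    mass is moved. When both masses vanish, division by zero gives the desired value 0. *)
Let match_class e a b (i j : I) : R :=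
  if e i == e j then
    a i * b j / Num.max (class_sum e a (e i)) (class_sum e b (e i)) else 0.

Let prod_div_max (x y : R) : 0 <= x -> 0 <= y -> x * y / Num.max x y = Num.min x y.
Proof.
move=> x0 y0; have [xy|yx] := leP x y.
  have [yE|yn0] := eqVneq y 0.
    have xE : x = 0 by apply/eqP; rewrite eq_le x0 -yE xy.
    by rewrite xE yE mul0r mul0r.
  by rewrite mulfK.
by rewrite mulrAC divff ?mul1r// gt_eqF// (le_lt_trans y0).
Qed.

Let match_classC e a b i j : match_class e a b i j = match_class e b a j i.
Proof.
rewrite /match_class eq_sym; case: ifP => // /eqP ->.
by rewrite maxC [a i * _]mulrC.
Qed.

Let match_row e a b i : (forall i, 0 <= a i) -> (forall i, 0 <= b i) ->
  \sum_j match_class e a b i j =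
  a i * (class_sum e b (e i) / Num.max (class_sum e a (e i)) (class_sum e b (e i))).
Proof.
move=> a0 b0; rewrite /match_class -big_mkcond/=.
under eq_bigl do rewrite eq_sym.
by rewrite -mulr_suml -mulr_sumr mulrA.
Qed.

Let match_row_le e a b i : (forall i, 0 <= a i) -> (forall i, 0 <= b i) ->
  \sum_j match_class e a b i j <= a i.
Proof.
move=> a0 b0; rewrite match_row// -[leRHS]mulr1 ler_wpM2l//.
set x := class_sum _ _ _; set y := class_sum _ _ _.
have x0 : 0 <= x by exact: class_sum_ge0.
have y0 : 0 <= y by exact: class_sum_ge0.
have : x <= Num.max y x by rewrite le_max lexx orbT.
have : 0 <= Num.max y x by rewrite le_max x0 orbT.
rewrite le_eqVlt => /orP[/eqP <-|m0 ym]; first by rewrite invr0 mulr0.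
by rewrite ler_pdivrMr// mul1r.
Qed.

Let match_class_row e a b k : (forall i, 0 <= a i) -> (forall i, 0 <= b i) ->
  class_sum e (fun i => \sum_j match_class e a b i j) k =
  Num.min (class_sum e a k) (class_sum e b k).
Proof.
move=> a0 b0; rewrite -prod_div_max; try exact: class_sum_ge0.
rewrite /class_sum -mulrA mulr_suml; apply: eq_bigr => i /eqP ik.
by rewrite match_row// ik.
Qed.

(** In each class the side of smaller mass is exhausted, so the leftover is one-sided; this last
    clause drives the induction over levels. *)
Lemma match_classes e a b : (forall i, 0 <= a i) -> (forall i, 0 <= b i) ->
  exists pi, [/\ forall i j, 0 <= pi i j,
    (forall i, \sum_j pi i j <= a i) /\ (forall j, \sum_i pi i j <= b j),
    forall i j, pi i j != 0 -> e i = e j &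
    forall k, class_sum e (fun i => a i - \sum_j pi i j) k = 0 \/
              class_sum e (fun j => b j - \sum_i pi i j) k = 0].
Proof.
move=> a0 b0; exists (match_class e a b).
have colE j : \sum_i match_class e a b i j = \sum_i match_class e b a j i.
  by apply: eq_bigr => i _; exact: match_classC.
split.
- move=> i j; rewrite /match_class; case: ifP => // _.
  by rewrite !mulr_ge0// invr_ge0 le_max class_sum_ge0.
- by split=> i; rewrite ?colE; exact: match_row_le.
- by move=> i j; rewrite /match_class; case: ifP => [/eqP//|_ /eqP].
- move=> k; rewrite class_sumB match_class_row//.
  under [X in _ \/ X = _]eq_bigr do rewrite colE.
  rewrite [X in _ \/ X = _]class_sumB match_class_row//.
  by case: leP => _; [left|right]; rewrite subrr.
Qed.

(** Mass moved within classes cancels in the difference of the class masses, so [gap] also measures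
    what earlier matchings left over. *)
Lemma class_sum_balanced e pi k : (forall i j, pi i j != 0 -> e i = e j) ->
  class_sum e (fun i => \sum_j pi i j) k = class_sum e (fun j => \sum_i pi i j) k.
Proof.
move=> pie; rewrite /class_sum big_mkcond [RHS]big_mkcond/=.
under eq_bigr do rewrite -[X in if _ then X else _](big_mkcond xpredT).
have E i : (if e i == k then \sum_j pi i j else 0) = \sum_j (if e i == k then pi i j else 0).
  by case: ifP => // _; rewrite big1.
have E' j : (if e j == k then \sum_i pi i j else 0) = \sum_i (if e j == k then pi i j else 0).
  by case: ifP => // _; rewrite big1.
under eq_bigr do rewrite E; under [RHS]eq_bigr do rewrite E'.
rewrite exchange_big; apply: eq_bigr => j _; apply: eq_bigr => i _.
have [->|/pie ->//] := eqVneq (pi i j) 0; by rewrite !if_same.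
Qed.

Variables (e : nat -> I -> K) (c : I -> I -> R) (delta : nat -> R).
Hypothesis nested : forall l i j, e l i = e l j -> e l.+1 i = e l.+1 j.
Hypothesis delta0 : forall l, 0 <= delta l.
Hypothesis c_delta : forall l i j, e l i = e l j -> c i j <= delta l.
Variables (p q : I -> R).
Hypothesis p0 : forall i, 0 <= p i.
Hypothesis q0 : forall i, 0 <= q i.

Let gap l := \sum_k `|class_sum (e l) (fun i => p i - q i) k|.

Let cost_le l pi a : (forall i j, 0 <= pi i j) -> (forall i, \sum_j pi i j <= a i) ->
  (forall i j, pi i j != 0 -> e l i = e l j) ->
  \sum_i \sum_j pi i j * c i j <= delta l * \sum_i a i.
Proof.
move=> pi0 pia pie; rewrite mulr_sumr; apply: ler_sum => i _.
apply: (@le_trans _ _ (delta l * \sum_j pi i j)); last by rewrite ler_wpM2l.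
rewrite mulr_sumr; apply: ler_sum => j _.
have [->|pij] := eqVneq (pi i j) 0; first by rewrite mul0r mulr0.
by rewrite mulrC ler_wpM2r//; apply: c_delta; exact: pie.
Qed.

(** After level N the leftover in each class is one-sided, so its mass is at most |p - q| of the
    class. This is the most that level N + 1 has to move, over a distance cost delta (N + 1). *)
Let partial_coupling N : exists pi, [/\ forall i j, 0 <= pi i j,
    (forall i, \sum_j pi i j <= p i) /\ (forall j, \sum_i pi i j <= q j),
    forall i j, pi i j != 0 -> e N i = e N j,
    forall k, class_sum (e N) (fun i => p i - \sum_j pi i j) k = 0 \/
              class_sum (e N) (fun j => q j - \sum_i pi i j) k = 0 &
    \sum_i \sum_j pi i j * c i j <=
      delta 0%N * (\sum_i p i) + \sum_(l < N) delta l.+1 * gap l].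
Proof.
elim: N => [|N [pi [pi0 [pip piq] pie pi_left pi_cost]]].
  have [pi [pi0 [pip piq] pie pi_left]] := match_classes (e 0%N) p0 q0.
  by exists pi; split => //; rewrite big_ord0 addr0; exact: cost_le.
pose a i := p i - \sum_j pi i j; pose b j := q j - \sum_i pi i j.
have a0 i : 0 <= a i by rewrite subr_ge0.
have b0 i : 0 <= b i by rewrite subr_ge0.
have [pi' [pi'0 [pi'a pi'b] pi'e pi'_left]] := match_classes (e N.+1) a0 b0.
exists (fun i j => pi i j + pi' i j).
have rowE i : p i - \sum_j (pi i j + pi' i j) = a i - \sum_j pi' i j.
  by rewrite big_split/= opprD addrA.
have colE j : q j - \sum_i (pi i j + pi' i j) = b j - \sum_i pi' i j.
  by rewrite big_split/= opprD addrA.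
split.
- by move=> i j; rewrite addr_ge0.
- by split=> i; rewrite -subr_ge0 ?rowE ?colE subr_ge0.
- move=> i j; have [->|/pie pij _] := eqVneq (pi i j) 0; last exact: nested.
  by rewrite add0r; exact: pi'e.
- move=> k; have := pi'_left k; rewrite /class_sum.
  by under [X in _ -> X = _ \/ _]eq_bigr do rewrite rowE;
     under [X in _ -> _ \/ X = _]eq_bigr do rewrite colE.
under eq_bigr do under eq_bigr do rewrite mulrDl.
under eq_bigr do rewrite big_split/=.
rewrite big_split/= big_ord_recr/= addrA lerD//.
apply: (le_trans (cost_le pi'0 pi'a pi'e)); rewrite ler_wpM2l//.
rewrite -(sum_class_sum (e N)); apply: ler_sum => k _.
have -> : class_sum (e N) (fun i => p i - q i) k =
    class_sum (e N) a k - class_sum (e N) b k.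
  by rewrite !class_sumB (class_sum_balanced k pie); ring.
case: (pi_left k) => ->; last by rewrite subr0 ler_norm.
exact: normr_ge0.
Qed.

(** The root is a single class of equal total masses: a one-sided leftover there is zero on both
    sides. *)
Lemma tree_coupling N : (forall i j, e N i = e N j) -> \sum_i p i = \sum_i q i ->
  exists pi, [/\ forall i j, 0 <= pi i j,
    forall i, \sum_j pi i j = p i,
    forall j, \sum_i pi i j = q j &
    \sum_i \sum_j pi i j * c i j <= delta 0%N * (\sum_i p i) +
      \sum_(l < N) delta l.+1 * \sum_k `|class_sum (e l) (fun i => p i - q i) k| ].
Proof.
move=> eN pq; have [pi [pi0 [pip piq] _ pi_left pi_cost]] := partial_coupling N.
have tot k i : e N i = k -> forall f, class_sum (e N) f k = \sum_j f j.
  by move=> ik f; rewrite /class_sum; apply: eq_bigl => j; rewrite -ik (eN j i) eqxx.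
have mass : \sum_i (p i - \sum_j pi i j) = \sum_j (q j - \sum_i pi i j).
  by rewrite !sumrB pq exchange_big.
have left0 (i : I) : \sum_i (p i - \sum_j pi i j) = 0.
  by case: (pi_left (e N i)); rewrite (tot _ i erefl)// mass.
exists pi; split => // i.
- have /eqP := left0 i; rewrite psumr_eq0 => [/allP/(_ i)|j _]; last by rewrite subr_ge0.
  by rewrite mem_index_enum => /(_ isT); rewrite subr_eq0 => /eqP.
- have := left0 i; rewrite mass => /eqP; rewrite psumr_eq0 => [/allP/(_ i)|j _]; last by rewrite subr_ge0.
  by rewrite mem_index_enum => /(_ isT); rewrite subr_eq0 => /eqP.
Qed.

End tree_coupling.

(** * Lifting a coupling of labels to a coupling of measures *)

Section mprob.
Context d (T : measurableType d) (R : realType).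
Variables (m : {measure set T -> \bar R}) (m1 : m setT = 1%E).

Definition mprob of m setT = 1%E : set T -> \bar R := m.

HB.instance Definition _ := isMeasure.Build _ _ _ (mprob m1)
  (measure0 m) (measure_ge0 m) (@measure_semi_sigma_additive _ _ _ m).
HB.instance Definition _ := Measure_isProbability.Build _ _ _ (mprob m1) m1.

End mprob.

Section sum_measure.
Context d (T : measurableType d) (R : realType) (J : Type).
Variable m : J -> {measure set T -> \bar R}.

Definition seq_measure (s : seq J) : {measure set T -> \bar R} :=
  foldr (fun j (acc : {measure set T -> \bar R}) => measure_add (m j) acc : {measure set T -> \bar R}) mzero s.

Lemma seq_measureE s A : (seq_measure s A = \sum_(j <- s) m j A)%E.
Proof.
elim: s => [|j s ih]; first by rewrite big_nil.
by rewrite big_cons -ih; exact: measure_addE.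
Qed.

End sum_measure.

Lemma sum_measure_disjoint d (T : measurableType d) (R : realType) (J : finType)
    (nu : probability T R) (S : {set J}) (B : J -> set T) :
  (forall j, measurable (B j)) -> (forall i j x, B i x -> B j x -> i = j) ->
  \sum_(j in S) fine (nu (B j)) = fine (nu (\bigcup_(j in [set` S]) B j)).
Proof.
move=> mB dB; have finS : finite_set [set` S] by exact: finite_finset.
rewrite measure_fin_bigcup//; last by move=> i j _ _ [x [Bi Bj]]; exact: dB Bi Bj.
rewrite fsbig_finite//= (_ : \sum_(i <- _) _ = \sum_(j in S) nu (B j))%E.
  by rewrite -sum_fine// => j _; rewrite fin_num_measure.
rewrite -[RHS]big_filter; apply: perm_big; apply: uniq_perm.
- exact: finmap.fset_uniq.
- by rewrite filter_uniq// index_enum_uniq.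
- by move=> i; rewrite in_fset_set// mem_filter mem_index_enum andbT mem_setE.
Qed.

Lemma measure_fiber_sum d (T : measurableType d) (R : realType) (I : finType)
    (nu : probability T R) (kappa : T -> I) A :
  (forall i, measurable (kappa @^-1` [set i])) -> measurable A ->
  nu A = (\sum_i fine (nu (A `&` kappa @^-1` [set i])))%:E.
Proof.
move=> mk mA.
have -> : \sum_i fine (nu (A `&` kappa @^-1` [set i])) =
    \sum_(i in (finset.setT : {set I})) fine (nu (A `&` kappa @^-1` [set i])).
  by apply: eq_bigl => i; rewrite finset.in_setT.
rewrite sum_measure_disjoint => [||i j x [_ <-] [_ <-]]//; last first.
  by move=> i; exact: measurableI.
rewrite fineK; last first.
  by apply: fin_num_measure; apply: fin_bigcup_measurable => // i _; exact: measurableI.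
congr (nu _); apply/seteqP; split => [x Ax|x [i _ []]//].
by exists (kappa x) => //=; rewrite finset.in_setT.
Qed.

Section lift.
Context d (T : measurableType d) (R : realType) (I : finType).
Variables (nu0 nu1 : probability T R) (kappa : T -> I).
Hypothesis mkappa : forall i, measurable (kappa @^-1` [set i]).
Variable pi : I -> I -> R.
Hypothesis pi0 : forall i j, 0 <= pi i j.

Let F i := kappa @^-1` [set i].
Let mF i : measurable (F i). Proof. exact: mkappa. Qed.
Let mIF i A : measurable A -> measurable (A `&` F i).
Proof. by move=> mA; apply: measurableI. Qed.
Let p i : R := fine (nu0 (F i)).
Let q i : R := fine (nu1 (F i)).
Hypothesis pip : forall i, \sum_j pi i j = p i.
Hypothesis piq : forall j, \sum_i pi i j = q j.

Let restr_fin (nu : probability T R) i : fin_num_fun (mrestr nu (mkappa i)).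
Proof.
by move=> A mA; exact: (fin_num_measure nu (A `&` F i) (mIF i mA)).
Qed.

(** The factor that gives the product of the restrictions to two fibers the mass [pi i j]. If a
    fiber is null then so is [pi i j], in agreement with division by zero. *)
Let w (ij : I * I) : R := pi ij.1 ij.2 / (p ij.1 * q ij.2).

Let p_ge0 i : 0 <= p i. Proof. exact: fine_ge0. Qed.
Let q_ge0 i : 0 <= q i. Proof. exact: fine_ge0. Qed.

Let w_ge0 ij : 0 <= w ij.
Proof. by rewrite /w divr_ge0// mulr_ge0. Qed.

Let block (ij : I * I) : {measure set (T * T)%type -> \bar R} :=
  mscale (NngNum (w_ge0 ij)) (mfin (restr_fin nu0 ij.1) \x mfin (restr_fin nu1 ij.2))%E.

Let Pi0 : {measure set (T * T)%type -> \bar R} := seq_measure block (index_enum (I * I)%type).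

Let Pi0E A B : measurable A -> measurable B ->
  Pi0 (A `*` B) = (\sum_i \sum_j w (i, j) * fine (nu0 (A `&` F i)) * fine (nu1 (B `&` F j)))%:E.
Proof.
move=> mA mB; rewrite /Pi0 seq_measureE pair_big/= -sumEFin.
apply: eq_bigr => -[i j] _ /=.
transitivity ((w (i, j))%:E * (nu0 (A `&` F i) * nu1 (B `&` F j)))%E.
  by congr (_ * _)%E; exact: product_measure1E.
rewrite -mulrA [RHS]EFinM; congr (_ * _)%E.
by rewrite EFinM (fineK (fin_num_measure nu0 _ (mIF i mA))) (fineK (fin_num_measure nu1 _ (mIF j mB))).
Qed.

Let nu_split (nu : probability T R) A : measurable A ->
  nu A = (\sum_i fine (nu (A `&` F i)))%:E.
Proof. exact: measure_fiber_sum. Qed.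

Let pi_le_p i j : pi i j <= p i.
Proof. by rewrite -pip (bigD1 j)//= lerDl sumr_ge0. Qed.

Let pi_le_q i j : pi i j <= q j.
Proof. by rewrite -piq (bigD1 i)//= lerDl sumr_ge0. Qed.

Let fine_le_p A i : measurable A -> fine (nu0 (A `&` F i)) <= p i.
Proof.
move=> mA; apply: fine_le; rewrite ?fin_num_measure//; try exact: mIF.
by apply: le_measure; rewrite ?inE//; exact: mIF.
Qed.

Let fine_le_q A i : measurable A -> fine (nu1 (A `&` F i)) <= q i.
Proof.
move=> mA; apply: fine_le; rewrite ?fin_num_measure//; try exact: mIF.
by apply: le_measure; rewrite ?inE//; exact: mIF.
Qed.

Let wE_row i x : 0 <= x <= p i -> \sum_j w (i, j) * x * q j = x.
Proof.
move=> /andP[x0 xp]; have [pi00|pin0] := eqVneq (p i) 0.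
  have -> : x = 0 by apply/eqP; rewrite eq_le x0 -pi00 xp.
  by rewrite big1// => j _; rewrite mulr0 mul0r.
transitivity (\sum_j pi i j * (x / p i)).
  apply: eq_bigr => j _; rewrite /w/=; have [qj0|qjn0] := eqVneq (q j) 0.
    have -> : pi i j = 0 by apply/eqP; rewrite eq_le pi0 -qj0 pi_le_q.
    by rewrite !mul0r.
  by field; rewrite pin0.
by rewrite -mulr_suml pip mulrC divfK.
Qed.

Let wE_col j x : 0 <= x <= q j -> \sum_i w (i, j) * p i * x = x.
Proof.
move=> /andP[x0 xp]; have [pi00|pin0] := eqVneq (q j) 0.
  have -> : x = 0 by apply/eqP; rewrite eq_le x0 -pi00 xp.
  by rewrite big1// => i _; rewrite mulr0.
transitivity (\sum_i pi i j * (x / q j)).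
  apply: eq_bigr => i _; rewrite /w/=; have [qj0|qjn0] := eqVneq (p i) 0.
    have -> : pi i j = 0 by apply/eqP; rewrite eq_le pi0 -qj0 pi_le_p.
    by rewrite !mul0r.
  by field; rewrite pin0.
by rewrite -mulr_suml piq mulrC divfK.
Qed.

Let Pi0_fst A : measurable A -> Pi0 (A `*` setT) = nu0 A.
Proof.
move=> mA; rewrite Pi0E// nu_split//; congr (_%:E); apply: eq_bigr => i _.
under eq_bigr do rewrite setTI.
by apply: wE_row; rewrite fine_le_p// fine_ge0.
Qed.

Let Pi0_snd A : measurable A -> Pi0 (setT `*` A) = nu1 A.
Proof.
move=> mA; rewrite Pi0E// exchange_big/= nu_split//; congr (_%:E); apply: eq_bigr => j _.
under eq_bigr do rewrite setTI.
by apply: wE_col; rewrite fine_le_q// fine_ge0.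
Qed.

Let Pi0T : Pi0 setT = 1%E.
Proof. by rewrite -setXTT Pi0_fst// probability_setT. Qed.

Let Pi0_block i j : Pi0 (F i `*` F j) = (pi i j)%:E.
Proof.
rewrite (Pi0E (mF i) (mF j)); congr (_%:E).
rewrite (bigD1 i)//= [X in _ + X]big1 ?addr0; last first.
  move=> i' /negPf i'i; rewrite big1// => j' _.
  rewrite (_ : F i `&` F i' = set0) ?measure0 ?mulr0 ?mul0r//.
  by apply/seteqP; split => // x []; rewrite /F /= => xi ii'; rewrite -ii' -xi eqxx in i'i.
rewrite (bigD1 j)//= [X in _ + X]big1 ?addr0; last first.
  move=> j' /negPf j'j.
  rewrite (_ : F j `&` F j' = set0) ?measure0 ?mulr0//.
  by apply/seteqP; split => // x []; rewrite /F /= => xi ii'; rewrite -ii' -xi eqxx in j'j.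
rewrite !setIid /w/= -/(p i) -/(q j).
have [pi00|pin0] := eqVneq (p i) 0.
  have -> : pi i j = 0 by apply/eqP; rewrite eq_le pi0 -pi00 pi_le_p.
  by rewrite !mul0r.
have [qj0|qjn0] := eqVneq (q j) 0.
  have -> : pi i j = 0 by apply/eqP; rewrite eq_le pi0 -qj0 pi_le_q.
  by rewrite !mul0r.
by rewrite -mulrA divfK// mulf_neq0.
Qed.

(** The label cost is constant on products of fibers, whose masses are known; [phi] pays where
    labels give no control, and its integral depends on the marginals only. *)
Lemma lift_coupling (c : I -> I -> R) (cost : T * T -> \bar R) (phi : T -> \bar R) :
  (forall i j, 0 <= c i j) -> measurable_fun setT phi -> (forall x, 0 <= phi x)%E ->
  (forall z, 0 <= cost z)%E ->
  (forall x y, cost (x, y) <= (c (kappa x) (kappa y))%:E + phi x + phi y)%E ->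
  exists Pi : probability (T * T)%type R,
    (forall A, measurable A -> Pi (A `*` setT) = nu0 A /\ Pi (setT `*` A) = nu1 A) /\
    (\int[Pi]_z cost z <= (\sum_i \sum_j pi i j * c i j)%:E +
      \int[nu0]_x phi x + \int[nu1]_x phi x)%E.
Proof.
move=> c0 mphi phi0 cost0 cost_le.
exists (mprob Pi0T); split => [A mA|]; first by split; [exact: Pi0_fst|exact: Pi0_snd].
set Pi : {measure set _ -> \bar R} := mprob Pi0T.
pose cE (z : T * T) : \bar R := (\sum_i \sum_j c i j * \1_(F i `*` F j) z)%:E.
have cEE x y : cE (x, y) = (c (kappa x) (kappa y))%:E.
  congr (_%:E); rewrite (bigD1 (kappa x))//= [X in _ + X]big1 ?addr0; last first.
    move=> i /negPf ix; rewrite big1// => j _; rewrite indicE memNset ?mulr0//.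
    by move=> [/= /esym/eqP]; rewrite ix.
  rewrite (bigD1 (kappa y))//= [X in _ + X]big1 ?addr0; last first.
    move=> j /negPf jy; rewrite indicE memNset ?mulr0//.
    by move=> [/= _ /esym/eqP]; rewrite jy.
  by rewrite indicE mem_set ?mulr1.
have mFF i j : measurable (F i `*` F j) by apply: measurableX; exact: mF.
have cE0 z : (0 <= cE z)%E.
  by rewrite lee_fin; apply: sumr_ge0 => i _; apply: sumr_ge0 => j _; rewrite mulr_ge0.
have mcE : measurable_fun setT cE.
  apply/measurable_EFinP; apply: measurable_sum => i; apply: measurable_sum => j.
  by apply: measurable_funM => //; exact: measurable_indic.
have mf1 : measurable_fun setT (fun z : T * T => z.1) by exact: measurable_fst.
have mf2 : measurable_fun setT (fun z : T * T => z.2) by exact: measurable_snd.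
have m1 : measurable_fun setT (fun z : T * T => phi z.1) by exact: measurableT_comp mphi measurable_fst.
have m2 : measurable_fun setT (fun z : T * T => phi z.2) by exact: measurableT_comp mphi measurable_snd.
apply: (@le_trans _ _ (\int[Pi]_z (cE z + phi z.1 + phi z.2))%E).
  by apply: le_integral_nonmeasurable => // -[x y]; rewrite cEE; exact: cost_le.
rewrite ge0_integralD//=; last 2 first.
- by move=> z _; rewrite adde_ge0.
- exact: emeasurable_funD.
rewrite ge0_integralD//.
have -> : (\int[Pi]_z phi z.1 = \int[nu0]_x phi x)%E.
  rewrite [RHS](@eq_measure_integral _ _ _ _ (mpush Pi mf1)).
    have := @ge0_integral_pushforward _ _ _ _ R _ mf1 Pi setT phi measurableT mphi.
    by rewrite preimage_setT => -> // y _; exact: phi0.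
  move=> A mA _; transitivity (Pi0 (A `*` setT)); first exact/esym/Pi0_fst.
  by congr (Pi0 _); apply/seteqP; split => // z [].
have -> : (\int[Pi]_z phi z.2 = \int[nu1]_x phi x)%E.
  rewrite [RHS](@eq_measure_integral _ _ _ _ (mpush Pi mf2)).
    have := @ge0_integral_pushforward _ _ _ _ R _ mf2 Pi setT phi measurableT mphi.
    by rewrite preimage_setT => -> // y _; exact: phi0.
  move=> A mA _; transitivity (Pi0 (setT `*` A)); first exact/esym/Pi0_snd.
  by congr (Pi0 _); apply/seteqP; split => // z [].
rewrite leeD2r// leeD2r// le_eqVlt; apply/orP; left; apply/eqP.
rewrite /cE; under eq_integral do rewrite -sumEFin.
rewrite ge0_integral_sum//; last 2 first.
- move=> i; apply/measurable_EFinP; apply: measurable_sum => j.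
  by apply: measurable_funM => //; exact: measurable_indic.
- by move=> i z _; rewrite lee_fin; apply: sumr_ge0 => j _; rewrite mulr_ge0.
rewrite -sumEFin; apply: eq_bigr => i _.
under eq_integral do rewrite -sumEFin.
rewrite ge0_integral_sum//; last 2 first.
- move=> j; apply/measurable_EFinP.
  by apply: measurable_funM => //; exact: measurable_indic.
- by move=> j z _; rewrite lee_fin mulr_ge0.
rewrite -sumEFin; apply: eq_bigr => j _.
under eq_integral do rewrite EFinM.
rewrite ge0_integralZl//; last 2 first.
- by apply/measurable_EFinP; exact: measurable_indic.
- by rewrite lee_fin.
by rewrite integral_indic// setIT [X in (_ * X)%E]Pi0_block -EFinM mulrC.
Qed.

End lift.

(** * Norms on tuples, triadic cells and central cubes *)

Section norms.
Context (R : realType) (d : nat).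
Implicit Types x y : d.-tuple R.

Lemma edist_le x y (M : R) : 0 <= M -> (forall i, `|tnth x i - tnth y i| <= M) ->
  Defs.edist x y <= d%:R * M.
Proof.
move=> M0 xyM; have dM0 : 0 <= d%:R * M by rewrite mulr_ge0.
rewrite -[leRHS]ger0_norm// -sqrtr_sqr /Defs.edist; apply: ler_wsqrtr.
apply: (@le_trans _ _ (\sum_(i < d) M ^+ 2)).
  apply: ler_sum => i _; have := xyM i; rewrite ler_norml => /andP[? ?].
  by rewrite -subr_ge0 subr_sqr mulr_ge0//; lra.
rewrite sumr_const card_ord exprMn -[leLHS]mulr_natl ler_wpM2r ?sqr_ge0//.
by rewrite -natrX ler_nat; case: (d) => // k; rewrite expnS expn1 leq_pmulr.
Qed.

Lemma norm_tnth_le_enorm x i : `|tnth x i| <= enorm x.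
Proof.
rewrite -sqrtr_sqr /enorm; apply: ler_wsqrtr; rewrite (bigD1 i)//= lerDl.
by apply: sumr_ge0 => j _; exact: sqr_ge0.
Qed.

Lemma enorm_ge0 x : 0 <= enorm x. Proof. exact: sqrtr_ge0. Qed.

Lemma measurable_box (A : 'I_d -> set R) : (forall i, measurable (A i)) ->
  measurable [set x : d.-tuple R | forall i, A i (tnth x i)].
Proof.
move=> mA; rewrite (_ : [set x | _] = \bigcap_(i in [set: 'I_d]) ((fun x : d.-tuple R => tnth x i) @^-1` A i)).
  apply: fin_bigcap_measurable => [|i _]; first exact: finite_finset.
  by rewrite -[X in measurable X]setTI; exact: measurable_tnth.
by apply/seteqP; split => x /= H i; [move=> _; exact: H|exact: H].
Qed.

Lemma measurable_enorm : measurable_fun setT (@enorm R d).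
Proof.
apply: (measurableT_comp (continuous_measurable_fun (@sqrt_continuous R))).
by apply: measurable_sum => i; apply: measurable_funX; exact: measurable_tnth.
Qed.

End norms.

(* The cube [-r, r)^d is cut into 3^(d(L-l)) cells of level l <= L, so that the
   origin is the centre of a cell on every level; digits are written in base 3. *)
Section cells.
Context (R : realType) (d : nat) (r : R) (L : nat).
Hypothesis r0 : 0 < r.
Implicit Types x y : d.-tuple R.

Definition digit (t : R) : nat := Num.truncn ((t + r) / (2 * r) * 3 ^+ L).

(** [None] is the outside of the cube. The successor in the ordinal type is there for [inord];
    labels with the extra index have empty cells. *)
Definition label := option {ffun 'I_d -> 'I_(3 ^ L).+1}.

Definition inside x := [forall i, - r <= tnth x i < r].

Definition cell_label x : label :=
  if inside x then Some [ffun i => inord (digit (tnth x i))] else None.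

(* Beyond level [L] all labels share the ancestor [None]. *)
Definition ancestor (l : nat) (k : label) : label :=
  if (l <= L)%N then
    omap (fun f : {ffun 'I_d -> 'I_(3 ^ L).+1} => [ffun i => inord (f i %/ 3 ^ l)%N]) k
  else None.

Definition cell l k := [set x | ancestor l (cell_label x) = k].

(** Half the side of a cell of level [m]; for m <= L, [cube m] is thus the cell of that level around
    the origin. *)
Definition rho m : R := r * 3 ^+ m / 3 ^+ L.

Definition cube m := [set x | forall i : 'I_d, - rho m <= tnth x i < rho m].

(** Index of the middle one of 3^m intervals; the division is exact because 3^m is odd. *)
Definition center m := ((3 ^ m).-1 %/ 2)%N.

Let e30 m : (0 : R) < 3 ^+ m. Proof. by rewrite exprn_gt0. Qed.

Lemma rho_gt0 m : 0 < rho m.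
Proof. by rewrite /rho divr_gt0// mulr_gt0. Qed.

Lemma rhoL : rho L = r.
Proof. by rewrite /rho mulfK// gt_eqF. Qed.

Lemma centerE m : (center m)%:R = (3 ^+ m - 1) / 2 :> R.
Proof.
have c2 : (center m * 2 = (3 ^ m).-1)%N.
  by rewrite /center divnK// dvdn2 -subn1 oddB ?expn_gt0// oddX orbT.
have : (center m * 2).+1%:R = 3 ^+ m :> R.
  by rewrite c2 prednK ?expn_gt0// natrX.
rewrite -natr1 natrM => <-; by rewrite addrK mulfK.
Qed.

Lemma digit_bounds (t : R) (l n : nat) : - r <= t ->
  (digit t %/ 3 ^ l == n)%N =
  (n%:R <= (t + r) / (2 * r) * 3 ^+ L / 3 ^+ l < n.+1%:R).
Proof.
move=> rt; set y := _ * 3 ^+ L.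
have y0 : 0 <= y.
  by rewrite !mulr_ge0// ?invr_ge0 ?mulr_ge0 ?(ltW r0)// -lerBlDr sub0r.
have p3 : (0 < 3 ^ l)%N by rewrite expn_gt0.
rewrite ler_pdivlMr// ltr_pdivrMr// -!natrX -!natrM.
have -> : ((n * 3 ^ l)%:R <= y) = (n * 3 ^ l <= digit t)%N by rewrite /digit -truncn_ge_nat.
have -> : (y < (n.+1 * 3 ^ l)%:R) = (digit t < n.+1 * 3 ^ l)%N by rewrite /digit -truncn_lt_nat.
by rewrite -leq_divRL// -ltn_divLR// ltnS eqn_leq andbC.
Qed.

Lemma digit_lt t : - r <= t < r -> (digit t < 3 ^ L)%N.
Proof.
move=> /andP[rt tr]; have := digit_bounds L 0 rt.
rewrite (mulfK (lt0r_neq0 (e30 L))) => E; have : (digit t %/ 3 ^ L)%N == 0%N.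
  rewrite E divr_ge0 ?mulr_ge0 ?(ltW r0)//=; last by rewrite -lerBlDr sub0r.
  by rewrite ltr_pdivrMr ?mulr_gt0// mul1r mulr_natl mulr2n ltrD2r.
by rewrite -leqn0 leqNgt divn_gt0 ?expn_gt0// -ltnNge.
Qed.

Lemma insideP x : reflect (forall i, - r <= tnth x i < r) (inside x).
Proof. exact: forallP. Qed.

Lemma ancestor_cell_label l x : (l <= L)%N -> inside x ->
  exists2 f : {ffun 'I_d -> 'I_(3 ^ L).+1}, ancestor l (cell_label x) = Some f &
    forall i, f i = (digit (tnth x i) %/ 3 ^ l)%N :> nat.
Proof.
move=> lL xin; rewrite /cell_label xin /ancestor lL /=; eexists; first reflexivity.
move=> i; rewrite !ffunE; have /insideP/(_ i)/digit_lt dlt := xin.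
by rewrite !inordK// ltnS ?(ltnW dlt)//; apply: leq_trans (leq_div _ _) (ltnW dlt).
Qed.

Lemma ancestor_outside l x : ~~ inside x -> ancestor l (cell_label x) = None.
Proof. by move=> /negPf xo; rewrite /cell_label xo /ancestor; case: ifP. Qed.

Lemma ancestor_nested l k k' : ancestor l k = ancestor l k' -> ancestor l.+1 k = ancestor l.+1 k'.
Proof.
rewrite /ancestor; have [lL|//] := ltnP l L; rewrite (ltnW lL).
case: k => [f|]; case: k' => [g|]//= [] /ffunP fg; congr Some; apply/ffunP => i.
have := fg i; rewrite !ffunE => /(congr1 val)/=.
have bd (h : {ffun 'I_d -> 'I_(3 ^ L).+1}) m : (h i %/ 3 ^ m < (3 ^ L).+1)%N.
  exact: leq_ltn_trans (leq_div _ _) (ltn_ord _).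
rewrite !inordK// => fgi; apply/val_inj => /=; rewrite !inordK//.
by rewrite expnSr !divnMA fgi.
Qed.

Lemma ancestor_last k k' : ancestor L.+1 k = ancestor L.+1 k'.
Proof. by rewrite /ancestor ltnn. Qed.

Lemma same_ancestor_dist l x y i : inside x -> inside y ->
  ancestor l (cell_label x) = ancestor l (cell_label y) ->
  `|tnth x i - tnth y i| <= 2 * rho l.
Proof.
move=> xin yin; have [lL|Ll] := leqP l L; last first.
  move=> _; apply: (@le_trans _ _ (2 * r)).
    have /insideP/(_ i)/andP[? ?] := xin; have /insideP/(_ i)/andP[? ?] := yin.
    by rewrite ler_norml; apply/andP; split; lra.
  rewrite ler_wpM2l// /rho -mulrA ler_peMr ?(ltW r0)//.
  by rewrite ler_pdivlMr// mul1r ler_weXn2l// ?ler1n// ltnW.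
have [f -> fE] := ancestor_cell_label lL xin.
have [g -> gE] := ancestor_cell_label lL yin.
move=> [] fg; have := fE i; rewrite fg gE => /esym.
have /insideP/(_ i)/andP[rx _] := xin; have /insideP/(_ i)/andP[ry _] := yin.
set n := (digit (tnth y i) %/ _)%N => /eqP; rewrite digit_bounds//.
have : n == n by []. rewrite {1}/n digit_bounds//.
have E t : (t + r) / (2 * r) * 3 ^+ L / 3 ^+ l = (t + r) / (2 * rho l).
  by rewrite /rho; field; rewrite !gt_eqF.
have rl0 : 0 < 2 * rho l by rewrite mulr_gt0// rho_gt0.
have En : n.+1%:R * (2 * rho l) = n%:R * (2 * rho l) + 2 * rho l.
  by rewrite -[in LHS](@natr1 R n); ring.
rewrite !E !ler_pdivlMr// !ltr_pdivrMr// En.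
move: (n%:R * (2 * rho l)) (2 * rho l) => c c' /andP[? ?] /andP[? ?].
by rewrite ler_norml; apply/andP; split; lra.
Qed.

(** Measured from -r in units of the side 2 rho_m, the origin sits at 3^(L-m) / 2, which is the
    central index plus one half. *)
Lemma cube_center m x : (m <= L)%N -> inside x ->
  cube m x <-> forall i, (digit (tnth x i) %/ 3 ^ m = center (L - m))%N.
Proof.
move=> mL /insideP xin.
suff H i : (- rho m <= tnth x i < rho m) = ((digit (tnth x i) %/ 3 ^ m)%N == center (L - m)).
  by split=> [xm i|xm i]; [apply/eqP; rewrite -H; exact: xm|rewrite H; apply/eqP; exact: xm].
have /andP[rx _] := xin i; rewrite digit_bounds// -(@natr1 R (center (L - m))) centerE.
have -> : (tnth x i + r) / (2 * r) * 3 ^+ L / 3 ^+ m = tnth x i / (2 * rho m) + 3 ^+ (L - m) / 2.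
  rewrite expfB_cond ?mL//; last by rewrite pnatr_eq0.
  by rewrite /rho; field; rewrite !gt_eqF.
have rm0 : 0 < 2 * rho m by rewrite mulr_gt0// rho_gt0.
have -> : (3 ^+ (L - m) - 1) / 2 = - 2^-1 + 3 ^+ (L - m) / 2 :> R by field.
rewrite lerD2r -addrA [_ / 2 + 1]addrC addrA ltrD2r.
rewrite ler_pdivlMr// ltr_pdivrMr//.
rewrite (_ : - 2^-1 * (2 * rho m) = - rho m); last by field.
by rewrite (_ : (- 2^-1 + 1) * (2 * rho m) = rho m)//; field.
Qed.

Lemma insideE x : inside x <-> cube L x.
Proof. by rewrite /cube rhoL; split => [/insideP//|H]; apply/insideP. Qed.

Lemma cube_inside m x : (m <= L)%N -> cube m x -> inside x.
Proof.
move=> mL xm; apply/insideP => i; have /andP[a b] := xm i.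
have rmr : rho m <= r.
  by rewrite /rho ler_pdivrMr// ler_pM2l// ler_weXn2l// ler1n.
by rewrite (le_trans _ a) ?lerN2//= (lt_le_trans b).
Qed.

Lemma notin_cube_enorm m x : ~ cube m x -> rho m <= enorm x.
Proof.
move=> xm; rewrite leNgt; apply/negP => xr; apply: xm => i.
have := norm_tnth_le_enorm x i => /le_lt_trans /(_ xr).
by rewrite ltr_norml => /andP[/ltW -> ->].
Qed.

Lemma measurable_cube m : measurable (cube m).
Proof.
apply: (@measurable_box _ _ (fun=> [set t | - rho m <= t < rho m])) => i.
rewrite (_ : [set t | _] = `[- rho m, rho m[%classic); first exact: measurable_itv.
by apply/seteqP; split => t /=; rewrite in_itv.
Qed.

Lemma measurable_cell_label k : measurable (cell_label @^-1` [set k]).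
Proof.
have mo : measurable [set x | ~~ inside x].
  rewrite (_ : [set x | _] = ~` cube L); first by apply: measurableC; exact: measurable_cube.
  by apply/seteqP; split => x /= => [/negP H /insideE//|H]; apply/negP => /insideE.
case: k => [f|]; last first.
  rewrite (_ : _ @^-1` _ = [set x | ~~ inside x])//.
  by apply/seteqP; split => x /=; rewrite /cell_label; case: ifP.
pose A (i : 'I_d) := [set t : R | - r <= t < r /\
  (f i)%:R <= (t + r) / (2 * r) * 3 ^+ L < (f i).+1%:R].
rewrite (_ : _ @^-1` _ = [set x | forall i, A i (tnth x i)]).
  apply: measurable_box => i.
  have m1 : measurable_fun setT (fun t : R => (t + r) / (2 * r) * 3 ^+ L).
    by do 2 apply: measurable_funM => //; exact: measurable_funD.
  rewrite (_ : A i = `[- r, r[ `&` (fun t : R => (t + r) / (2 * r) * 3 ^+ L) @^-1` `[(f i)%:R, (f i).+1%:R[%classic).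
    apply: measurableI; first exact: measurable_itv.
    by rewrite -[X in measurable X]setTI; apply: m1 => //; exact: measurable_itv.
  by apply/seteqP; split => t /=; rewrite !in_itv.
have dE x i : - r <= tnth x i < r ->
    ((f i)%:R <= (tnth x i + r) / (2 * r) * 3 ^+ L < (f i).+1%:R) = (digit (tnth x i) == f i).
  by move=> /andP[rx _]; have := digit_bounds 0 (f i) rx; rewrite expn0 divn1 expr0 divr1 => ->.
apply/seteqP; split => x /=; rewrite /cell_label.
  case: ifP => // /insideP xin [] /ffunP fx i; split; first exact: xin.
  rewrite dE// -fx ffunE inordK//; exact: leq_trans (digit_lt (xin i)) _.
move=> xA; have xin : inside x by apply/insideP => i; have [] := xA i.
rewrite xin; congr Some; apply/ffunP => i; have [xi] := xA i; rewrite dE// => /eqP xf.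
by rewrite ffunE xf inord_val.
Qed.

Lemma measurable_cell l k : measurable (cell l k).
Proof.
rewrite (_ : cell l k = \bigcup_(j in [set j | ancestor l j = k]) (cell_label @^-1` [set j])).
  by apply: fin_bigcup_measurable => [|j _]; [exact: finite_finset|exact: measurable_cell_label].
by apply/seteqP; split => [x <-|x [j <- <-]//]; exists (cell_label x).
Qed.

(* Labels of the level-[l] cells contained in the cube [cube n]. *)
Definition central l n : {set {ffun 'I_d -> 'I_(3 ^ L).+1}} :=
  [set f : {ffun 'I_d -> 'I_(3 ^ L).+1} | [forall i, (f i %/ 3 ^ (n - l) == center (L - n))%N]].

(** All coordinates share the same quotient by 3^(n-l), so the remainders determine the label. *)
Lemma card_central l n : (#|central l n| <= (3 ^ (n - l)) ^ d)%N.
Proof.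
set M := (3 ^ (n - l))%N; have M0 : (0 < M)%N by rewrite expn_gt0.
pose g (f : {ffun 'I_d -> 'I_(3 ^ L).+1}) : {ffun 'I_d -> 'I_M} :=
  [ffun i => Ordinal (ltn_pmod (f i) M0)].
have ginj : {in central l n &, injective g}.
  move=> f f'; rewrite !inE => /forallP fc /forallP f'c /ffunP gg; apply/ffunP => i.
  apply/val_inj => /=; rewrite (divn_eq (f i) M) (divn_eq (f' i) M).
  have := gg i; rewrite !ffunE => /(congr1 val)/= ->.
  by rewrite (eqP (fc i)) (eqP (f'c i)).
rewrite -(card_in_imset ginj); apply: leq_trans (max_card _) _.
by rewrite card_ffun !card_ord.
Qed.

(** The criterion depends on the label only: each cell lies inside [cube n] or is disjoint from
    it. *)
Lemma cell_central l n f x : (l <= n)%N -> (n <= L)%N -> cell l (Some f) x ->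
  cube n x <-> f \in central l n.
Proof.
move=> ln nL xf; have lL := leq_trans ln nL.
have xin : inside x.
  by apply/negPn/negP => /(ancestor_outside l); rewrite xf.
have [f' ] := ancestor_cell_label lL xin; rewrite xf => -[<-] fE.
have E i : (f i %/ 3 ^ (n - l) = digit (tnth x i) %/ 3 ^ n)%N.
  by rewrite fE -divnMA -expnD subnKC.
rewrite inE; split=> [/(cube_center nL xin) H|/forallP H].
  by apply/forallP => i; rewrite E H.
by apply/(cube_center nL xin) => i; rewrite -E; apply/eqP.
Qed.

Lemma cell_None l x : (l <= L)%N -> cell l None x <-> ~ cube L x.
Proof.
move=> lL; split=> [xN /insideE xin|xo].
  by have [f] := ancestor_cell_label lL xin; rewrite xN.
by apply: ancestor_outside; apply/negP => /insideE.
Qed.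

(** The label type is common to all levels, so the higher the level, the more labels denote no
    cell. *)
Lemma cell_notin_central_empty l f : (l <= L)%N -> f \notin central l L -> cell l (Some f) = set0.
Proof.
move=> lL fc; apply/seteqP; split => // x xf.
have xin : cube L x.
  apply/insideE; apply/negPn/negP => /(ancestor_outside l); by rewrite xf.
by move/(cell_central lL (leqnn L) xf): xin; rewrite (negPf fc).
Qed.

End cells.

(** * Bounding the transport cost by differences of cell masses *)

Section transport.
Context (R : realType) (d : nat) (p r : R) (L : nat).
Hypothesis r0 : 0 < r.
Hypothesis p0 : 0 < p.
Variables (nu0 nu1 : probability (d.-tuple R) R).

Local Notation kappa := (@cell_label R d r L).
Local Notation anc := (@ancestor d L).
Local Notation rho := (@rho R r L).

(** Bounds the p-th power of the distance between two points of one cell: d times the side exceeds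
    the diameter. *)
Definition scale_cost l : R := (d%:R * (2 * rho l)) `^ p.

(** Pays for pairs with a point outside the cube: an outer point has norm at least r, so the outer
    point of larger norm bounds all coordinates of both. *)
Definition outer_cost (x : d.-tuple R) : \bar R :=
  ((2 * d%:R * enorm x) `^ p * \1_(~` cube r L L) x)%:E.

Lemma outer_cost_ge0 x : (0 <= outer_cost x)%E.
Proof. by rewrite lee_fin mulr_ge0// powR_ge0. Qed.

Lemma measurable_outer_cost : measurable_fun setT outer_cost.
Proof.
apply/measurable_EFinP; apply: measurable_funM; last first.
  by apply: measurable_indic; apply: measurableC; exact: measurable_cube.
apply: (measurableT_comp (measurable_powR p)).
by apply: measurable_funM => //; exact: measurable_enorm.
Qed.

Let meets i j : exists l, anc l i == anc l j.
Proof. by exists L.+1; apply/eqP; exact: ancestor_last. Qed.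

Let meet_level i j : nat := ex_minn (meets i j).

(** Pairs with an outer label are free here, since [outer_cost] pays for them. *)
Let label_cost (i j : label d L) : R :=
  if (i != None) && (j != None) then scale_cost (meet_level i j) else 0.

Lemma scale_cost_ge0 l : 0 <= scale_cost l. Proof. exact: powR_ge0. Qed.

Let rho_ge0 l : 0 <= rho l. Proof. exact/ltW/rho_gt0. Qed.

Lemma scale_cost_homo l m : (l <= m)%N -> scale_cost l <= scale_cost m.
Proof.
move=> lm; have h k : 0 <= d%:R * (2 * rho k) by do 2 rewrite mulr_ge0//; exact: rho_ge0.
apply: ge0_ler_powR; rewrite ?nnegrE; [exact: ltW|exact: h|exact: h|].
do 2 apply: ler_wpM2l => //; apply: ler_wpM2r; first by rewrite invr_ge0 exprn_ge0.
by rewrite ler_pM2l// ler_weXn2l// ler1n.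
Qed.

Let label_cost_le l i j : anc l i = anc l j -> label_cost i j <= scale_cost l.
Proof.
move=> ij; rewrite /label_cost; case: ifP => _; last exact: scale_cost_ge0.
apply: scale_cost_homo; rewrite /meet_level; case: ex_minnP => m _; apply.
exact/eqP.
Qed.

Let cost_pointwise x y : (((Defs.edist x y) `^ p)%:E <=
  (label_cost (kappa x) (kappa y))%:E + outer_cost x + outer_cost y)%E.
Proof.
rewrite /outer_cost -!EFinD lee_fin.
have out (z : d.-tuple R) : ~~ inside r z -> (\1_(~` cube r L L) z : R) = 1.
  by move=> zo; rewrite indicE mem_set//= => /(@insideE R d r L); exact/negP.
have outn (z : d.-tuple R) : ~~ inside r z -> r <= enorm z.
  move=> zo; rewrite -(@rhoL R r L); apply: notin_cube_enorm => /(@insideE R d r L).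
  exact/negP.
have nonneg (z : d.-tuple R) : 0 <= (2 * d%:R * enorm z) `^ p * \1_(~` cube r L L) z.
  by rewrite mulr_ge0// powR_ge0.
have lc0 i j : 0 <= label_cost i j.
  by rewrite /label_cost; case: ifP => // _; exact: scale_cost_ge0.
have far (u v : d.-tuple R) M : 0 <= M -> enorm u <= M -> enorm v <= M ->
    Defs.edist u v `^ p <= (2 * d%:R * M) `^ p.
  move=> M0 uM vM; apply: ge0_ler_powR; rewrite ?nnegrE; [exact: ltW|exact: sqrtr_ge0|by rewrite !mulr_ge0|].
  rewrite mulrAC [2 * M * _]mulrC; apply: edist_le; first by rewrite mulr_ge0.
  move=> i; rewrite (le_trans (ler_normB _ _))// mulr_natl mulr2n lerD//.
    by rewrite (le_trans (norm_tnth_le_enorm _ _)).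
  by rewrite (le_trans (norm_tnth_le_enorm _ _)).
have near (u v : d.-tuple R) M : 0 <= M -> (forall i, `|tnth u i| <= M) -> (forall i, `|tnth v i| <= M) ->
    Defs.edist u v `^ p <= (2 * d%:R * M) `^ p.
  move=> M0 uM vM; apply: ge0_ler_powR; rewrite ?nnegrE; [exact: ltW|exact: sqrtr_ge0|by rewrite !mulr_ge0|].
  rewrite mulrAC [2 * M * _]mulrC; apply: edist_le; first by rewrite mulr_ge0.
  by move=> i; rewrite (le_trans (ler_normB _ _))// mulr_natl mulr2n lerD.
have innorm (z : d.-tuple R) i : inside r z -> `|tnth z i| <= r.
  by move=> /insideP/(_ i)/andP[? ?]; rewrite ler_norml; apply/andP; split; lra.
have [xin|xo] := boolP (inside r x); have [yin|yo] := boolP (inside r y).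
- apply: (@le_trans _ _ (label_cost (kappa x) (kappa y))); last by rewrite -addrA lerDl addr_ge0.
  rewrite /label_cost {1}/cell_label xin {1}/cell_label yin /=.
  have h k : 0 <= d%:R * (2 * rho k) by do 2 rewrite mulr_ge0//; exact: rho_ge0.
  apply: ge0_ler_powR; rewrite ?nnegrE; [exact: ltW|exact: sqrtr_ge0|exact: h|].
  apply: edist_le; first by rewrite mulr_ge0.
  move=> i; apply: same_ancestor_dist => //.
  by rewrite /meet_level; case: ex_minnP => m /eqP.
- apply: (@le_trans _ _ ((2 * d%:R * enorm y) `^ p * \1_(~` cube r L L) y)); last first.
    by rewrite lerDr addr_ge0.
  rewrite out// mulr1; apply: near; first exact: enorm_ge0.
    by move=> i; rewrite (le_trans (innorm _ _ xin))// outn.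
  by move=> i; exact: norm_tnth_le_enorm.
- apply: (@le_trans _ _ ((2 * d%:R * enorm x) `^ p * \1_(~` cube r L L) x)); last first.
    by rewrite addrAC lerDr addr_ge0.
  rewrite out// mulr1; apply: near; first exact: enorm_ge0.
    by move=> i; exact: norm_tnth_le_enorm.
  by move=> i; rewrite (le_trans (innorm _ _ yin))// outn.
- have [xy|yx] := leP (enorm x) (enorm y).
    apply: (@le_trans _ _ ((2 * d%:R * enorm y) `^ p * \1_(~` cube r L L) y)); last first.
      by rewrite lerDr addr_ge0.
    by rewrite out// mulr1; apply: far => //; exact: enorm_ge0.
  apply: (@le_trans _ _ ((2 * d%:R * enorm x) `^ p * \1_(~` cube r L L) x)); last first.
    by rewrite addrAC lerDr addr_ge0.
  by rewrite out// mulr1; apply: far => //; [exact: enorm_ge0|exact: ltW].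
Qed.

Let mkappa k : measurable (kappa @^-1` [set k]).
Proof. exact: measurable_cell_label. Qed.

Let fibers_cell (nu : probability (d.-tuple R) R) l k :
  class_sum (anc l) (fun i => fine (nu (kappa @^-1` [set i]))) k = fine (nu (cell r l k)).
Proof.
rewrite (@measure_fiber_sum _ _ _ _ nu kappa (cell r l k))//; last exact: measurable_cell.
rewrite /class_sum big_mkcond/=; apply: eq_bigr => i _; case: ifP => [/eqP <-|/eqP ik].
  by congr (fine (nu _)); apply/seteqP; split => [x <-|x []].
rewrite (_ : _ `&` _ = set0) ?measure0//.
by apply/seteqP; split => // x [xk xi]; apply: ik; rewrite -xi.
Qed.

(** Level L + 1 is a root joining the cube to its outside; what cannot be matched on level L is
    moved there. *)
Lemma transport_le :
  (Tcost p nu0 nu1 <= (scale_cost 0 + \sum_(l < L.+1) scale_cost l.+1 *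
     \sum_(k : label d L) `|fine (nu0 (cell r l k)) - fine (nu1 (cell r l k))|)%:E +
     \int[nu0]_x outer_cost x + \int[nu1]_x outer_cost x)%E.
Proof.
pose P0 i := fine (nu0 (kappa @^-1` [set i])); pose P1 i := fine (nu1 (kappa @^-1` [set i])).
have sum1 (nu : probability (d.-tuple R) R) : \sum_i fine (nu (kappa @^-1` [set i])) = 1.
  have := measure_fiber_sum nu mkappa measurableT; rewrite probability_setT => -[] /esym.
  by under eq_bigr do rewrite setTI.
have [||||pi [pi0 pip piq pic]] := @tree_coupling R _ _ anc label_cost scale_cost
  (@ancestor_nested _ _) scale_cost_ge0 label_cost_le P0 P1 _ _ L.+1.
- by move=> i; exact: fine_ge0.
- by move=> i; exact: fine_ge0.
- exact: ancestor_last.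
- by rewrite !sum1.
have [|||||Pi [cPi lePi]] := @lift_coupling _ _ _ _ nu0 nu1 kappa mkappa pi pi0 pip piq label_cost
  (fun z => ((Defs.edist z.1 z.2) `^ p)%:E) outer_cost.
- by move=> i j; rewrite /label_cost; case: ifP => // _; exact: scale_cost_ge0.
- exact: measurable_outer_cost.
- exact: outer_cost_ge0.
- by move=> z; rewrite lee_fin powR_ge0.
- exact: cost_pointwise.
apply: (@le_trans _ _ (\int[Pi]_z ((Defs.edist z.1 z.2) `^ p)%:E)%E).
  by apply: ereal_inf_lbound; exists Pi.
apply: (le_trans lePi); rewrite leeD2r// leeD2r// lee_fin.
apply: (le_trans pic); rewrite sum1 mulr1 lerD2l; apply: ler_sum => l _.
rewrite ler_wpM2l ?scale_cost_ge0//; apply: ler_sum => k _.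
by rewrite class_sumB !fibers_cell.
Qed.

End transport.

(** Couplings see their marginals on measurable sets only, so the set function [empirical] can be
    exchanged for a genuine probability. *)
Lemma eq_Tcost (R : realType) (d : nat) (p : R) (nu0 nu0' nu1 : set (d.-tuple R) -> \bar R) :
  (forall A, measurable A -> nu0 A = nu0' A) -> Tcost p nu0 nu1 = Tcost p nu0' nu1.
Proof.
move=> E; congr ereal_inf; apply/seteqP; split => _ [pi cpi <-]; exists pi => // A mA.
  by rewrite -E//; exact: cpi.
by rewrite E//; exact: cpi.
Qed.

(** * The empirical measure as a random probability *)

Section empirical_measure.
Context (R : realType) (d : nat) (dO : measure_display).
Context (Omega : measurableType dO) (P : probability Omega R).
Variables (X : R -> Omega -> d.-tuple R).
Variables (Pk : R -> d.-tuple R -> probability (d.-tuple R) R).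
Variable mu : probability (d.-tuple R) R.
Hypothesis markov : markov_process P X Pk mu.
Hypothesis inv : mu_invariant Pk mu.
Variable T : R.
Hypothesis T0 : 0 < T.

Lemma measurable_path w : measurable_fun setT (fun t => X t w).
Proof. exact: measurableT_comp (measurable_process markov) (pair2_measurable w). Qed.

Let T1_ge0 : 0 <= T^-1. Proof. by rewrite invr_ge0 ltW. Qed.

Let emp0 w : {measure set (d.-tuple R) -> \bar R} :=
  mscale (NngNum T1_ge0) (mpush (lebI T) (measurable_path w)).

Let emp0T w : emp0 w setT = 1%E.
Proof.
transitivity (T^-1%:E * lebI T setT)%E => //.
by rewrite lebI_setTE ?(ltW T0)// -EFinM mulVf// gt_eqF.
Qed.

Definition emp w : probability (d.-tuple R) R := mprob (emp0T w).

Lemma empE w A : measurable A -> emp w A = empirical X T w A.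
Proof.
move=> mA; transitivity (T^-1%:E * lebI T ((fun t => X t w) @^-1` A))%E => //.
have mXA : measurable ((fun t => X t w) @^-1` A).
  by rewrite -[X in measurable X]setTI; exact: measurable_path.
congr (_ * _)%E; rewrite lebIE -lebesgue_measure_setIcc_co//.
by rewrite (_ : (fun t => _) = (EFin \o \1_((fun t => X t w) @^-1` A)))// integral_indic.
Qed.

Lemma fine_emp w A : measurable A ->
  fine (emp w A) = T^-1 * \int[lebI T]_t (\1_A (X t w)).
Proof.
move=> mA; have mXA : measurable ((fun t => X t w) @^-1` A).
  by rewrite -[X in measurable X]setTI; exact: measurable_path.
transitivity (fine (T^-1%:E * lebI T ((fun t => X t w) @^-1` A))%E) => //.
rewrite fineM//; last by rewrite fin_num_measure.
by congr (_ * _); rewrite -(Rint_indic (lebI T) mXA).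
Qed.

Lemma ge0_integral_emp w f : measurable_fun setT f -> (forall x, 0 <= f x)%E ->
  (\int[emp w]_x f x = T^-1%:E * \int[lebI T]_t f (X t w))%E.
Proof.
move=> mf f0; rewrite (@eq_measure_integral _ _ _ _ (emp0 w))//.
rewrite ge0_integral_mscale//; congr (_ * _)%E.
have := @ge0_integral_pushforward _ _ _ _ R _ (measurable_path w) (lebI T) setT f measurableT mf.
by rewrite preimage_setT => -> // y _; exact: f0.
Qed.

Lemma measurable_ge0_integral_emp f : measurable_fun setT f -> (forall x, 0 <= f x)%E ->
  measurable_fun setT (fun w => \int[emp w]_x f x)%E.
Proof.
move=> mf f0; under eq_fun do rewrite ge0_integral_emp//.
apply: measurable_funeM.
apply: (@measurable_fun_fubini_tonelli_G _ _ _ _ _ (lebI T) (fun tw : R * Omega => f (X tw.1 tw.2))) => //.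
exact: measurableT_comp mf (measurable_process markov).
Qed.

Lemma expectation_ge0_integral_emp f : measurable_fun setT f -> (forall x, 0 <= f x)%E ->
  (\int[P]_w \int[emp w]_x f x = \int[mu]_x f x)%E.
Proof.
move=> mf f0; under eq_integral do rewrite ge0_integral_emp//.
have mfX : measurable_fun setT (fun tw : R * Omega => f (X tw.1 tw.2)).
  exact: measurableT_comp mf (measurable_process markov).
rewrite ge0_integralZl//; last 2 first.
- exact: (@measurable_fun_fubini_tonelli_G _ _ _ _ _ (lebI T) (fun tw : R * Omega => f (X tw.1 tw.2))).
- by move=> w _; exact: integral_ge0.
rewrite -(@fubini_tonelli _ _ _ _ _ (lebI T) P _ mfX)//=.
have mG : measurable_fun setT (fun t => \int[P]_w f (X t w))%E.
  exact: (@measurable_fun_fubini_tonelli_F _ _ _ _ _ P (fun tw : R * Omega => f (X tw.1 tw.2))).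
have G0 t : (0 <= \int[P]_w f (X t w))%E by exact: integral_ge0.
have mI : measurable (`[0, T[%classic : set R) by exact: measurable_itv.
(* Stationarity is known for nonnegative times only, so the time interval is made explicit as an
   indicator before it is applied. *)
rewrite (@eq_measure_integral _ _ _ _ (mrestr (@lebR R) mI))//.
rewrite integral_mrestr//.
rewrite (eq_integral (fun t => (\int[mu]_x f x) * (\1_(`[0, T[%classic : set R) t)%:E)%E); last first.
  move=> t _; rewrite indicE; case: (boolP (t \in _)) => [|_]; last by rewrite !mule0.
  rewrite inE/= in_itv/= => /andP[t0 _]; congr (_ * _)%E.
  exact: (ge0_integral_marginal markov inv).
rewrite ge0_integralZl//; last 2 first.
- by apply/measurable_EFinP; exact: measurable_indic.
- exact: integral_ge0.
rewrite integral_indic// setIT.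
transitivity (T^-1%:E * (\int[mu]_x f x * T%:E))%E.
  by congr (_ * (_ * _))%E; rewrite -(lebI_setTE (ltW T0)) lebIE setTI.
by rewrite muleCA -EFinM mulVf ?mule1// gt_eqF.
Qed.

End empirical_measure.

Lemma bmf_sum d (T : measurableType d) (R : realType) (J : Type) (s : seq J)
    (f : J -> T -> R) : (forall j, bmf (f j)) -> bmf (fun x => \sum_(j <- s) f j x).
Proof.
move=> bf; elim: s => [|j s ih].
  by under eq_fun do rewrite big_nil; exact: bmf_cst.
by under eq_fun do rewrite big_cons; exact: bmfD.
Qed.

Lemma Rint_sum d (T : measurableType d) (R : realType) (J : Type) (s : seq J)
    (m : {finite_measure set T -> \bar R}) (f : J -> T -> R) : (forall j, bmf (f j)) ->
  \int[m]_x (\sum_(j <- s) f j x) = \sum_(j <- s) \int[m]_x f j x.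
Proof.
move=> bf; elim: s => [|j s ih].
  by under eq_Rintegral do rewrite big_nil; rewrite Rint_cst mul0r big_nil.
under eq_Rintegral do rewrite big_cons.
by rewrite RintD ?ih ?big_cons//; exact: bmf_sum.
Qed.

Lemma big_option_sum (R : nmodType) (A : finType) (F : option A -> R) :
  \sum_k F k = F None + \sum_a F (Some a).
Proof.
rewrite (bigD1 None)//=; congr (_ + _).
rewrite (reindex_omap Some id)/=; last by case.
by apply: eq_bigl => a; rewrite eqxx.
Qed.

(** * Expected deviations, summed over the cells of a level *)

Section deviation.
Context (R : realType) (d : nat) (dO : measure_display).
Context (Omega : measurableType dO) (P : probability Omega R).
Variables (X : R -> Omega -> d.-tuple R).
Variables (Pk : R -> d.-tuple R -> probability (d.-tuple R) R).
Variable mu : probability (d.-tuple R) R.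
Hypothesis markov : markov_process P X Pk mu.
Hypothesis inv : mu_invariant Pk mu.
Hypothesis sc : strongly_continuous Pk mu.
Variable lam : R.
Hypothesis lam0 : 0 < lam.
Hypothesis coer : coercive Pk mu lam.
Variable T : R.
Hypothesis T0 : 0 < T.
Implicit Types B Z : set (d.-tuple R).

Let nuT w : probability (d.-tuple R) R := emp markov T0 w.

Lemma bmf_emp B : measurable B -> bmf (fun w => fine (nuT w B)).
Proof.
move=> mB.
have bXB : bmf (fun wt : Omega * R => (\1_B (X wt.2 wt.1) : R)).
  have : bmf (fun tw : R * Omega => (\1_B (X tw.1 tw.2) : R)).
    have := bmf_process_shift markov 0 (bmf_indic R mB); congr bmf; apply/funext => tw.
    by rewrite add0r.
  have ms : measurable_fun setT (fun wt : Omega * R => (wt.2, wt.1)) by exact: measurable_fun_pair.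
  exact: (bmf_comp ms).
have := bmfZ T^-1 (bmf_fst (lebI T) bXB); congr bmf; apply/funext => w.
by rewrite fine_emp.
Qed.

Lemma emp_mean B : measurable B -> \int[P]_w fine (nuT w B) = fine (mu B).
Proof.
move=> mB; have b1 := bmf_indic R mB.
have : (\int[P]_w \int[nuT w]_x (\1_B x)%:E = \int[mu]_x (\1_B x)%:E)%E.
  apply: (expectation_ge0_integral_emp markov inv T0) => //.
  by apply/measurable_EFinP; exact: measurable_indic.
rewrite integral_indic// setIT => E; rewrite -E; congr fine.
apply: eq_integral => w _; rewrite integral_indic// setIT fineK//.
exact: fin_num_measure.
Qed.

Definition deviation B : R := \int[P]_w `|fine (nuT w B) - fine (mu B)|.

Let bmf_dev B : measurable B -> bmf (fun w => `|fine (nuT w B) - fine (mu B)|).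
Proof. by move=> mB; apply: bmf_norm; apply: bmfB; [exact: bmf_emp|exact: bmf_cst]. Qed.

Lemma deviation_ge0 B : 0 <= deviation B.
Proof. by apply: Rintegral_ge0 => w _; exact: normr_ge0. Qed.

Lemma deviation_set0 : deviation set0 = 0.
Proof.
rewrite /deviation; under eq_Rintegral do rewrite !measure0 subrr normr0.
by rewrite Rint_cstP.
Qed.

(** The cell around the origin may have mass close to 1; its complement is a tail set of small
    mass. *)
Lemma deviationC B : measurable B -> deviation (~` B) = deviation B.
Proof.
move=> mB; apply: eq_Rintegral => w _.
have E (nu : probability (d.-tuple R) R) : fine (nu (~` B)) = 1 - fine (nu B).
  by rewrite probability_setC// fineB// fin_num_measure.
rewrite !E distrC; congr `|_|; lra.
Qed.

Lemma deviation_le_mass B : measurable B -> deviation B <= 2 * fine (mu B).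
Proof.
move=> mB; have bE := bmf_emp mB.
apply: (@le_trans _ _ (\int[P]_w (fine (nuT w B) + fine (mu B)))).
  apply: le_Rint; [exact: bmf_dev|exact: bmfD bE (bmf_cst _ _)|] => w.
  by rewrite (le_trans (ler_normB _ _))// !ger0_norm// fine_ge0.
by rewrite RintD//; [rewrite emp_mean// Rint_cstP mulr_natl mulr2n|exact: bmf_cst].
Qed.

(** From 2 |a| <= theta a^2 + 1 / theta. A common [theta] for a family of cells, optimised after
    summation, replaces the Cauchy-Schwarz inequality. *)
Lemma deviation_le_variance (theta : R) B : measurable B -> 0 < theta ->
  deviation B <= (theta * (4 * fine (mu B) / (lam * T)) + theta^-1) / 2.
Proof.
move=> mB th0; have bE := bmf_emp mB.
have bD : bmf (fun w => fine (nuT w B) - fine (mu B)) by apply: bmfB => //; exact: bmf_cst.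
have := variance_empirical markov inv sc lam0 coer mB T0.
under eq_Rintegral do rewrite -(fine_emp markov T0)//.
rewrite -/nuT => var.
have bD2 := bmfZ (theta / 2) (bmfX2 bD).
apply: (@le_trans _ _ (\int[P]_w (theta / 2 * (fine (nuT w B) - fine (mu B)) ^+ 2 + theta^-1 / 2))).
  apply: le_Rint; [exact: bmf_dev|exact: bmfD bD2 (bmf_cst _ _)|] => w.
  move: (fine _ - _) => a; rewrite -[a ^+ 2]real_normK ?num_real// -subr_ge0.
  have tn0 : theta != 0 by rewrite gt_eqF.
  rewrite (_ : _ - _ = theta / 2 * (`|a| - theta^-1) ^+ 2); last by field.
  by rewrite mulr_ge0 ?sqr_ge0// divr_ge0// ltW.
rewrite RintD//; last exact: bmf_cst.
rewrite RintZ; last exact: bmfX2.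
rewrite Rint_cstP mulrDl lerD2r mulrAC ler_wpM2r// ler_wpM2l// ltW//.
Qed.

Definition dev_bound (N eps : R) := Num.min (2 * eps) (Num.sqrt (4 * eps * N / (lam * T))).

Lemma dev_bound_ge0 N eps : 0 <= eps -> 0 <= dev_bound N eps.
Proof. by move=> e0; rewrite /dev_bound le_min sqrtr_ge0 mulr_ge0. Qed.

Lemma deviation_family (J : finType) (S : {set J}) (B : J -> set (d.-tuple R)) Z (N eps : R) :
  0 < eps -> 0 < N -> (forall j, measurable (B j)) ->
  (forall i j x, B i x -> B j x -> i = j) ->
  measurable Z -> (forall j, j \in S -> B j `<=` Z) ->
  fine (mu Z) <= eps -> #|S|%:R <= N -> \sum_(j in S) deviation (B j) <= dev_bound N eps.
Proof.
move=> eps0 N0 mB dB mZ BZ Zeps SN.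
have mass : \sum_(j in S) fine (mu (B j)) <= eps.
  rewrite (sum_measure_disjoint mu S mB dB); apply: le_trans Zeps.
  have mU : measurable (\bigcup_(j in [set` S]) B j).
    by apply: fin_bigcup_measurable => //; exact: finite_finset.
  apply: fine_le; rewrite ?fin_num_measure//.
  by apply: le_measure; rewrite ?inE// => x [j /= jS /(BZ _ jS)].
rewrite le_min; apply/andP; split.
  apply: (@le_trans _ _ (\sum_(j in S) 2 * fine (mu (B j)))).
    by apply: ler_sum => j _; exact: deviation_le_mass.
  by rewrite -mulr_sumr ler_pM2l.
set s := Num.sqrt _.
have lT0 : 0 < lam * T by exact: mulr_gt0.
have s2 : s ^+ 2 = 4 * eps * N / (lam * T).
  by rewrite sqr_sqrtr// divr_ge0 ?(ltW lT0)// !mulr_ge0 ?(ltW eps0) ?(ltW N0).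
have s0 : 0 < s by rewrite sqrtr_gt0 divr_gt0// !mulr_gt0.
(* theta = N / s balances the variance term and the term 1 / theta summed over at most N cells: each
   becomes at most s. *)
have th0 : 0 < N / s by rewrite divr_gt0.
apply: (@le_trans _ _ (\sum_(j in S) ((N / s * (4 * fine (mu (B j)) / (lam * T)) + (N / s)^-1) / 2))).
  by apply: ler_sum => j _; exact: deviation_le_variance.
rewrite -mulr_suml big_split/= -mulr_sumr sumr_const -mulr_suml -mulr_sumr.
rewrite -[_ *+ #|S|]mulr_natr.
have sn0 : s != 0 by rewrite gt_eqF.
have Nn0 : N != 0 by rewrite gt_eqF.
have lTn0 : lam * T != 0 by rewrite gt_eqF.
rewrite ler_pdivrMr// [s * 2]mulr_natr mulr2n; apply: lerD.
  apply: (@le_trans _ _ (N / s * (4 * eps / (lam * T)))).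
    by rewrite ler_pM2l// ler_pM2r ?invr_gt0// ler_pM2l.
  rewrite (_ : N / s * (4 * eps / (lam * T)) = s ^+ 2 / s); last first.
      have alg (a e m u : R) : u != 0 -> a != 0 -> m / u * (4 * e / a) = 4 * e * m / a / u.
        by move=> u0 a0; field; rewrite ?u0 ?a0.
      by rewrite s2 alg.
  by rewrite expr2 mulfK.
apply: (@le_trans _ _ ((N / s)^-1 * N)); first by rewrite ler_pM2l ?invr_gt0.
by rewrite invf_div divfK.
Qed.

Variables (r : R) (L : nat).
Hypothesis r0 : 0 < r.
Variable eps : nat -> R.
Hypothesis eps0 : forall n, 0 < eps n.
(** The tail outside [cube n] serves the complement of the central cell and the outer label; the
    next hypothesis serves the annulus of index n + 1, which lies outside [cube n]. *)
Hypothesis eps_cube : forall n, (n <= L)%N -> fine (mu (~` cube r L n)) <= eps n.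
Hypothesis eps_cubeS : forall n, (n < L)%N -> fine (mu (~` cube r L n)) <= eps n.+1.

Let mcC n : measurable (~` cube r L n : set (d.-tuple R)).
Proof. by apply: measurableC; exact: measurable_cube. Qed.

Let card_bound l n : R := ((3 ^ (n - l)) ^ d)%:R.

Let card_bound_gt0 l n : 0 < card_bound l n.
Proof. by rewrite ltr0n !expn_gt0. Qed.

Let card_bound_ge1 l n : 1 <= card_bound l n.
Proof. by rewrite ler1n !expn_gt0. Qed.

Let mcell l (k : label d L) : measurable (cell r l k : set (d.-tuple R)).
Proof. exact: measurable_cell. Qed.

Let deviation_single B Z (N e : R) : measurable B -> measurable Z -> B `<=` Z ->
  0 < e -> fine (mu Z) <= e -> 1 <= N -> deviation B <= dev_bound N e.
Proof.
move=> mB mZ BZ e0 Ze N1.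
have := @deviation_family unit (finset.setT : {set unit}) (fun=> B) Z N e e0 (lt_le_trans ltr01 N1).
rewrite (eq_bigl xpredT); last by move=> j; rewrite finset.in_setT.
rewrite (big_pred1 tt); last by case.
by apply => //; [case; case|rewrite cardsT card_unit].
Qed.

(** Induction over the cubes: each new index n adds the cells of one annulus, and the base n = l is
    the single cell around the origin. *)
Let deviation_central l n : (l <= n)%N -> (n <= L)%N ->
  \sum_(f in central d L l n) deviation (cell r l (Some f)) <=
  \sum_(l <= m < n.+1) dev_bound (card_bound l m) (eps m).
Proof.
have cell_inj (k k' : label d L) x : cell r l k x -> cell r l k' x -> k = k' by move=> <- <-.
have base m : l = m -> (m <= L)%N -> \sum_(f in central d L l m) deviation (cell r l (Some f)) <=
    \sum_(l <= i < m.+1) dev_bound (card_bound l i) (eps i).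
  move=> <- lL; rewrite big_nat1.
  have : (#|central d L l l| <= 1)%N by apply: leq_trans (card_central d L l l) _; rewrite subnn exp1n.
  rewrite leq_eqVlt ltnS leqn0 => /orP[/cards1P[f cf]|/eqP/cards0_eq ->]; last first.
    by rewrite big_set0 dev_bound_ge0// ltW.
  (* This cell contains [cube l], so its complement lies in the tail measured by [eps l]. *)
  rewrite cf big_set1 -deviationC//.
  apply: (deviation_single _ (mcC l)) => //; last exact: eps_cube.
    by apply: measurableC; exact: mcell.
  apply: subsetC => x xl;  have xin := cube_inside r0 lL xl.
  have [f' xf' _] := ancestor_cell_label r0 lL xin.
  have := xl => /(cell_central r0 (leqnn l) lL xf'); rewrite cf finset.in_set1 => /eqP <-.
  exact: xf'.
elim: n => [|n ih] ln nL; first by move: ln; rewrite leqn0 => /eqP E; exact: base.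
have [E|ltln] := eqVneq l n.+1; first exact: base.
have {ltln}ln' : (l <= n)%N by rewrite -ltnS ltn_neqAle ltln.
rewrite big_nat_recr//= (bigID (fun f => f \in central d L l n))/=; apply: lerD.
  apply: le_trans (ih ln' (ltnW nL)).
  rewrite [leRHS](bigID (fun f => f \in central d L l n.+1))/=.
  rewrite (eq_bigl (fun f => (f \in central d L l n) && (f \in central d L l n.+1))); last first.
    by move=> f; rewrite andbC.
  by rewrite lerDl; apply: sumr_ge0 => f _; exact: deviation_ge0.
rewrite (eq_bigl (fun f => f \in central d L l n.+1 :\: central d L l n)%SET); last first.
  by move=> f; rewrite finset.in_setD andbC.
apply: (@deviation_family _ _ (fun f => cell r l (Some f)) (~` cube r L n)) => //.
- by move=> f f' x /cell_inj H /H[].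
- move=> f; rewrite finset.in_setD => /andP[fn _] x xf xn.
  by move/(cell_central r0 ln' (ltnW nL) xf): xn; rewrite (negPf fn).
- exact: eps_cubeS.
- rewrite ler_nat; apply: leq_trans (card_central d L l n.+1).
  by apply: subset_leq_card; exact: subsetDl.
Qed.

(** The cells inside the cube cost the whole sum and the outer label at most its last term, whence
    the factor 2. *)
Lemma deviation_level l : (l <= L)%N ->
  \sum_(k : label d L) deviation (cell r l k) <=
  2 * \sum_(l <= n < L.+1) dev_bound (card_bound l n) (eps n).
Proof.
move=> lL; rewrite big_option_sum mulr_natl mulr2n lerD//.
  apply: (@le_trans _ _ (dev_bound (card_bound l L) (eps L))).
    apply: (deviation_single (mcell l None) (mcC L)) => //; last exact: eps_cube.
    by move=> x xc; apply/(cell_None r0 x lL).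
  rewrite big_nat_recr//= lerDr big_nat; apply: sumr_ge0 => m _.
  by rewrite dev_bound_ge0// ltW.
apply: le_trans (deviation_central lL (leqnn L)).
rewrite (bigID (fun f => f \in central d L l L))/= [X in _ + X]big1 ?addr0// => f fc.
by rewrite cell_notin_central_empty// deviation_set0.
Qed.

Variable p : R.
Hypothesis p0 : 0 < p.

Lemma expected_Tcost_le :
  (\int[P]_w Tcost p (empirical X T w) mu <=
   (scale_cost d p r L 0 + \sum_(l < L.+1) scale_cost d p r L l.+1 *
     (2 * \sum_(l <= n < L.+1) dev_bound (card_bound l n) (eps n)))%:E +
   2%:E * \int[mu]_x outer_cost p r L x)%E.
Proof.
pose G w : R := scale_cost d p r L 0 + \sum_(l < L.+1) scale_cost d p r L l.+1 *
     \sum_(k : label d L) `|fine (nuT w (cell r l k)) - fine (mu (cell r l k))|.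
pose oc := @outer_cost R d p r L.
have moc : measurable_fun setT oc by exact: measurable_outer_cost.
have oc0 x : (0 <= oc x)%E by exact: outer_cost_ge0.
have bk (l : 'I_L.+1) (k : label d L) := bmf_dev (mcell l k).
have bl (l : 'I_L.+1) : bmf (fun w => scale_cost d p r L l.+1 *
     \sum_(k : label d L) `|fine (nuT w (cell r l k)) - fine (mu (cell r l k))|).
  by apply: bmfZ; apply: bmf_sum => k; exact: bk.
have bG : bmf G.
  by apply: bmfD; [exact: bmf_cst|apply: bmf_sum => l; exact: bl].
have G0 w : 0 <= G w.
  rewrite addr_ge0 ?scale_cost_ge0//; apply: sumr_ge0 => l _.
  by rewrite mulr_ge0 ?scale_cost_ge0//; apply: sumr_ge0 => k _.
have int_oc0 (nu : {measure set (d.-tuple R) -> \bar R}) : (0 <= \int[nu]_x oc x)%E.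
  exact: integral_ge0.
have mo := measurable_ge0_integral_emp markov T0 moc oc0.
have mG : measurable_fun setT (fun w => (G w)%:E) by apply/measurable_EFinP; exact: bG.1.
apply: (@le_trans _ _ (\int[P]_w ((G w)%:E + \int[nuT w]_x oc x + \int[mu]_x oc x))%E).
  (* [Tcost] is not known to be measurable in [w]. *)
  apply: le_integral_nonmeasurable => w.
    by apply: le_ereal_inf_tmp => _ [pi _ <-]; apply: integral_ge0 => z _; rewrite lee_fin powR_ge0.
  rewrite (@eq_Tcost _ _ _ _ (nuT w)); last by move=> A mA; rewrite [RHS](empE markov T0).
  exact: transport_le.
have Goc0 w : (0 <= (G w)%:E + \int[nuT w]_x oc x)%E by rewrite adde_ge0// ?lee_fin.
have mGoc : measurable_fun setT (fun w => (G w)%:E + \int[nuT w]_x oc x)%E.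
  exact: emeasurable_funD.
have split1 := ge0_integralD P measurableT (fun w _ => Goc0 w) mGoc (fun w _ => int_oc0 mu)
  (@measurable_cst _ _ Omega _ setT (\int[mu]_x oc x)%E).
have split2 := ge0_integralD P measurableT (fun w _ => G0 w : (0 <= (G w)%:E)%E) mG
  (fun w _ => int_oc0 (nuT w)) mo.
rewrite [leLHS]split1 [X in (X + _)%E]split2 (expectation_ge0_integral_emp markov inv T0 moc oc0).
rewrite integral_cst// [X in (_ + _ * X)%E]probability_setT mule1 -addeA.
rewrite (_ : (\int[mu]_x oc x + \int[mu]_x oc x = 2%:E * \int[mu]_x oc x)%E); last first.
  by rewrite mule_natl mule2n.
rewrite leeD2r// -EFin_Rint// lee_fin RintD; [|exact: bmf_cst|by apply: bmf_sum => l; exact: bl].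
rewrite Rint_cstP lerD2l Rint_sum//; apply: ler_sum => l _.
rewrite RintZ; last by apply: bmf_sum => k; exact: bk.
rewrite ler_wpM2l ?scale_cost_ge0// Rint_sum; last by move=> k; exact: bk.
exact: deviation_level (ltn_ord l).
Qed.

End deviation.

(** * Geometric sums over selected indices, uniform in the number of terms *)

Section geometric.
Context (R : realType).
Implicit Types (s W x b Y : R) (w : nat -> R) (Q : pred nat) (N : nat).

Let big_ord_recr_cond Q (F : nat -> R) N :
  \sum_(k < N.+1 | Q k) F k = \sum_(k < N | Q k) F k + if Q N then F N else 0.
Proof. by rewrite big_mkcond big_ord_recr -big_mkcond. Qed.

(** By telescoping, s - 1 times the sum below M is at most w M; apply this just after the last
    selected index, whose weight is at most W. *)
Lemma geometric_below s w W Q N : 1 < s -> (forall k, 0 < w k) ->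
  (forall k, w k.+1 = s * w k) -> 0 <= W -> (forall k, Q k -> w k <= W) ->
  \sum_(k < N | Q k) w k <= s / (s - 1) * W.
Proof.
move=> s1 w0 wS W0 QW; have s10 : 0 < s - 1 by rewrite subr_gt0.
have sw M : (s - 1) * \sum_(k < M | Q k) w k <= w M.
  elim: M => [|M ih]; first by rewrite big_ord0 mulr0 ltW.
  rewrite big_ord_recr_cond mulrDr wS; case: ifP => _; first lra.
  by rewrite mulr0 addr0 (le_trans ih)// ler_peMl// ltW.
rewrite mulrAC ler_pdivlMr// mulrC.
elim: N => [|N ih]; first by rewrite big_ord0 mulr0 mulr_ge0//; lra.
have := sw N.+1; rewrite big_ord_recr_cond; case: ifP => [QN|_ _]; last by rewrite addr0.
by move=> /le_trans; apply; rewrite wS ler_wpM2l ?QW//; lra.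
Qed.

(** Induction with a reserve: s / w M is s - 1 times the complete tail of the series from M on, and
    the maximum with W caps it while the weights are still below W. *)
Lemma geometric_above s w W Q N : 1 < s -> (forall k, 0 < w k) ->
  (forall k, w k.+1 = s * w k) -> 0 < W -> (forall k, Q k -> W <= w k) ->
  \sum_(k < N | Q k) (w k)^-1 <= s / (s - 1) / W.
Proof.
move=> s1 w0 wS W0 QW; have s10 : 0 < s - 1 by rewrite subr_gt0.
have sp : 0 < s by lra.
have mx M : 0 < Num.max (w M) W by rewrite lt_max W0 orbT.
have sw M : (s - 1) * (\sum_(k < M | Q k) (w k)^-1) + s / Num.max (w M) W <= s / W.
  elim: M => [|M ih].
    by rewrite big_ord0 mulr0 add0r ler_pM2l// lef_pV2// ?posrE// le_max lexx orbT.
  rewrite (big_ord_recr_cond Q (fun k => (w k)^-1)); case: ifP => [/QW QM|_]; last first.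
    rewrite addr0; apply: le_trans ih; rewrite lerD2l ler_pM2l// lef_pV2// ?posrE//.
    by rewrite wS ge_max !le_max lexx orbT andbT ler_peMl// ltW.
  apply: le_trans ih; rewrite (max_l QM) max_l; last first.
    by rewrite wS (le_trans QM)// ler_peMl// ltW.
  rewrite wS mulrDr -addrA lerD2l.
  have wM := w0 M; rewrite le_eqVlt; apply/orP; left; apply/eqP.
  by field; rewrite !gt_eqF.
rewrite -mulrA [_ / W]mulrC mulrA ler_pdivlMr// mulrC.
by apply: le_trans (sw N); rewrite lerDl divr_ge0// ltW.
Qed.

(** Each selected index raises ln w by ln s. The weight is clamped to [1, s W] because the one after
    the last selected index can reach s W. *)
Lemma geometric_count s w W Q N : 1 < s -> (forall k, 0 < w k) ->
  (forall k, w k.+1 = s * w k) -> 1 <= W -> (forall k, Q k -> 1 <= w k <= W) ->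
  \sum_(k < N | Q k) 1 <= 1 + ln W / ln s :> R.
Proof.
move=> s1 w0 wS W1 QW; have ls0 : 0 < ln s by exact: ln_gt0.
have sp : 0 < s by lra.
have sW : 1 <= s * W by rewrite (le_trans W1)// ler_peMl; lra.
pose m M := Num.max 1 (Num.min (w M) (s * W)).
have m1 M : 1 <= m M by rewrite le_max lexx.
have sw M : ln s * (\sum_(k < M | Q k) 1) <= ln (m M).
  elim: M => [|M ih]; first by rewrite big_ord0 mulr0 ln_ge0.
  rewrite (big_ord_recr_cond Q (fun=> 1)); case: ifP => [/QW/andP[w1 wW]|_]; last first.
    rewrite addr0 (le_trans ih)// ler_ln ?posrE ?(lt_le_trans ltr01 (m1 _))//.
    rewrite ge_max m1/= le_max; apply/orP; right.
    by rewrite le_min !ge_min lexx orbT andbT wS ler_peMl// ltW.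
  rewrite mulrDr mulr1; apply: (@le_trans _ _ (ln (w M) + ln s)).
    rewrite lerD2r (le_trans ih)// /m min_l ?max_r//.
    by rewrite (le_trans wW)// ler_peMl; lra.
  rewrite -lnM ?posrE// mulrC -wS ler_ln ?posrE//; last exact: lt_le_trans (m1 _).
  by rewrite /m le_max le_min lexx wS/= ler_pM2l// wW orbT.
rewrite -(ler_pM2l ls0) (le_trans (sw N))// mulrDr mulr1 mulrCA divff ?gt_eqF// mulr1.
rewrite -lnM ?posrE//; last by rewrite (lt_le_trans _ W1).
rewrite ler_ln ?posrE//; [|exact: lt_le_trans (m1 _)|exact: lt_le_trans sW].
by rewrite /m ge_max sW ge_min lexx orbT.
Qed.

Lemma powR_expR x b : 0 < x -> x `^ b = expR (b * ln x).
Proof. by move=> x0; rewrite /powR gt_eqF. Qed.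

Lemma powR_ge1 x b : 1 <= x -> 0 <= b -> 1 <= x `^ b.
Proof. by move=> x1 b0; rewrite powR_expR ?(lt_le_trans ltr01)// -expR0 ler_expR mulr_ge0// ln_ge0. Qed.

Definition geometric_factor b : R := 3 `^ b / (3 `^ b - 1).

Let pow3_gt1 b : 0 < b -> 1 < (3 : R) `^ b.
Proof. move=> b0; rewrite powR_expR; last lra.
by rewrite -[ltLHS]expR0 ltr_expR mulr_gt0// ln_gt0// ltr1n. Qed.

Lemma geometric_factor_gt0 b : 0 < b -> 0 < geometric_factor b.
Proof. by move=> /pow3_gt1 b1; rewrite divr_gt0// ?subr_gt0//; lra. Qed.

Let scale_gt0 x k : 0 < x -> 0 < x * 3 ^+ k. Proof. by move=> x0; rewrite mulr_gt0// exprn_gt0. Qed.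

Let pow_scaleS x b k : 0 < x -> (x * 3 ^+ k.+1) `^ b = 3 `^ b * (x * 3 ^+ k) `^ b.
Proof.
by move=> x0; rewrite exprS mulrCA [LHS]powRM// ltW// scale_gt0.
Qed.


Lemma sum_scale_below x b Y Q N : 0 < x -> 0 < b -> 0 <= Y ->
  (forall k, Q k -> x * 3 ^+ k <= Y) ->
  \sum_(k < N | Q k) (x * 3 ^+ k) `^ b <= geometric_factor b * Y `^ b.
Proof.
move=> x0 b0 Y0 QY; apply: (@geometric_below _ (fun k => (x * 3 ^+ k) `^ b)) => [|k|k||k /QY kY].
- exact: pow3_gt1.
- by rewrite powR_gt0// scale_gt0.
- exact: pow_scaleS.
- exact: powR_ge0.
- by apply: ge0_ler_powR; rewrite ?nnegrE ?(ltW b0) ?(ltW (scale_gt0 k x0)).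
Qed.

Lemma sum_scale_above x b Y Q N : 0 < x -> 0 < b -> 0 < Y ->
  (forall k, Q k -> Y <= x * 3 ^+ k) ->
  \sum_(k < N | Q k) (x * 3 ^+ k) `^ (- b) <= geometric_factor b * Y `^ (- b).
Proof.
move=> x0 b0 Y0 QY; rewrite powRN; under eq_bigr do rewrite powRN.
apply: (@geometric_above _ (fun k => (x * 3 ^+ k) `^ b)) => [|k|k||k /QY kY].
- exact: pow3_gt1.
- by rewrite powR_gt0// scale_gt0.
- exact: pow_scaleS.
- by rewrite powR_gt0.
- by apply: ge0_ler_powR; rewrite ?nnegrE ?(ltW b0) ?(ltW Y0) ?(ltW (scale_gt0 k x0)).
Qed.

Lemma count_scale x Y Q N : 0 < x -> 1 <= Y ->
  (forall k, Q k -> 1 <= x * 3 ^+ k <= Y) ->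
  \sum_(k < N | Q k) 1 <= 1 + ln Y / ln 3 :> R.
Proof.
move=> x0 Y1 QY; apply: (@geometric_count _ (fun k => x * 3 ^+ k)) => //.
- by rewrite ltr1n.
- by move=> k; exact: scale_gt0.
- by move=> k; rewrite exprS mulrCA.
Qed.

End geometric.

Lemma triangle_sum (V : nmodType) (f : nat -> nat -> V) N :
  \sum_(l < N) \sum_(l <= n < N) f l n = \sum_(n < N) \sum_(k < n.+1) f (n - k)%N n.
Proof.
elim: N => [|N ih]; first by rewrite !big_ord0.
rewrite big_ord_recr [RHS]big_ord_recr/= -ih big_nat1.
under eq_bigr do rewrite big_nat_recr ?(ltnW (ltn_ord _))//.
rewrite big_split/= -addrA; congr (_ + _).
rewrite [RHS](reindex_inj rev_ord_inj)/= [RHS]big_ord_recr/= subSS subnn subn0.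
by congr (_ + _); apply: eq_bigr => i _; rewrite subSS subKn// ltnW.
Qed.

(** * The sum over scales within an annulus and the sum over radii *)

Section rates.
Context (R : realType).
Implicit Types (e T u b : R).

Lemma expR_powR u b : (expR u) `^ b = expR (b * u).
Proof. by rewrite powR_expR ?expR_gt0// expRK. Qed.

Let one_powR b : 1 `^ b = 1 :> R. Proof. by rewrite powR1. Qed.

(** For T >= 2 the factor ln T may be below 1; dividing a constant by [m0] makes up for a logarithm
    that a term does not itself produce. *)
Let m0 : R := Num.min 1 (ln 2).

Let m0_gt0 : 0 < m0. Proof. by rewrite lt_min ltr01 ln_gt0// ltr1n. Qed.

Lemma log_factor_ge (c : bool) T : 2 <= T -> m0 <= (if c then ln T else 1).
Proof.
by move=> T2; case: c; rewrite ge_min ?lexx// ler_ln ?posrE ?T2 ?orbT// (lt_le_trans _ T2).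
Qed.

Section scale.
Variables (d : nat) (p : R).
Hypothesis d0 : (0 < d)%N.
Hypothesis p0 : 0 < p.

Let dR0 : 0 < d%:R :> R. Proof. by rewrite ltr0n. Qed.
Let dn0 : d%:R != 0 :> R. Proof. by rewrite gt_eqF. Qed.

Let g : R := Num.max 2^-1 (1 - p / d%:R).

Let term e T k := (3 ^+ k) `^ (- p) * Num.min e (Num.sqrt (e * ((3 ^ k) ^ d)%:R / T)).

Let term_le_mass e T k : 0 < e -> term e T k <= e * (1 * 3 ^+ k) `^ (- p).
Proof. by move=> e0; rewrite /term mul1r mulrC ler_wpM2r ?powR_ge0// ge_min lexx. Qed.

Let term_le_sqrt e T k : 0 < e -> 0 < T ->
  term e T k <= e `^ 2^-1 * T `^ (- 2^-1) * (1 * 3 ^+ k) `^ (d%:R / 2 - p).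
Proof.
move=> e0 T0; have z0 : 0 < 3 ^+ k :> R by rewrite exprn_gt0.
apply: (@le_trans _ _ ((3 ^+ k) `^ (- p) * Num.sqrt (e * ((3 ^ k) ^ d)%:R / T))).
  by rewrite ler_wpM2l ?powR_ge0// ge_min lexx orbT.
have a0 : 0 < e * ((3 ^ k) ^ d)%:R / T by rewrite divr_gt0// mulr_gt0// ltr0n !expn_gt0.
have nE : ((3 ^ k) ^ d)%:R = (3 ^+ k) ^+ d :> R by rewrite !natrX.
rewrite -powR12_sqrt ?(ltW a0)// mul1r nE.
rewrite -[e]lnK ?posrE// -[T]lnK ?posrE// -[3 ^+ k]lnK ?posrE//.
rewrite -expRN -!expRM_natl -!expRD !expR_powR -!expRD ler_expR le_eqVlt; apply/orP; left.
by apply/eqP; rewrite -mulr_natl; field.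
Qed.

(** The mass bound decays like 3^(-k p), the variance bound behaves like 3^(k (d/2 - p)). For p <
    d/2 both are geometric on their side of the crossover; for p > d/2 the variance bound alone
    converges from k = 0; for p = d/2 it is constant, and the scales up to the crossover are
    counted. *)
Lemma scale_sum : exists2 C : R, 0 < C & forall T e N, 2 <= T -> 0 < e -> e <= 1 ->
  \sum_(k < N) (3 ^+ k) `^ (- p) * Num.min e (Num.sqrt (e * ((3 ^ k) ^ d)%:R / T)) <=
  C * (e `^ g * T `^ (g - 1)) * (if p == d%:R / 2 then ln T else 1).
Proof.
have [pd|dp|pd] := ltgtP p (d%:R / 2).
- have b0 : 0 < d%:R / 2 - p by rewrite subr_gt0.
  have gE : g = 1 - p / d%:R.
    by rewrite /g max_r// lerBrDr -lerBrDl ler_pdivrMr//; lra.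
  exists (geometric_factor p + geometric_factor (d%:R / 2 - p)).
    by rewrite addr_gt0// geometric_factor_gt0.
  move=> T e N T2 e0 e1; have T0 : 0 < T by rewrite (lt_le_trans _ T2).
  rewrite -/(term e T _) mulr1 mulrDl.
  (* The value of 3^k at which e equals sqrt(e 3^(k d) / T). *)
  set y := (e * T) `^ (d%:R^-1); have y0 : 0 < y by rewrite powR_gt0// mulr_gt0.
  rewrite (bigID (fun k : 'I_N => y <= 1 * 3 ^+ k))/=; apply: lerD.
    apply: (@le_trans _ _ (e * (geometric_factor p * y `^ (- p)))).
      apply: (@le_trans _ _ (e * \sum_(k < N | y <= 1 * 3 ^+ k) (1 * 3 ^+ k) `^ (- p))).
        by rewrite mulr_sumr; apply: ler_sum => k _; exact: term_le_mass.
      by rewrite ler_pM2l//; exact: (@sum_scale_above _ _ _ _ (fun k => y <= 1 * 3 ^+ k)).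
    rewrite mulrCA ler_pM2l ?geometric_factor_gt0// gE /y.
    rewrite -[e]lnK ?posrE// -[T]lnK ?posrE// -expRD !expR_powR -!expRD ler_expR.
    by rewrite le_eqVlt; apply/orP; left; apply/eqP; field.
  apply: (@le_trans _ _ (e `^ 2^-1 * T `^ (- 2^-1) *
      (geometric_factor (d%:R / 2 - p) * y `^ (d%:R / 2 - p)))).
    apply: (@le_trans _ _ (e `^ 2^-1 * T `^ (- 2^-1) *
        \sum_(k < N | ~~ (y <= 1 * 3 ^+ k)) (1 * 3 ^+ k) `^ (d%:R / 2 - p))).
      by rewrite mulr_sumr; apply: ler_sum => k _; exact: term_le_sqrt.
    rewrite ler_wpM2l ?mulr_ge0 ?powR_ge0//.
    apply: (@sum_scale_below _ _ _ _ (fun k => ~~ (y <= 1 * 3 ^+ k))) => //; first exact: ltW.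
    by move=> k; rewrite -ltNge => /ltW.
  rewrite mulrCA ler_pM2l ?geometric_factor_gt0// gE /y.
  rewrite -[e]lnK ?posrE// -[T]lnK ?posrE// -expRD !expR_powR -!expRD ler_expR.
  by rewrite le_eqVlt; apply/orP; left; apply/eqP; field.
- have b0 : 0 < p - d%:R / 2 by rewrite subr_gt0.
  have gE : g = 2^-1.
    by rewrite /g max_l// lerBlDr -lerBlDl ler_pdivlMr//; lra.
  exists (geometric_factor (p - d%:R / 2)); first exact: geometric_factor_gt0.
  move=> T e N T2 e0 e1; have T0 : 0 < T by rewrite (lt_le_trans _ T2).
  rewrite -/(term e T _) mulr1 gE (_ : 2^-1 - 1 = - 2^-1); last by field.
  apply: (@le_trans _ _ (e `^ 2^-1 * T `^ (- 2^-1) *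
      \sum_(k < N) (1 * 3 ^+ k) `^ (- (p - d%:R / 2)))).
    by rewrite mulr_sumr; apply: ler_sum => k _; rewrite opprB; exact: term_le_sqrt.
  rewrite mulrC ler_wpM2r ?mulr_ge0 ?powR_ge0//.
  rewrite -[leRHS]mulr1 -[X in _ <= _ * X](one_powR (- (p - d%:R / 2))).
  apply: (@sum_scale_above _ _ _ _ xpredT) => // k _.
  by rewrite mul1r exprn_ege1// ler1n.
- have gE : g = 2^-1.
    by rewrite /g max_l// lerBlDr -lerBlDl ler_pdivlMr//; lra.
  have l3 : 0 < ln 3 :> R by rewrite ln_gt0// ltr1n.
  have l2 : 0 < ln 2 :> R by rewrite ln_gt0// ltr1n.
  exists (geometric_factor p / ln 2 + ((ln 2)^-1 + (ln 3)^-1)).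
    by rewrite !addr_gt0 ?invr_gt0// divr_gt0// geometric_factor_gt0.
  move=> T e N T2 e0 e1; have T0 : 0 < T by rewrite (lt_le_trans _ T2).
  have lT : 1 <= ln T / ln 2 by rewrite ler_pdivlMr// mul1r ler_ln ?posrE.
  rewrite -/(term e T _) gE (_ : 2^-1 - 1 = - 2^-1); last by field.
  rewrite -mulrA mulrDl !(mulrCA _ (e `^ 2^-1 * T `^ (- 2^-1))).
  set y := (e * T) `^ (d%:R^-1); have y0 : 0 < y by rewrite powR_gt0// mulr_gt0.
  rewrite (bigID (fun k : 'I_N => y <= 1 * 3 ^+ k))/=; apply: lerD.
    apply: (@le_trans _ _ (e * (geometric_factor p * y `^ (- p)))).
      apply: (@le_trans _ _ (e * \sum_(k < N | y <= 1 * 3 ^+ k) (1 * 3 ^+ k) `^ (- p))).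
        by rewrite mulr_sumr; apply: ler_sum => k _; exact: term_le_mass.
      by rewrite ler_pM2l//; exact: (@sum_scale_above _ _ _ _ (fun k => y <= 1 * 3 ^+ k)).
    apply: (@le_trans _ _ (geometric_factor p * (e `^ 2^-1 * T `^ (- 2^-1)))).
      rewrite mulrCA ler_pM2l ?geometric_factor_gt0// /y pd.
      rewrite -[e]lnK ?posrE// -[T]lnK ?posrE// -expRD !expR_powR -!expRD ler_expR.
      by rewrite le_eqVlt; apply/orP; left; apply/eqP; field.
    rewrite mulrC ler_wpM2l ?mulr_ge0 ?powR_ge0// -mulrA ler_peMr//.
      exact/ltW/geometric_factor_gt0.
    by rewrite mulrC.
  apply: (@le_trans _ _ (e `^ 2^-1 * T `^ (- 2^-1) *
        \sum_(k < N | ~~ (y <= 1 * 3 ^+ k)) 1)).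
    rewrite mulr_sumr; apply: ler_sum => k _.
    rewrite (le_trans (term_le_sqrt k e0 T0))// ler_wpM2l ?mulr_ge0 ?powR_ge0//.
    by rewrite -pd subrr powRr0.
  rewrite ler_wpM2l ?mulr_ge0 ?powR_ge0//.
  (* Since e <= 1 the crossover is at most T^(1/d), which gives a count of order ln T uniform in
     e. *)
  have Y1 : 1 <= T `^ (d%:R^-1) by rewrite powR_ge1// ?invr_ge0//; lra.
  apply: (le_trans (@count_scale _ 1 (T `^ (d%:R^-1)) (fun k => ~~ (y <= 1 * 3 ^+ k)) N _ Y1 _)) => //.
    move=> k; rewrite -ltNge => ky; rewrite {1}mul1r exprn_ege1 ?ler1n//= (le_trans (ltW ky))//.
    apply: ge0_ler_powR; rewrite ?nnegrE ?invr_ge0 ?mulr_ge0 ?(ltW e0) ?(ltW T0)//.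
    by rewrite ler_piMl// ltW.
  rewrite mulrDl; apply: lerD; first by rewrite mulrC.
  rewrite mulrC ler_pM2l ?invr_gt0// powR_expR// expRK.
  by rewrite ler_piMl ?ln_ge0 ?invf_le1 ?ler1n//; lra.
Qed.

End scale.

Section radius.
Variables (p q g K : R).
Hypotheses (p0 : 0 < p) (pq : p < q) (g0 : 0 < g) (K1 : 1 <= K).

(** Radii below 1 sum to a constant by the trivial mass bound 1. Above 1 the summand is of order
    rho^(p - g q): convergent for p < g q, dominated by the largest radius T^(1/q) for p > g q, and
    a count of radii for p = g q. *)
Lemma radius_sum : exists2 C : R, 0 < C & forall T x N, 2 <= T -> 0 < x ->
  (forall n, (n < N)%N -> x * 3 ^+ n <= T `^ q^-1) ->
  \sum_(n < N) (x * 3 ^+ n) `^ p * (Num.min 1 (K * (x * 3 ^+ n) `^ (- q))) `^ g <=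
  C * T `^ (Num.max g (p / q) - g) * (if g * q == p then ln T else 1).
Proof.
have q0 : 0 < q := lt_trans p0 pq.
have K0 : 0 < K := lt_le_trans ltr01 K1.
have Kg : 0 < K `^ g by rewrite powR_gt0.
have l3 : 0 < ln 3 :> R by rewrite ln_gt0// ltr1n.
have l2 : 0 < ln 2 :> R by rewrite ln_gt0// ltr1n.
pose F x n : R := (x * 3 ^+ n) `^ p * (Num.min 1 (K * (x * 3 ^+ n) `^ (- q))) `^ g.
have low T x N : 2 <= T -> 0 < x -> \sum_(n < N | x * 3 ^+ n <= 1) F x n <=
    geometric_factor p / m0 * T `^ (Num.max g (p / q) - g) * (if g * q == p then ln T else 1).
  move=> T2 x0; apply: (@le_trans _ _ (geometric_factor p * 1 `^ p)).
    apply: le_trans (@sum_scale_below _ x p 1 (fun n => x * 3 ^+ n <= 1) N x0 p0 ler01 _) => //.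
    apply: ler_sum => n _; rewrite /F ler_piMr ?powR_ge0//.
    rewrite -[leRHS](one_powR g); apply: ge0_ler_powR; rewrite ?nnegrE ?(ltW g0) ?ge_min ?lexx//.
    by rewrite le_min ler01 mulr_ge0 ?powR_ge0 ?(ltW K0).
  have := geometric_factor_gt0 p0; move: (geometric_factor p) => G G0.
  rewrite one_powR mulr1 -!mulrA ler_peMr ?(ltW G0)// mulrC ler_pdivlMr// mul1r.
  apply: (@le_trans _ _ (1 * m0)); first by rewrite mul1r.
  apply: ler_pM => //; [exact: ltW| |exact: log_factor_ge].
  by rewrite powR_ge1 ?subr_ge0 ?le_max ?lexx//; lra.
have Fle x n : 0 < x -> F x n <= K `^ g * (x * 3 ^+ n) `^ (p - g * q).
  move=> x0; have z0 : 0 < x * 3 ^+ n by rewrite mulr_gt0// exprn_gt0.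
  apply: (@le_trans _ _ ((x * 3 ^+ n) `^ p * (K * (x * 3 ^+ n) `^ (- q)) `^ g)).
    rewrite ler_wpM2l ?powR_ge0//; apply: ge0_ler_powR.
    - exact: ltW.
    - by rewrite nnegrE le_min ler01 mulr_ge0 ?powR_ge0 ?(ltW K0).
    - by rewrite nnegrE mulr_ge0 ?powR_ge0 ?(ltW K0).
    - by rewrite ge_min lexx orbT.
  rewrite -[x * _]lnK ?posrE// -[K]lnK ?posrE// !expR_powR -expRD expR_powR -!expRD ler_expR.
  by rewrite le_eqVlt; apply/orP; left; apply/eqP; ring.
(* The conjunct n < N carries the bound T^(1/q) on the radii into the geometric lemmas, whose
   selection predicates range over all naturals. *)
suff [C C0 high] : exists2 C : R, 0 < C & forall T x N, 2 <= T -> 0 < x ->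
    (forall n, (n < N)%N -> x * 3 ^+ n <= T `^ q^-1) ->
    \sum_(n < N | (1 < x * 3 ^+ n) && (n < N)%N) (x * 3 ^+ n) `^ (p - g * q) <=
    C * T `^ (Num.max g (p / q) - g) * (if g * q == p then ln T else 1).
  exists (geometric_factor p / m0 + K `^ g * C).
    by apply: addr_gt0; [rewrite divr_gt0// geometric_factor_gt0|rewrite mulr_gt0].
  move=> T x N T2 x0 xT; rewrite (bigID (fun n : 'I_N => x * 3 ^+ n <= 1))/= -/(F _ _) !mulrDl.
  apply: lerD; first exact: low.
  apply: (@le_trans _ _ (K `^ g * \sum_(n < N | (1 < x * 3 ^+ n) && (n < N)%N)
     (x * 3 ^+ n) `^ (p - g * q))); last by rewrite -!mulrA ler_pM2l// !mulrA; exact: high.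
  rewrite mulr_sumr [leRHS](eq_bigl (fun n : 'I_N => ~~ (x * 3 ^+ n <= 1))); last first.
    by move=> n; rewrite ltn_ord andbT ltNge.
  by apply: ler_sum => n _; exact: Fle.
have [pg|gp|pg] := ltgtP p (g * q).
- have b0 : 0 < g * q - p by rewrite subr_gt0.
  exists (geometric_factor (g * q - p)); first exact: geometric_factor_gt0.
  move=> T x N T2 x0 xT; rewrite mulr1 max_l; last by rewrite ler_pdivrMr// ltW.
  rewrite subrr powRr0 -[X in _ <= _ * X](one_powR (- (g * q - p))) -[p - g * q]opprB.
  apply: (@sum_scale_above _ x (g * q - p) 1 (fun n => (1 < x * 3 ^+ n) && (n < N)%N)) => //.
  by move=> n /andP[/ltW].
- have b0 : 0 < p - g * q by rewrite subr_gt0.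
  exists (geometric_factor (p - g * q)); first exact: geometric_factor_gt0.
  move=> T x N T2 x0 xT; have T0 : 0 < T by rewrite (lt_le_trans _ T2).
  rewrite mulr1 max_r; last by rewrite ler_pdivlMr// ltW.
  rewrite (_ : T `^ (p / q - g) = (T `^ q^-1) `^ (p - g * q)); last first.
    rewrite -[T]lnK ?posrE// !expR_powR; congr expR.
    by field; rewrite gt_eqF.
  apply: (@sum_scale_below _ x (p - g * q) _ (fun n => (1 < x * 3 ^+ n) && (n < N)%N)) => //.
    exact: powR_ge0.
  by move=> n /andP[_ /xT].
- exists ((ln 2)^-1 + q^-1 / ln 3).
    by rewrite addr_gt0// ?divr_gt0// invr_gt0.
  move=> T x N T2 x0 xT; have T0 : 0 < T by rewrite (lt_le_trans _ T2).
  rewrite max_l; last by rewrite ler_pdivrMr// pg.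
  rewrite subrr powRr0 mulr1 pg subrr.
  under eq_bigr do rewrite powRr0.
  have Y1 : 1 <= T `^ q^-1 by rewrite powR_ge1// ?invr_ge0 ?(ltW q0)//; lra.
  apply: (le_trans (@count_scale _ x (T `^ q^-1) (fun n => (1 < x * 3 ^+ n) && (n < N)%N) N x0 Y1 _)).
    by move=> n /andP[/ltW -> /xT].
  rewrite powR_expR// expRK mulrDl; apply: lerD.
    by rewrite mulrC ler_pdivlMr// mul1r ler_ln ?posrE.
  by rewrite mulrAC.
Qed.

End radius.

End rates.

Lemma dev_bound_le (R : realType) (lam T N e : R) : 0 < lam -> 0 < T -> 0 <= e -> 0 <= N ->
  dev_bound lam T N e <= 2 * (1 + Num.sqrt lam^-1) * Num.min e (Num.sqrt (e * N / T)).
Proof.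
move=> lam0 T0 e0 N0; have s0 : 0 <= Num.sqrt lam^-1 := sqrtr_ge0 _.
have [_|_] := leP e (Num.sqrt (e * N / T)).
  apply: (@le_trans _ _ (2 * e)); first by rewrite ge_min lexx.
  by rewrite ler_wpM2r// ler_peMr// lerDl.
apply: (@le_trans _ _ (Num.sqrt (4 * e * N / (lam * T)))); first by rewrite ge_min lexx orbT.
rewrite (_ : 4 * e * N / (lam * T) = 2 ^+ 2 * lam^-1 * (e * N / T)); last first.
  by field; rewrite !gt_eqF.
rewrite sqrtrM; last by rewrite mulr_ge0// invr_ge0 ltW.
rewrite sqrtrM// sqrtr_sqr ger0_norm// ler_wpM2r ?sqrtr_ge0// ler_pM2l// lerDr.
exact: ler01.
Qed.

(** * Moment and tail bounds, choice of depth, and the multiscale sum *)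

Section scales.
Context (R : realType) (d : nat) (p q : R).
Hypotheses (d0 : (0 < d)%N) (p0 : 0 < p) (pq : p < q).
Variable mu : probability (d.-tuple R) R.
Hypothesis moment : (\int[mu]_x ((enorm x) `^ q)%:E < +oo)%E.

Let q0 : 0 < q. Proof. exact: lt_trans pq. Qed.

Let M : R := fine (\int[mu]_x ((enorm x) `^ q)%:E).

Let momentE : (\int[mu]_x ((enorm x) `^ q)%:E = M%:E)%E.
Proof.
rewrite fineK// ge0_fin_numE//; apply: integral_ge0 => x _.
by rewrite lee_fin powR_ge0.
Qed.

Lemma moment_ge0 : 0 <= M.
Proof. by rewrite fine_ge0//; apply: integral_ge0 => x _; rewrite lee_fin powR_ge0. Qed.

Let measurable_moment : measurable_fun setT (fun x : d.-tuple R => (enorm x `^ q)%:E).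
Proof.
apply/measurable_EFinP; apply: (measurableT_comp (measurable_powR q)).
exact: measurable_enorm.
Qed.

(** Outside the cube |x| >= r, hence |x|^p <= r^(p-q) |x|^q. *)
Lemma integral_outer_cost_le r L : 0 < r ->
  (\int[mu]_x outer_cost p r L x <= ((2 * d%:R) `^ p * r `^ (p - q) * M)%:E)%E.
Proof.
move=> r0; set c := _ * _ `^ _.
have c0 : 0 <= c by rewrite mulr_ge0 ?powR_ge0.
rewrite EFinM -momentE -ge0_integralZl//; last first.
  by move=> x _; rewrite lee_fin powR_ge0.
apply: ge0_le_integral => //.
- by move=> x _; exact: outer_cost_ge0.
- exact: measurable_outer_cost.
- exact: measurable_funeM.
move=> x _; rewrite /outer_cost -EFinM lee_fin indicE.
have [|_] := boolP (x \in _); last by rewrite mulr0 mulr_ge0 ?powR_ge0.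
rewrite inE => /notin_cube_enorm; rewrite rhoL => rx.
have x0 : 0 < enorm x by rewrite (lt_le_trans r0).
rewrite mulr1 powRM ?mulr_ge0// ?(ltW x0)// /c -mulrA ler_wpM2l ?powR_ge0//.
rewrite !powR_expR// -expRD ler_expR.
have : ln r <= ln (enorm x) by rewrite ler_ln.
move: (ln (enorm x)) (ln r) => v u uv; rewrite -subr_ge0.
rewrite (_ : _ - _ = (q - p) * (v - u)); last by ring.
by rewrite mulr_ge0 ?subr_ge0// ltW.
Qed.

(** Markov's inequality for the q-th moment. *)
Lemma cube_tail r L n : 0 < r ->
  fine (mu (~` cube r L n)) <= M * rho r L n `^ (- q).
Proof.
move=> r0; have rn0 := rho_gt0 L r0 n.
have mC : measurable (~` cube r L n : set (d.-tuple R)).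
  by apply: measurableC; exact: measurable_cube.
have rq : 0 < rho r L n `^ q by rewrite powR_gt0.
rewrite powRN ler_pdivlMr// -lee_fin EFinM fineK ?fin_num_measure// -momentE muleC.
have <- : (\int[mu]_x ((rho r L n `^ q)%:E * (\1_(~` cube r L n) x)%:E) =
    (rho r L n `^ q)%:E * mu (~` cube r L n))%E.
  rewrite ge0_integralZl//=.
  - by rewrite integral_indic// setIT.
  - by apply/measurable_EFinP; exact: measurable_indic.
  - by rewrite lee_fin ltW.
apply: ge0_le_integral => //.
- by move=> x _; rewrite -EFinM lee_fin mulr_ge0// ltW.
- by apply: measurable_funeM; apply/measurable_EFinP; exact: measurable_indic.
move=> x _; rewrite -EFinM lee_fin indicE.
have [|_] := boolP (x \in _); last by rewrite mulr0 powR_ge0.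
rewrite inE => /notin_cube_enorm rx; rewrite mulr1.
by apply: ge0_ler_powR; rewrite ?nnegrE ?enorm_ge0// ltW.
Qed.

(** Fixes the depth [L]: the finest cells must cost no more than 1 / T. A crude choice through 3^L
    >= L + 1 suffices, the scale sums being uniform in the number of levels. *)
Lemma scale_cost_small (r T : R) : 0 < r -> 0 < T -> exists L, scale_cost d p r L 0 <= T^-1.
Proof.
move=> r0 T0; pose b := T `^ (- p^-1); have b0 : 0 < b by rewrite powR_gt0.
pose c : R := d%:R * (2 * r); have c0 : 0 < c by rewrite !mulr_gt0// ltr0n.
exists (Num.truncn (c / b)); set L := Num.truncn _.
have cb : c / b < L.+1%:R by rewrite -truncn_lt_nat ?ltnSn// divr_ge0// ltW.
have e3 : 0 < 3 ^+ L :> R by rewrite exprn_gt0.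
have L3 : L.+1%:R <= 3 ^+ L :> R by rewrite -natrX ler_nat ltn_expl.
have -> : T^-1 = b `^ p.
  rewrite /b -powRrM mulNr mulVf ?gt_eqF// powRN powRr1//; exact: ltW.
rewrite /scale_cost; apply: ge0_ler_powR.
- exact: ltW.
- by rewrite nnegrE !mulr_ge0// ltW// rho_gt0.
- by rewrite nnegrE ltW.
rewrite /rho expr0 mulr1 mulrA mulrA -[_ * 2 * r]mulrA -/c ler_pdivrMr//.
by rewrite mulrC -ler_pdivrMr// (le_trans (ltW cb)).
Qed.

(** With k = n - l, the cost of level l + 1 factors as (6 d)^p rho_n^p 3^(-k p): 2 from the side of
    a cell, 3 from the step to the parent level. The double sum thus takes the form treated by
    [scale_sum] and [radius_sum]. *)
Lemma multiscale_sum_le (r T lam : R) (L : nat) (eps : nat -> R) :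
  0 < r -> 0 < T -> 0 < lam -> (forall n, 0 < eps n) ->
  \sum_(l < L.+1) scale_cost d p r L l.+1 *
    (2 * \sum_(l <= n < L.+1) dev_bound lam T ((3 ^ (n - l)) ^ d)%:R (eps n)) <=
  (d%:R * 6) `^ p * (4 * (1 + Num.sqrt lam^-1)) *
  \sum_(n < L.+1) (rho r L n) `^ p *
    \sum_(k < n.+1) (3 ^+ k) `^ (- p) * Num.min (eps n) (Num.sqrt (eps n * ((3 ^ k) ^ d)%:R / T)).
Proof.
move=> r0 T0 lam0 eps0; set c := 4 * _.
have c0 : 0 <= c by rewrite mulr_ge0// addr_ge0// sqrtr_ge0.
pose f l n := scale_cost d p r L l.+1 * (2 * dev_bound lam T ((3 ^ (n - l)) ^ d)%:R (eps n)).
have -> : \sum_(l < L.+1) scale_cost d p r L l.+1 *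
    (2 * \sum_(l <= n < L.+1) dev_bound lam T ((3 ^ (n - l)) ^ d)%:R (eps n)) =
    \sum_(l < L.+1) \sum_(l <= n < L.+1) f l n.
  by apply: eq_bigr => l _; rewrite !mulr_sumr.
rewrite triangle_sum mulr_sumr; apply: ler_sum => n _.
rewrite !mulr_sumr; apply: ler_sum => k _.
have kn : (k <= n)%N by rewrite -ltnS.
have e3 m : 0 < 3 ^+ m :> R by rewrite exprn_gt0.
have rho0 m : 0 < rho r L m by exact: rho_gt0.
have scE : scale_cost d p r L (n - k).+1 = (d%:R * 6) `^ p * (rho r L n `^ p * (3 ^+ k) `^ (- p)).
  have -> : (3 ^+ k) `^ (- p) = ((3 ^+ k)^-1) `^ p :> R.
    by rewrite -[3 ^+ k]lnK ?posrE// -expRN !expR_powR; congr expR; ring.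
  have h1 : 0 <= (3 ^+ k)^-1 :> R by rewrite invr_ge0 ltW.
  have h2 : 0 <= rho r L n by exact/ltW/rho0.
  have h3 : 0 <= rho r L n / 3 ^+ k by exact: mulr_ge0.
  have h4 : 0 <= d%:R * 6 :> R by exact: mulr_ge0.
  rewrite -powRM// -powRM//.
  rewrite /scale_cost; congr powR; rewrite /rho exprS.
  have : 3 ^+ n = 3 ^+ (n - k) * 3 ^+ k :> R by rewrite -exprD subnK.
  by move=> ->; field; rewrite !gt_eqF.
have rearrange (a b e D m c' : R) : 0 <= a -> 0 <= b -> 0 <= e -> 2 * D <= c' * m ->
    a * (b * e) * (2 * D) <= a * c' * (b * (e * m)).
  move=> a0 b0 e0 Dm; rewrite (_ : a * c' * _ = a * (b * e) * (c' * m)); last by ring.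
  by rewrite ler_wpM2l// !mulr_ge0.
rewrite /f scE subKn//; apply: rearrange; rewrite ?powR_ge0//.
apply: (@le_trans _ _ (2 * (2 * (1 + Num.sqrt lam^-1) *
    Num.min (eps n) (Num.sqrt (eps n * ((3 ^ k) ^ d)%:R / T))))).
  by rewrite ler_pM2l// dev_bound_le// ltW.
by rewrite /c !mulrA -natrM.
Qed.

End scales.

(** * Assembly of the rate *)

Lemma transport_rate (R : realType) (d : nat) (dO : measure_display)
  (Omega : measurableType dO) (P : probability Omega R)
  (X : R -> Omega -> d.-tuple R)
  (Pk : R -> d.-tuple R -> probability (d.-tuple R) R)
  (mu : probability (d.-tuple R) R) (p q lam : R) :
  (0 < d)%N -> markov_process P X Pk mu -> mu_invariant Pk mu ->
  strongly_continuous Pk mu -> 0 < lam -> coercive Pk mu lam ->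
  0 < p -> p < q -> (\int[mu]_x ((enorm x) `^ q)%:E < +oo)%E ->
  let g := Num.max (2^-1) (1 - p / d%:R) in
  exists2 C : R, 0 < C & forall T : R, 2 <= T ->
    (\int[P]_w Tcost p (empirical X T w) mu <=
      (C * T `^ (- (1 - Num.max g (p / q)))
         * (if g * q == p then ln T else 1)
         * (if p == d%:R / 2 then ln T else 1))%:E)%E.
Proof.
move=> d0 markov inv sc lam0 coer p0 pq moment g.
have q0 : 0 < q := lt_trans p0 pq.
have g0 : 0 < g by rewrite lt_max invr_gt0 ltr0n.
set M : R := fine (\int[mu]_x ((enorm x) `^ q)%:E).
have M0 : 0 <= M := moment_ge0 q mu.
have q3 : 1 <= 3 `^ q :> R by rewrite powR_ge1 ?ler1n// ltW.
(* The factor 3^q lets the bound for radius rho_(n+1) also cover the tail outside [cube n]; M + 1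
   ensures K >= 1 even if the moment vanishes. *)
pose K := 3 `^ q * (M + 1).
have MK : M + 1 <= K by rewrite ler_peMl// addr_ge0.
have K1 : 1 <= K by rewrite (le_trans _ MK)// lerDr.
have [C1 C1_gt0 scales] := scale_sum d0 p0.
have [C2 C2_gt0 radii] := radius_sum p0 pq g0 K1.
pose c := (d%:R * 6) `^ p * (4 * (1 + Num.sqrt lam^-1)).
have c0 : 0 <= c by rewrite mulr_ge0 ?powR_ge0// mulr_ge0// addr_ge0// sqrtr_ge0.
pose m0 : R := Num.min 1 (ln 2).
have m0_gt0 : 0 < m0 by rewrite lt_min ltr01 ln_gt0// ltr1n.
(* The 1 pays for the finest cells, the rest for the mass outside the cube under both marginals.
   Neither produces logarithms, hence the division by [m0 * m0] below. *)
pose c' := 1 + 2 * ((2 * d%:R) `^ p * M).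
have c'0 : 0 < c' by rewrite ltr_wpDr// !mulr_ge0 ?powR_ge0.
exists (c * (C1 * C2) + c' / (m0 * m0)).
  by rewrite ltr_wpDl ?divr_gt0 ?mulr_gt0// mulr_ge0// mulr_ge0// ltW.
move=> T T2; have T0 : 0 < T by rewrite (lt_le_trans _ T2).
set LQ := if g * q == p then _ else _; set LT := if p == _ then _ else _.
have LQm : m0 <= LQ by exact: log_factor_ge.
have LTm : m0 <= LT by exact: log_factor_ge.
set mx := Num.max g (p / q); set tau := T `^ _.
pose r := T `^ q^-1; have r0 : 0 < r by rewrite powR_gt0.
have [L small] := scale_cost_small d0 p0 r0 T0.
pose x := r / 3 ^+ L.
have e3 k : 0 < 3 ^+ k :> R by rewrite exprn_gt0.
have x0 : 0 < x by rewrite divr_gt0.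
have rhoE n : rho r L n = x * 3 ^+ n by rewrite /rho /x mulrAC.
pose eps n := Num.min 1 (K * (x * 3 ^+ n) `^ (- q)).
have z0 n : 0 < x * 3 ^+ n by rewrite mulr_gt0.
have eps0 n : 0 < eps n.
  by rewrite lt_min ltr01 mulr_gt0 ?powR_gt0// (lt_le_trans _ K1).
have eps1 n : eps n <= 1 by rewrite ge_min lexx.
have mass1 n : fine (mu (~` cube r L n)) <= 1.
  have mC : measurable (~` cube r L n : set (d.-tuple R)).
    by apply: measurableC; exact: measurable_cube.
  by rewrite -lee_fin fineK ?fin_num_measure// probability_le1.
have tail n : fine (mu (~` cube r L n)) <= M * (x * 3 ^+ n) `^ (- q).
  by rewrite -rhoE; exact: (cube_tail p0 pq moment).
have eps_cube n : (n <= L)%N -> fine (mu (~` cube r L n)) <= eps n.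
  move=> _; rewrite le_min mass1 (le_trans (tail n))// ler_wpM2r ?powR_ge0//.
  by rewrite (le_trans _ MK)// lerDl.
have eps_cubeS n : (n < L)%N -> fine (mu (~` cube r L n)) <= eps n.+1.
  move=> _; rewrite le_min mass1 (le_trans (tail n))//.
  have -> : K * (x * 3 ^+ n.+1) `^ (- q) = (M + 1) * (x * 3 ^+ n) `^ (- q).
    have -> : (x * 3 ^+ n.+1) `^ (- q) = 3 `^ (- q) * (x * 3 ^+ n) `^ (- q).
      by rewrite exprS mulrCA [LHS]powRM// ltW.
    rewrite mulrA; congr (_ * _); rewrite /K powRN mulrAC mulfV ?mul1r//.
  by rewrite ler_wpM2r ?powR_ge0// lerDl.
apply: (le_trans (expected_Tcost_le markov inv sc lam0 coer T0 r0 eps0 eps_cube eps_cubeS p0)).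
apply: (@le_trans _ _ ((scale_cost d p r L 0 + \sum_(l < L.+1) scale_cost d p r L l.+1 *
    (2 * \sum_(l <= n < L.+1) dev_bound lam T ((3 ^ (n - l)) ^ d)%:R (eps n)))%:E +
    2%:E * ((2 * d%:R) `^ p * r `^ (p - q) * M)%:E)%E).
  by rewrite leeD2l// lee_wpmul2l ?lee_fin//; exact: (integral_outer_cost_le pq moment).
rewrite -EFinM -EFinD lee_fin.
set S := \sum_(l < _) _.
have tau0 : 0 < tau by rewrite powR_gt0.
have T1 : 1 <= T by rewrite (le_trans _ T2)// ler1n.
have mxpq : p / q <= mx by rewrite le_max lexx orbT.
have pq0 : 0 < p / q by rewrite divr_gt0.
have small' : scale_cost d p r L 0 <= tau.
  apply: (le_trans small); have -> : T^-1 = T `^ (- 1) by rewrite powR_inv1// ltW.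
  rewrite /tau; apply: ler_powR => //.
  by rewrite lerN2 gerBl (le_trans (ltW pq0)).
have outer' : r `^ (p - q) <= tau.
  rewrite /r -powRrM /tau; apply: ler_powR => //.
  rewrite mulrBr mulVf ?gt_eqF// [q^-1 * p]mulrC opprB lerD2r//.
have S_le : S <= c * (C1 * C2) * tau * LQ * LT.
  apply: (le_trans (multiscale_sum_le d p L r0 T0 lam0 eps0)).
  rewrite -/c; apply: (@le_trans _ _ (c * \sum_(n < L.+1)
      (x * 3 ^+ n) `^ p * (C1 * (eps n `^ g * T `^ (g - 1)) * LT))).
    rewrite ler_wpM2l//; apply: ler_sum => n _.
    by rewrite rhoE ler_wpM2l ?powR_ge0//; exact: scales.
  have -> : \sum_(n < L.+1) (x * 3 ^+ n) `^ p * (C1 * (eps n `^ g * T `^ (g - 1)) * LT) =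
      C1 * T `^ (g - 1) * LT * \sum_(n < L.+1) (x * 3 ^+ n) `^ p * eps n `^ g.
    by rewrite mulr_sumr; apply: eq_bigr => n _; ring.
  have -> : c * (C1 * C2) * tau * LQ * LT =
      c * (C1 * T `^ (g - 1) * LT * (C2 * T `^ (mx - g) * LQ)).
    have -> : tau = T `^ (g - 1) * T `^ (mx - g).
      by rewrite /tau !powR_expR// -expRD; congr expR; ring.
    by ring.
  rewrite ler_wpM2l// ler_wpM2l//; last first.
    apply: radii => // n nL; rewrite -rhoE /rho -mulrA ler_piMr ?(ltW r0)//.
    by rewrite ler_pdivrMr// mul1r ler_weXn2l// ler1n.
  by rewrite !mulr_ge0 ?powR_ge0 ?(ltW C1_gt0)// (le_trans _ LTm)// ltW.
have logs : 1 <= LQ * LT / (m0 * m0).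
  by rewrite ler_pdivlMr ?mulr_gt0// mul1r ler_pM// ltW.
have -> : (c * (C1 * C2) + c' / (m0 * m0)) * tau * LQ * LT =
    c' * tau * (LQ * LT / (m0 * m0)) + c * (C1 * C2) * tau * LQ * LT.
  by move: (m0 * m0)^-1 => i; ring.
rewrite addrAC; apply: lerD => //.
apply: (@le_trans _ _ (c' * tau)); last by rewrite ler_peMr// mulr_ge0 ?ltW.
have -> : c' * tau = tau + 2 * ((2 * d%:R) `^ p * tau * M) by rewrite /c'; ring.
by rewrite lerD// ler_wpM2l// ler_wpM2r// ler_wpM2l ?powR_ge0.
Qed.

Theorem theorem1p3 (R : realType) (d : nat) (dO : measure_display)
  (Omega : measurableType dO) (P : probability Omega R)
  (X : R -> Omega -> d.-tuple R)
  (Pk : R -> d.-tuple R -> probability (d.-tuple R) R)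
  (mu : probability (d.-tuple R) R) (p q : R) :
  (0 < d)%N ->
  markov_process P X Pk mu ->
  mu_invariant Pk mu ->
  mu_ergodic Pk mu ->
  strongly_continuous Pk mu ->
  (exists2 lam : R, 0 < lam & coercive Pk mu lam) ->
  0 < p -> p < q ->
  (\int[mu]_x ((enorm x) `^ q)%:E < +oo)%E ->
  let gamma2 := Num.max (2^-1) (1 - p / d%:R) in
  exists2 C : R, 0 < C &
    (forall T : R, 2 <= T ->
      (\int[P]_w Tcost p (empirical X T w) mu <=
       (C * T `^ (- (1 - Num.max gamma2 (p / q)))
          * (if gamma2 * q == p then ln T else 1)
          * (if p == d%:R / 2 then ln T else 1))%:E)%E)
    /\
    (2 * p < q -> forall T : R, 2 <= T ->
      (\int[P]_w Tcost p (empirical X T w) mu <=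
       (if d%:R / 2 < p then C * T `^ (- 2^-1)
        else if p == d%:R / 2 then C * T `^ (- 2^-1) * ln T
        else C * T `^ (- (p / d%:R)))%:E)%E).
Proof.
move=> d0 markov inv _ sc [lam lam0 coer] p0 pq moment gamma2.
have [C C0 rate] := transport_rate d0 markov inv sc lam0 coer p0 pq moment.
exists C => //; split=> // pq2 T T2; apply: (le_trans (rate T T2)); rewrite lee_fin -/gamma2.
have q0 : 0 < q := lt_trans p0 pq.
have dR0 : 0 < d%:R :> R by rewrite ltr0n.
have half : 2^-1 <= gamma2 by rewrite le_max lexx.
(* As gamma_2 >= 1/2, the assumption q > 2p excludes the critical case gamma_2 q = p and makes
   gamma_2 the larger exponent. *)
have pgq : p < gamma2 * q.
  by rewrite (lt_le_trans _ (ler_wpM2r (ltW q0) half))//; lra.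
rewrite gt_eqF// mulr1 (@max_l _ _ _ (p / q)); last by rewrite ler_pdivrMr// ltW.
have [pd|dp|pE] := ltgtP p (d%:R / 2).
- rewrite mulr1 /gamma2 max_r; first by rewrite subKr.
  by rewrite lerBrDr -lerBrDl ler_pdivrMr//; lra.
- rewrite mulr1 /gamma2 max_l; first by rewrite (_ : 1 - 2^-1 = 2^-1)//; field.
  by rewrite lerBlDr -lerBlDl ler_pdivlMr//; lra.
- rewrite /gamma2 max_l; first by rewrite (_ : 1 - 2^-1 = 2^-1)//; field.
  by rewrite lerBlDr -lerBlDl ler_pdivlMr//; lra.
Qed.
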